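(* Suppose that Assumption 1 and Assumption 2 hold (with functions $b$ and $a$), or that Assumption 1 and Assumption 2' hold (with functions $b$ and $a$). Suppose moreover that $\int \mathrm{d}|\mu|(y)\, e^{a(y)+2b(y)} < \infty$. Then \[ Z = \exp\Bigl\{ \sum_{n\geq1} \int\mathrm{d}\mu(x_1) \cdots \int\mathrm{d}\mu(x_n) \, \varphi(x_1,\dots,x_n) \Bigr\}, \] where the series in the exponential converges absolutely, i.e. $\sum_{n\ge1}\int\mathrm{d}|\mu|(x_1)\cdots\int\mathrm{d}|\mu|(x_n)\,|\varphi(x_1,\dots,x_n)|<\infty$. Furthermore, for $|\mu|$-almost all $x_1 \in \mathbb{X}$, \[ \sum_{n\geq2} n \int\mathrm{d}|\mu|(x_2) \cdots \int\mathrm{d}|\mu|(x_n) \, |\varphi(x_1,\dots,x_n)| \leq \bigl(e^{a(x_1)}-1\bigr) e^{2b(x_1)} \] under Assumptions 1 and 2, and the same bound with $e^{b(x_1)}$ in place of $e^{2b(x_1)}$ under Assumptions 1 and 2'.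
   Context: Let $(\mathbb{X},\mathcal{X},\mu)$ be a measure space with $\mu$ a complex measure, and $|\mu|$ its total variation. Let $u,\zeta$ be complex measurable symmetric functions on $\mathbb{X}\times\mathbb{X}$ with $\zeta(x,y)=e^{-u(x,y)}-1$; the real part of $u$ may take the value $+\infty$, in which case $\zeta(x,y)=-1$. Define \[ Z=\sum_{n\ge0}\frac1{n!}\int\mathrm{d}\mu(x_1)\cdots\int\mathrm{d}\mu(x_n)\prod_{1\le i<j\le n}\bigl(1+\zeta(x_i,x_j)\bigr), \] the $n=0$ term being $1$. Let $\overline u(x,y)=u(x,y)$ if $\mathrm{Re}\,u(x,y)\ne\infty$ and $\overline u(x,y)=1$ if $\mathrm{Re}\,u(x,y)=\infty$. Assumption 1 (stability): there is a nonnegative function $b$ on $\mathbb{X}$ such that for all $n$ and $\otimes^n\mu$-almost all $x_1,\dots,x_n$: $\prod_{1\le i<j\le n}|1+\zeta(x_i,x_j)|\le\prod_{i=1}^n e^{b(x_i)}$. Assumption 2: there is a nonnegative function $a$ on $\mathbb{X}$ such that for almost all $x$: $\int\mathrm{d}|\mu|(y)\,|\zeta(x,y)|\,e^{a(y)+2b(y)}\le a(x)$. Assumption 2': there is a nonnegative function $a$ on $\mathbb{X}$ such that for almost all $x$: $\int\mathrm{d}|\mu|(y)\,|\overline u(x,y)|\,e^{a(y)+b(y)}\le a(x)$. Let $\mathcal{C}_n$ be the set of connected graphs (unoriented, no loops) on vertex set $\{1,\dots,n\}$. Define $\varphi(x_1)=1$ and, for $n\ge2$, $\varphi(x_1,\dots,x_n)=\frac1{n!}\sum_{G\in\mathcal{C}_n}\prod_{\{i,j\}\in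 G}\zeta(x_i,x_j)$ (product over edges of $G$). *)

(* Defs.v *)
From mathcomp Require Import all_boot all_order all_algebra.
From mathcomp Require Import all_classical all_reals all_analysis.
From mathcomp Require Import measurable_realfun.
From mathcomp Require Import complex.
Set Implicit Arguments.
Unset Strict Implicit.
Unset Printing Implicit Defensive.
Import Order.TTheory GRing.Theory Num.Theory.
Import numFieldNormedType.Exports.
Local Open Scope classical_set_scope.
Local Open Scope ring_scope.
Local Open Scope complex_scope.

Section Cluster.
Context {R : realType}.

Definition cRe (z : R[i]) : R := complex.Re z.
Definition cIm (z : R[i]) : R := complex.Im z.

Definition cmod (z : R[i]) : R := Num.sqrt (cRe z ^+ 2 + cIm z ^+ 2).

Definition cexp (z : R[i]) : R[i] :=
  (expR (cRe z))%:C * (cos (cIm z) +i* sin (cIm z)).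

Context {d : measure_display} {X : measurableType d}.

(* The interaction u = ur + i ui : X*X -> C, whose real part ur may be +oo. *)
Definition zeta (ur : X * X -> \bar R) (ui : X * X -> R) (x y : X) : R[i] :=
  if ur (x, y) == +oo%E then -1
  else cexp (- ((fine (ur (x, y))) +i* (ui (x, y)))) - 1.

Definition ubar (ur : X * X -> \bar R) (ui : X * X -> R) (x y : X) : R[i] :=
  if ur (x, y) == +oo%E then 1 else (fine (ur (x, y))) +i* (ui (x, y)).

(* The complex measure mu is represented by its polar decomposition
   d mu = h d|mu|, with nu = |mu| (a finite positive measure) and
   h a measurable phase with |h| = 1. *)
Variable nu : {finite_measure set X -> \bar R}.

Definition cint (g : X -> R[i]) : R[i] :=
  (Rintegral nu setT (fun x => cRe (g x))) +i* (Rintegral nu setT (fun x => cIm (g x))).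

Fixpoint iint (h : X -> R[i]) (n : nat) (F : seq X -> R[i]) : R[i] :=
  match n with
  | 0 => F [::]
  | n'.+1 => cint (fun x => h x * iint h n' (fun s => F (x :: s)))
  end.

Fixpoint iabs (n : nat) (F : seq X -> \bar R) : \bar R :=
  match n with
  | 0 => F [::]
  | n'.+1 => (\int[nu]_x iabs n' (fun s => F (x :: s)))%E
  end.

(* P holds for (x_1,...,x_n) outside a null set of the n-fold product of nu *)
Definition prod_ae (n : nat) (P : seq X -> Prop) : Prop :=
  iabs n (fun s => ((\1_[set s' | ~ P s'] s : R))%:E) = 0%E.

Definition graph_on (n : nat) (G : {set 'I_n * 'I_n}) : bool :=
  [forall e in G, (e.1 < e.2)%N].

Definition gadj (n : nat) (G : {set 'I_n * 'I_n}) : rel 'I_n :=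
  fun i j => ((i, j) \in G) || ((j, i) \in G).

Definition gconnected (n : nat) (G : {set 'I_n * 'I_n}) : bool :=
  [forall i, forall j, connect (gadj G) i j].

Definition phi (ur : X * X -> \bar R) (ui : X * X -> R) (s : seq X) : R[i] :=
  (((size s)`!)%:R)^-1 *
  \sum_(G : {set 'I_(size s) * 'I_(size s)} | graph_on G && gconnected G)
     \prod_(e in G) zeta ur ui (nth point s e.1) (nth point s e.2).

Definition Zterm (ur : X * X -> \bar R) (ui : X * X -> R) (s : seq X) : R[i] :=
  \prod_(i < size s) \prod_(j < size s | (i < j)%N)
     (1 + zeta ur ui (nth point s i) (nth point s j)).

Definition Zpartial (h : X -> R[i]) (ur : X * X -> \bar R) (ui : X * X -> R)
  (N : nat) : R[i] :=
  \sum_(n < N) ((n`!)%:R)^-1 * iint h n (Zterm ur ui).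

Definition logZpartial (h : X -> R[i]) (ur : X * X -> \bar R) (ui : X * X -> R)
  (N : nat) : R[i] :=
  \sum_(1 <= n < N) iint h n (phi ur ui).

End Cluster.

(* Main.v *)
Require Import Defs.
From mathcomp Require Import all_boot all_order all_algebra.
From mathcomp Require Import all_classical all_reals all_analysis.
From mathcomp Require Import measurable_realfun.
From mathcomp Require Import complex ring lra zify.
Set Implicit Arguments.
Unset Strict Implicit.
Unset Printing Implicit Defensive.
Import Order.TTheory GRing.Theory Num.Theory.
Import numFieldNormedType.Exports.
Local Open Scope classical_set_scope.
Local Open Scope ring_scope.
Local Open Scope complex_scope.

(* The stability bound is used through a tree-graph inequality. Let w e = |1 + z e|
   and expand the sum over connected graphs by deletion and contraction, taking
   the edges in decreasing order of w (Kruskal's algorithm). Every connected graph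
   is thereby assigned to a spanning tree T; the edges of T contribute z, the edges
   that close a cycle contribute 1 + z. If |z| <= t max(1, w), the contribution of T
   is at most prod_T t times the product of w over the pairs inside the components
   of some partition of the vertices, and stability bounds this product by
   prod e^b. Both t = |zeta| and t = |ubar| are admissible, so Assumptions 2 and 2'
   are treated at once, and even the first one yields the factor e^b.

   The tree sums are explored root by root, which gives a recursion whose integrated
   form shows by induction that sum_m 1/m! int (rooted forests with roots x_i) is at
   most prod e^{a(x_i)}. This is the pointwise bound; integrating it over x_1
   gives sum_n n int |phi| < oo.

   For Z, splitting a graph along the component of its first vertex yields
   (n + 1) Z_{n+1} = sum_k (k + 1) L_{k+1} Z_{n-k} for the terms Z_n and L_n of the
   two series. Hence z(s) e^{-l(s)}, built from the truncated series with powers of s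
   inserted, has a derivative that is uniformly small on [0, 1], because
   sum n |L_n| and sum |Z_n| are finite; it equals 1 at s = 0. *)

(** Stability controls the product of |1 + zeta| over all pairs of a set of points, while a tree
    expansion leaves such factors on an irregular set of pairs. The decreasing order repairs this.
    As long as w >= 1, a missing factor can be inserted: for a deleted edge because this only
    increases the bound, for a tree edge because max(1, w) in the bound on |z| supplies it. What
    remains is the set of pairs inside the components formed while w >= 1.

    Forests with several roots are needed because exploring a vertex turns its neighbours into
    roots, so that a single tree does not reproduce itself. Each root x contributes sum_k a(x)^k /
    k! <= e^{a(x)}.

    For the exponential formula, z e^{-l} avoids a complex logarithm and the question whether Z
    vanishes. With polynomials in place of series, the real mean value theorem on [0, 1] suffices,
    and no infinite series is differentiated. *)

Section CmodTheory.
Context {R : realType}.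
Implicit Types z w : R[i].

Lemma cmodE z : cmod z = Normc.normc z.
Proof. by case: z. Qed.

Lemma cmodM z w : cmod (z * w) = cmod z * cmod w.
Proof. by rewrite !cmodE Normc.normcM. Qed.

Lemma cmodD z w : cmod (z + w) <= cmod z + cmod w.
Proof. by rewrite !cmodE le_normcD. Qed.

Lemma cmodN z : cmod (- z) = cmod z.
Proof. by rewrite !cmodE normcN. Qed.

Lemma cmod0 : cmod (0 : R[i]) = 0.
Proof. by rewrite cmodE Normc.normc0. Qed.

Lemma cmod1 : cmod (1 : R[i]) = 1.
Proof. by rewrite cmodE Normc.normc1. Qed.

Lemma cmod_ge0 z : 0 <= cmod z.
Proof. exact: sqrtr_ge0. Qed.

Lemma cmod_sum (I : Type) (r : seq I) (P : pred I) (F : I -> R[i]) :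
  cmod (\sum_(i <- r | P i) F i) <= \sum_(i <- r | P i) cmod (F i).
Proof.
elim/big_ind2: _ => [|x a y b xa yb|//]; first by rewrite cmod0.
exact: le_trans (cmodD _ _) (lerD xa yb).
Qed.

Lemma cmod_prod (I : Type) (r : seq I) (P : pred I) (F : I -> R[i]) :
  cmod (\prod_(i <- r | P i) F i) = \prod_(i <- r | P i) cmod (F i).
Proof.
elim/big_ind2: _ => [|x a y b <- <-|//]; first exact: cmod1.
exact: cmodM.
Qed.

Lemma cmod_nat n : cmod (n%:R : R[i]) = n%:R.
Proof. by rewrite cmodE normcMn Normc.normc1. Qed.

End CmodTheory.

(** * Tree-graph inequality *)

Section SubsetSums.
Import mathcomp.boot.fintype mathcomp.boot.finset.
Variables (S : nmodType) (T : finType).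

(** Subsets are sorted by whether they contain [e]. The free predicate [P] lets one lemma serve
    deletion-contraction, the splitting of lists and the expansion of products of [1 + z]. *)
Lemma big_subset_setU1 (e : T) (E : {set T}) (P : pred {set T}) (f : {set T} -> S) :
  e \notin E ->
  \sum_(G : {set T} | (G \subset e |: E) && P G) f G =
  \sum_(G : {set T} | (G \subset E) && P G) f G +
  \sum_(G : {set T} | (G \subset E) && P (e |: G)) f (e |: G).
Proof.
move=> eE; rewrite (bigID (fun G : {set T} => e \in G)) /= addrC; congr (_ + _).
  apply: eq_bigl => G; rewrite andbAC; congr (_ && _).
  apply/andP/idP => [[GE eG]|GE].
    apply/subsetP => x xG; have := subsetP GE x xG.
    by rewrite !inE => /orP[/eqP xe|//]; rewrite -xe xG in eG.
  split; last by apply: contra eE => /(subsetP GE).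
  by apply: (subset_trans GE); apply: subsetUr.
rewrite (reindex_onto (fun G => e |: G) (fun G => G :\ e)) /=; last first.
  by move=> G /andP[_ eG]; rewrite setD1K.
apply: eq_bigl => G; rewrite setU11 andbT.
have [GE|GE] := boolP (G \subset E).
  have eG : e \notin G by apply: contra eE => /(subsetP GE).
  by rewrite setU1K// eqxx andbT setUS.
apply/negbTE; apply: contra GE => /andP[/andP[GE _] /eqP eG].
have eGn : e \notin G by rewrite -eG !inE eqxx.
apply/subsetP => x xG; have := subsetP GE x.
rewrite !inE xG orbT => /(_ isT) /orP[/eqP xe|//].
by rewrite -xe xG in eGn.
Qed.

End SubsetSums.

Section GraphConnect.
Import mathcomp.boot.fintype mathcomp.boot.finset.
Variable n : nat.
Implicit Types (A B G T : {set 'I_n * 'I_n}) (e : 'I_n * 'I_n).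

Definition joined A : rel 'I_n := connect (gadj A).

Lemma gadj_sym A : symmetric (gadj A).
Proof. by move=> x y; rewrite /gadj orbC. Qed.

Lemma joined_sym A x y : joined A x y = joined A y x.
Proof. exact: (sym_connect_sym (@gadj_sym A)). Qed.

Lemma joined_trans A y x z : joined A x y -> joined A y z -> joined A x z.
Proof. exact: connect_trans. Qed.

Lemma joinedS A B x y : A \subset B -> joined A x y -> joined B x y.
Proof.
move=> AB; apply: connect_sub => u v uv; apply: connect1; move: uv.
by rewrite /gadj => /orP[] /(subsetP AB) ->; rewrite ?orbT.
Qed.

Lemma joined_edge A e : e \in A -> joined A e.1 e.2.
Proof. by move=> eA; apply: connect1; rewrite /gadj -surjective_pairing eA. Qed.

Lemma joined_setU1 A e x y : joined (e |: A) x y ->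
  [\/ joined A x y, joined A x e.1 /\ joined A e.2 y |
      joined A x e.2 /\ joined A e.1 y].
Proof.
case/connectP => p; elim: p x => [|z p IH] x /=.
  by move=> _ ->; apply: Or31; apply: connect0.
case/andP => xz zp yE; have {IH zp yE} := IH z zp yE.
have [xzA|xzA] := boolP (gadj A x z).
  have xzj : joined A x z by apply: connect1.
  case=> [h|[h1 h2]|[h1 h2]].
  - by apply: Or31; apply: joined_trans h.
  - by apply: Or32; split=> //; apply: joined_trans h1.
  - by apply: Or33; split=> //; apply: joined_trans h1.
have {xz xzA} : ((x, z) = e) \/ ((z, x) = e).
  move: xz xzA; rewrite /gadj !inE => /orP[/orP[/eqP|->//]|/orP[/eqP|->]].
  - by left.
  - by right.
  - by rewrite orbT.
case=> <- /=; case=> [h|[h1 h2]|[h1 h2]].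
- by apply: Or32; split => //; apply: connect0.
- by apply: Or32; split => //; apply: connect0.
- by apply: Or31.
- by apply: Or33; split => //; apply: connect0.
- by apply: Or31.
- by apply: Or33; split => //; apply: connect0.
Qed.

Lemma joined_loop A e x y : joined A e.1 e.2 -> joined (e |: A) x y = joined A x y.
Proof.
move=> eA; apply/idP/idP; last exact/joinedS/subsetUr.
case/joined_setU1=> [//|[h1 h2]|[h1 h2]].
  exact: joined_trans (joined_trans h1 eA) h2.
by rewrite joined_sym in eA; apply: joined_trans (joined_trans h1 eA) h2.
Qed.

Lemma gconnected_loop A e :
  joined A e.1 e.2 -> gconnected (e |: A) = gconnected A.
Proof.
move=> eA; apply: eq_forallb => x; apply: eq_forallb => y; exact: joined_loop.
Qed.

(** Acyclicity expressed without cycles: each edge is the only connection between its ends. *)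
Definition all_bridges A := [forall e in A, ~~ joined (A :\ e) e.1 e.2].

(** If an old edge [f] could be bypassed with the help of [e], then the bypass without [e],
    completed by [f], would join the ends of [e] inside [A]. *)
Lemma all_bridges_setU1 A e :
  all_bridges A -> ~~ joined A e.1 e.2 -> all_bridges (e |: A).
Proof.
move=> /forall_inP bA eA; apply/forall_inP => f.
have eNA : e \notin A by apply: contra eA => /joined_edge.
rewrite !inE => /orP[/eqP ->|fA]; first by rewrite setU1K.
have fe : f != e by apply: contraNneq eNA => <-.
have -> : (e |: A) :\ f = e |: (A :\ f).
  by apply/setP => x; rewrite !inE; case: eqVneq => // ->; rewrite (negbTE fe).
have := bA f fA; apply: contra => /joined_setU1.
have sub : A :\ f \subset A by apply: subD1set.
have fj : joined A f.1 f.2 by exact: joined_edge.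
case=> [//|[h1 h2]|[h1 h2]]; case/negP: eA.
- move: h1 h2 => /(joinedS sub) h1 /(joinedS sub) h2.
  rewrite joined_sym in h1; rewrite joined_sym in h2.
  by apply: joined_trans h1 (joined_trans fj h2).
- move: h1 h2 => /(joinedS sub) h1 /(joinedS sub) h2.
  rewrite joined_sym in fj.
  by apply: joined_trans h2 (joined_trans fj h1).
Qed.

Lemma all_bridgesS A B : A \subset B -> all_bridges B -> all_bridges A.
Proof.
move=> AB /forall_inP bB; apply/forall_inP => e eA.
apply: contra (bB e (subsetP AB _ eA)); exact/joinedS/setSD.
Qed.

End GraphConnect.

Section Kruskal.
Import mathcomp.boot.fintype mathcomp.boot.finset.
Context {R : realType}.
Variables (n : nat) (z : 'I_n * 'I_n -> R[i]) (t : 'I_n * 'I_n -> R).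
Hypothesis t_ge0 : forall e, 0 <= t e.
Let w e := cmod (1 + z e).
Hypothesis z_le : forall e, cmod (z e) <= t e * Num.max 1 (w e).
Implicit Types (E : seq ('I_n * 'I_n)) (A G Q T : {set 'I_n * 'I_n}).

(** [A] holds the edges already contracted, which carry no weight any more; [E] lists the edges
    still to be decided. *)
Let D E A := \sum_(G : {set 'I_n * 'I_n} |
  (G \subset [set e in E]) && gconnected (G :|: A)) \prod_(e in G) z e.

Let W E A := \sum_(G : {set 'I_n * 'I_n} |
  (G \subset [set e in E]) && (gconnected (G :|: A) && all_bridges (G :|: A)))
  \prod_(e in G) t e.

Let big_in (S : comPzSemiRingType) (f : 'I_n * 'I_n -> S) e E G :
  e \notin E -> G \subset [set x in E] ->
  \prod_(x in e |: G) f x = f e * \prod_(x in G) f x.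
Proof.
move=> eE GE; rewrite big_setU1//.
by apply: contra eE => /(subsetP GE); rewrite inE.
Qed.

Let D_cons e E A : e \notin E -> D (e :: E) A = D E A + z e * D E (e |: A).
Proof.
move=> eE; rewrite /D set_cons big_subset_setU1 ?inE//; congr (_ + _).
rewrite big_distrr /=; apply: eq_big => [G|G /andP[GE _]].
  by rewrite setUCA setUA.
exact: big_in GE.
Qed.

Let D_loop e E A : e \notin E -> joined A e.1 e.2 ->
  D (e :: E) A = (1 + z e) * D E A.
Proof.
move=> eE eA; rewrite D_cons// mulrDl mul1r; congr (_ + _ * _).
apply: eq_bigl => G; rewrite setUCA gconnected_loop//.
exact: joinedS (subsetUr _ _) eA.
Qed.

Let W_cons e E A : e \notin E -> W (e :: E) A = W E A + t e * W E (e |: A).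
Proof.
move=> eE; rewrite /W set_cons big_subset_setU1 ?inE//; congr (_ + _).
rewrite big_distrr /=; apply: eq_big => [G|G /andP[GE _]].
  by rewrite setUCA setUA.
exact: big_in GE.
Qed.

Let W_ge0 E A : 0 <= W E A.
Proof. by apply: sumr_ge0 => G _; apply: prodr_ge0. Qed.

Let w_ge0 e : 0 <= w e. Proof. exact: cmod_ge0. Qed.

(* Edges are processed in decreasing order of [w] (Kruskal's algorithm): an edge
   inside a component of [A] contributes its full factor [1 + z e], the other
   edges are deleted or contracted. [Q] stands for the partition into
   components that the contractions may produce. *)
Let deletion_contraction_le E A M :
  uniq E -> sorted (fun e f => w f <= w e) E -> all_bridges A ->
  (forall Q, A \subset Q -> \prod_(e <- E | joined Q e.1 e.2) w e <= M) ->
  cmod (D E A) <= M * W E A.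
Proof.
elim: E A M => [|e E IH] A M.
  move=> _ _ bA /(_ A (subxx A)); rewrite big_nil => M1.
  have e0 : [set e in [::]] = set0 :> {set 'I_n * 'I_n}.
    by apply/setP => x; rewrite !inE.
  have [cA|cA] := boolP (gconnected A).
    rewrite /D /W e0 (big_pred1 set0) ?(big_pred1 set0); first last.
    - move=> G /=; rewrite subset0; case: eqVneq => // ->.
      by rewrite set0U cA.
    - move=> G /=; rewrite subset0; case: eqVneq => // ->.
      by rewrite set0U cA.
    by rewrite !big_set0 cmod1 mulr1.
  rewrite /D e0 big_pred0 ?cmod0; last first.
    by move=> G; rewrite subset0; case: eqVneq => // ->; rewrite set0U (negbTE cA).
  by rewrite mulr_ge0// (le_trans ler01).
move=> /= /andP[eE uE] eEs bA HM.
have M0 : 0 <= M.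
  by apply: le_trans (HM A _) => //; apply: prodr_ge0.
have sE : sorted (fun e f => w f <= w e) E by exact: path_sorted eEs.
have leE f : f \in E -> w f <= w e.
  move=> fE; have tr : transitive (fun e f => w f <= w e).
    by move=> a b c ab bc; apply: le_trans bc ab.
  by have /allP/(_ f fE) := order_path_min tr eEs.
(* Below 1 the order makes all later weights small too, so joining more pairs only lowers the
   product: the worst partition is the one given by [A] itself. *)
have small : w e < 1 -> forall Q, A \subset Q ->
    \prod_(f <- E | joined Q f.1 f.2) w f <= \prod_(f <- E | joined A f.1 f.2) w f.
  move=> we1 Q AQ; rewrite [leLHS]big_mkcond [leRHS]big_mkcond /=.
  rewrite [leLHS]big_seq [leRHS]big_seq.
  apply: ler_prod => f fE; apply/andP; split; first by case: ifP.
  case: ifPn => [_|]; case: ifPn => //; last by move/(joinedS AQ) => ->.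
  by move=> _; apply: le_trans (leE _ fE) (ltW we1).
have [eA|eA] := boolP (joined A e.1 e.2).
  rewrite D_loop// cmodM W_cons//.
  apply: (@le_trans _ _ (M * W E A)); last first.
    by apply: ler_wpM2l => //; rewrite lerDl mulr_ge0.
  have [we0|we0] := eqVneq (w e) 0.
    by rewrite -/(w e) we0 mul0r mulr_ge0.
  have wep : 0 < w e by rewrite lt_def we0 w_ge0.
  (* Every [Q] containing [A] joins the ends of [e], so all products in [HM] have the factor [w e];
     what is left is bounded by [M / w e]. *)
  rewrite -/(w e) mulrC -ler_pdivlMr// mulrAC; apply: IH => // Q AQ.
  have := HM Q AQ; rewrite big_cons (joinedS AQ eA) => h.
  by rewrite ler_pdivlMr// mulrC.
have mx : 0 < Num.max 1 (w e) by rewrite lt_max ltr01.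
rewrite D_cons// W_cons//; apply: le_trans (cmodD _ _) _.
rewrite cmodM mulrDr; apply: lerD.
  apply: IH => // Q AQ; have [we1|we1] := ltP (w e) 1.
    apply: le_trans (small we1 Q AQ) _.
    by have := HM A (subxx A); rewrite big_cons (negbTE eA).
  apply: le_trans (HM Q AQ); rewrite big_cons; case: ifP => // _.
  by apply: ler_peMl => //; apply: prodr_ge0.
rewrite mulrCA.
(* The factor [Num.max 1 (w e)] is taken out of [M] to pay for [z e]. If [w e >= 1], each [Q]
   containing [e] has this factor in its product. *)
have -> : t e * (M * W E (e |: A)) =
    (t e * Num.max 1 (w e)) * (M / Num.max 1 (w e) * W E (e |: A)).
  by field; rewrite gt_eqF.
apply: ler_pM; rewrite ?cmod_ge0//; apply: IH => //.
  exact: all_bridges_setU1.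
move=> Q AQ; have AQ' := subset_trans (subsetUr _ _) AQ.
rewrite ler_pdivlMr// mulrC; have [we1|we1] := ltP (w e) 1.
  rewrite mul1r; apply: le_trans (small we1 Q AQ') _.
  by have := HM A (subxx A); rewrite big_cons (negbTE eA).
have := HM Q AQ'; rewrite big_cons.
by rewrite (joined_edge (subsetP AQ _ (setU11 _ _))).
Qed.

(** [Q] matters only through its components: the hypothesis bounds the weight of the pairs inside
    the blocks of an arbitrary partition. The sum on the right runs over the spanning trees. *)
Lemma tree_graph_le M :
  (forall Q, \prod_(e : 'I_n * 'I_n | (e.1 < e.2)%N && joined Q e.1 e.2) w e <= M) ->
  cmod (\sum_(G : {set 'I_n * 'I_n} | graph_on G && gconnected G) \prod_(e in G) z e)
  <= M * \sum_(G : {set 'I_n * 'I_n} | [&& graph_on G, gconnected G & all_bridges G])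
           \prod_(e in G) t e.
Proof.
move=> HM; pose r := fun e f => w f <= w e.
pose E := sort r (enum [set e : 'I_n * 'I_n | (e.1 < e.2)%N]).
have tot : total r by move=> e f; exact: le_total.
have EE : [set e in E] = [set e : 'I_n * 'I_n | (e.1 < e.2)%N].
  by apply/setP => e; rewrite inE mem_sort mem_enum.
have go G : graph_on G = (G \subset [set e in E]).
  rewrite EE; apply/forall_inP/subsetP => h e /h; by rewrite inE.
have := @deletion_contraction_le E set0 M _ (sort_sorted tot _).
rewrite sort_uniq enum_uniq => /(_ isT) => h.
suff : cmod (D E set0) <= M * W E set0.
  rewrite /D /W; congr (cmod _ <= _ * _); apply: eq_bigl => G; by rewrite !setU0 go.
apply: h.
  by apply/forall_inP => e; rewrite inE.
move=> Q _; apply: le_trans (HM Q); rewrite le_eqVlt; apply/orP; left; apply/eqP.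
rewrite (perm_big (enum [set e : 'I_n * 'I_n | (e.1 < e.2)%N])) /=; last first.
  by rewrite perm_sort.
by rewrite big_enum_cond; apply: eq_bigl => e; rewrite inE.
Qed.

End Kruskal.

(** * Rooted forests *)

Section Splits.
Import mathcomp.boot.fintype mathcomp.boot.finset.

(* The sum of [A K L] over all ways of splitting the list [J] into a sublist [K]
   and its complement [L]. *)
Fixpoint splits (S : nmodType) (T : Type) (A : seq T -> seq T -> S) (J : seq T) : S :=
  if J is y :: J' then
    splits (fun K L => A (y :: K) L) J' + splits (fun K L => A K (y :: L)) J'
  else A [::] [::].

Lemma eq_splits (S : nmodType) (T : Type) (A B : seq T -> seq T -> S) J :
  (forall K L, (size K + size L = size J)%N -> A K L = B K L) ->
  splits A J = splits B J.
Proof.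
elim: J A B => [|y J IH] A B AB /=; first exact: AB.
congr (_ + _); apply: IH => K L KL; apply: AB; rewrite /= ?addnS ?addSn KL//.
Qed.

Lemma splits_map (S : nmodType) (T U : Type) (f : U -> T) (A : seq T -> seq T -> S) J :
  splits A (map f J) = splits (fun K L => A (map f K) (map f L)) J.
Proof. by elim: J A => //= y J IH A; rewrite !IH. Qed.

Lemma splits_mulr (S : pzRingType) (T : Type) (A : seq T -> seq T -> S) c J :
  splits A J * c = splits (fun K L => A K L * c) J.
Proof. by elim: J A => //= y J IH A; rewrite mulrDl !IH. Qed.

(** Passage from the list recursion to sums over vertex sets; without repetitions, choosing a
    sublist is the same as choosing a subset. *)
Lemma splits_setE (S : nmodType) (V : finType) (A : seq V -> seq V -> S) (J : seq V) :
  uniq J ->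
  splits A J = \sum_(K : {set V} | K \subset [set x in J])
                 A [seq x <- J | x \in K] [seq x <- J | x \notin K].
Proof.
elim: J A => [|y J IH] A.
  move=> _; rewrite (big_pred1 set0) ?filter_pred0// => K /=.
  suff -> : [set x in [::]] = set0 :> {set V} by rewrite subset0.
  by apply/setP => x; rewrite !inE.
move=> /= /andP[yJ uJ]; rewrite !IH// set_cons.
transitivity (\sum_(K : {set V} | (K \subset y |: [set x in J]) && true)
    A [seq x <- y :: J | x \in K] [seq x <- y :: J | x \notin K]); last first.
  by apply: eq_bigl => K; rewrite andbT.
rewrite big_subset_setU1 ?inE// addrC; congr (_ + _).
  apply: eq_big => [K|K KJ]; first by rewrite andbT.
  rewrite /=; have -> // : (y \in K) = false.
  by apply/negbTE; apply: contra yJ => /(subsetP KJ); rewrite inE.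
apply: eq_big => [K|K KJ]; first by rewrite andbT.
rewrite /= setU11 /=; congr (A (_ :: _) _); apply: eq_in_filter => x xJ;
  by rewrite !inE; case: eqVneq => // xy; rewrite -xy xJ in yJ.
Qed.

End Splits.

Section Forests.
Import mathcomp.boot.fintype mathcomp.boot.finset.
Context {R : realType}.

(* The total weight of the forests on the vertices [I ++ J] with set of roots [I],
   explored from the first root; [m] is the fuel, and [size I + size J < m]
   suffices. *)
Fixpoint forests (T : Type) (t : T -> T -> R) (m : nat) (I J : seq T) : R :=
  if m is m'.+1 then
    if I is i :: I' then
      splits (fun K L => (\prod_(k <- K) t i k) * forests t m' (I' ++ K) L) J
    else (size J == 0)%:R
  else 0.

Lemma forests_map (T U : Type) (f : U -> T) (t : T -> T -> R) m I J :
  forests t m (map f I) (map f J) = forests (fun x y => t (f x) (f y)) m I J.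
Proof.
elim: m I J => //= m IH [|i I] J /=; first by rewrite size_map.
rewrite splits_map; apply: eq_splits => K L _.
by rewrite big_map -map_cat IH.
Qed.

Lemma splits_ge0 (T : Type) (A : seq T -> seq T -> R) J :
  (forall K L, 0 <= A K L) -> 0 <= splits A J.
Proof. by elim: J A => //= y J IH A A0; rewrite addr_ge0// IH. Qed.

Lemma forests_ge0 (T : Type) (t : T -> T -> R) m I J :
  (forall x y, 0 <= t x y) -> 0 <= forests t m I J.
Proof.
move=> t0; elim: m I J => //= m IH [|i I] J; first by case: (size J).
by apply: splits_ge0 => K L; rewrite mulr_ge0// prodr_ge0.
Qed.

Lemma ler_sum_inj (V : finType) (P P' : {pred V}) (d : V -> V) (f : V -> R) :
  (forall x, 0 <= f x) -> {in P &, injective d} -> (forall x, P x -> P' (d x)) ->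
  \sum_(x in P) f (d x) <= \sum_(x in P') f x.
Proof.
move=> f0 dinj dP.
rewrite -(@big_imset _ _ _ _ _ d (mem P) f)//=.
rewrite [leLHS]big_mkcond [leRHS]big_mkcond; apply: ler_sum => x _.
case: ifPn => [/imsetP[y yP ->]|_]; last by case: ifP.
by rewrite [_ \in P']dP.
Qed.

Variable n : nat.
Implicit Types (I J : seq 'I_n) (G : {set 'I_n * 'I_n}).

(** The vertex set is carried as a list inside the fixed type ['I_n], so that deleting a root does
    not change the type of the graph. *)
Definition rooted_forest I J G :=
  [&& graph_on G, all_bridges G,
      [forall e in G, (e.1 \in I ++ J) && (e.2 \in I ++ J)],
      all (fun j => has (joined G j) I) J &
      pairwise (fun i i' => ~~ joined G i i') I].

Definition edge (i j : 'I_n) := if (i < j)%N then (i, j) else (j, i).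

Lemma edge_gadj G i j : graph_on G -> gadj G i j = (edge i j \in G).
Proof.
move=> /forall_inP gG; rewrite /gadj /edge; case: ltnP => ij.
  have [ijG|//] := boolP ((j, i) \in G); last by rewrite orbF.
  by have := gG _ ijG; rewrite /= ltnNge (ltnW ij).
have [ijG|//] := boolP ((i, j) \in G).
by have := gG _ ijG; rewrite /= ltnNge ij.
Qed.

Lemma edge_inj i : injective (edge i).
Proof.
move=> j k; rewrite /edge; case: ifP; case: ifP => h1 h2 [] => //.
- by move=> -> ->.
- by move=> -> ->.
Qed.

Section RemoveRoot.
Variables (i : 'I_n) (I J : seq 'I_n) (G : {set 'I_n * 'I_n}).
Hypotheses (uIJ : uniq (i :: I ++ J)) (fG : rooted_forest (i :: I) J G).

Let K := [set k in J | gadj G i k].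
Let G' := [set e in G | (e.1 != i) && (e.2 != i)].

Let gG : graph_on G. Proof. by case/and5P: fG. Qed.
Let bG : all_bridges G. Proof. by case/and5P: fG. Qed.
Let G'G : G' \subset G.
Proof. by apply/subsetP => e; rewrite inE => /andP[]. Qed.

Let nbr k : gadj G i k -> k \in J.
Proof.
move=> ik; case/and5P: fG => _ _ /forall_inP supp _ pw.
have kIJ : k \in (i :: I) ++ J.
  by move: ik; rewrite /gadj => /orP[] /supp /= /andP[].
have ki : k != i.
  apply: contraTneq ik => ->; rewrite /gadj orbb; apply/negP.
  by move/(forall_inP gG); rewrite ltnn.
move: kIJ; rewrite mem_cat inE (negbTE ki) /= => /orP[kI|//].
by move: pw => /= /andP[/allP/(_ _ kI)]; rewrite /joined connect1.
Qed.

Let KE k : (k \in K) = gadj G i k.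
Proof. by rewrite inE; case: (boolP (gadj G i k)) => [/nbr ->//|]; rewrite andbF. Qed.

Lemma remove_rootE : [set e in G | ~~ ((e.1 != i) && (e.2 != i))] = edge i @: K.
Proof.
apply/setP => e; rewrite inE negb_and !negbK; apply/andP/imsetP.
  move=> [eG /orP[] /eqP ei].
  - exists e.2; last by rewrite /edge -ei (forall_inP gG _ eG) -surjective_pairing.
    by rewrite KE /gadj -ei -surjective_pairing eG.
  - exists e.1; last first.
      by rewrite /edge -ei ltnNge ltnW ?(forall_inP gG _ eG)//= -surjective_pairing.
    by rewrite KE /gadj -ei -surjective_pairing eG orbT.
case=> k; rewrite KE edge_gadj// => ikG ->; split => //.
by rewrite /edge; case: ifP => _ /=; rewrite eqxx ?orbT.
Qed.

(** Recovers [G] from [G'] and the neighbours [K] of the deleted root; hence the deletion is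
    injective once [K] is fixed. *)
Lemma remove_root_setU : G = G' :|: edge i @: K.
Proof.
rewrite -remove_rootE; apply/setP => e; rewrite !inE -andb_orr.
by rewrite orbN andbT.
Qed.

(** The path is cut at its first visit to [i]; the vertex before it is a neighbour of [i]. *)
Let joined_remove x y : joined G x y -> x != i ->
  (y != i /\ joined G' x y) \/ exists2 k, k \in K & joined G' x k.
Proof.
case/connectP => p; elim: p x => [|v p IH] x /=.
  by move=> _ -> xi; left; split => //; apply: connect0.
move=> /andP[xv vp] yE xi; have [vi|vi] := eqVneq v i.
  by right; exists x; [rewrite KE gadj_sym -vi|apply: connect0].
have xv' : joined G' x v.
  apply: connect1; move: xv; rewrite /gadj !inE /= xi vi !andbT //.
case: (IH v vp yE vi) => [[yi vy]|[k kK vk]].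
  by left; split => //; apply: joined_trans vy.
by right; exists k => //; apply: joined_trans vk.
Qed.

(** The neighbours of the deleted root take over its role. What was attached to [i] hangs on one of
    them, and a link from a neighbour to another old root would have joined two roots of [G] through
    [i]. *)
Lemma remove_root_forest :
  rooted_forest (I ++ [seq x <- J | x \in K]) [seq x <- J | x \notin K] G'.
Proof.
case/and5P: fG => _ _ /forall_inP supp reach pw.
apply/and5P; split.
- by apply/forall_inP => e /(subsetP G'G) eG; apply: (forall_inP gG).
- exact: all_bridgesS G'G bG.
- apply/forall_inP => e; rewrite inE => /andP[/supp/andP[h1 h2] /andP[e1 e2]].
  have mem x : x != i -> x \in (i :: I) ++ J ->
      x \in (I ++ [seq x <- J | x \in K]) ++ [seq x <- J | x \notin K].
    move=> /negbTE xi; rewrite !mem_cat !mem_filter inE xi /=.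
    by case/orP => ->; rewrite ?orbT// !andbT -orbA orbN orbT.
  by rewrite !mem.
- apply/allP => j; rewrite mem_filter => /andP[jK jJ].
  have ji : j != i.
    apply: contraTneq jJ => ->; move: uIJ => /=.
    by rewrite mem_cat negb_or => /andP[/andP[]].
  have /hasP[i0 i0I ji0] := allP reach j jJ.
  apply/hasP; case: (joined_remove ji0 ji) => [[i0i h]|[k kK h]].
    exists i0 => //; rewrite mem_cat; move: i0I; rewrite inE (negbTE i0i) /=.
    by move=> ->.
  exists k => //; rewrite mem_cat mem_filter kK; apply/orP; right.
  by move: kK; rewrite inE => /andP[].
move: pw => /= /andP[/allP iI pwI]; rewrite pairwise_cat; apply/and3P; split.
- apply/allrelP => i' k i'I; rewrite mem_filter KE => /andP[ik _].
  apply: contra (iI _ i'I) => /(joinedS G'G) h.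
  by apply: (@joined_trans _ _ k); [exact: connect1|rewrite joined_sym].
- apply: sub_pairwise pwI => a b; apply: contra; exact: joinedS.
(* Two distinct neighbours joined in [G'] would give a way around the edge from [i] to one of them,
   which is a bridge. *)
- have uK : uniq [seq x <- J | x \in K].
    by rewrite filter_uniq//; move: uIJ; rewrite /= cat_uniq => /and4P[].
  move: uK; rewrite uniq_pairwise; apply: (@sub_in_pairwise _ [in K]) => //; last first.
    by apply/allP => x; rewrite mem_filter => /andP[].
  move=> k k' kK k'K kk'.
  have := kK; have := k'K; rewrite !KE !edge_gadj// => ik' ik.
  apply/negP => h.
  have : joined (G :\ edge i k) i k.
    apply: (@joined_trans _ _ k').
      apply: connect1; have : edge i k' \in G :\ edge i k.
        by rewrite !inE ik' andbT (inj_eq (@edge_inj i)) eq_sym.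
      by rewrite /edge /gadj; case: ifP => _ ->; rewrite ?orbT.
    rewrite joined_sym; apply: joinedS h; apply/subsetP => e; rewrite !inE.
    move=> /andP[-> /andP[e1 e2]]; rewrite andbT.
    by apply/eqP => E; move: e1 e2; rewrite E /edge; case: ifP => _ /=; rewrite eqxx.
  have := forall_inP bG _ ik; rewrite {2 3}/edge; case: ifP => _ /= /negP h1 h2;
    by apply: h1; rewrite // joined_sym.
Qed.

Lemma remove_root_prod (t : 'I_n -> 'I_n -> R) : (forall x y, t x y = t y x) ->
  \prod_(e in G) t e.1 e.2 =
  (\prod_(k <- [seq x <- J | x \in K]) t i k) * \prod_(e in G') t e.1 e.2.
Proof.
move=> tsym; rewrite (bigID (fun e => (e.1 != i) && (e.2 != i))) /= mulrC.
congr (_ * _); last by apply: eq_bigl => e; rewrite inE.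
transitivity (\prod_(e in edge i @: K) t e.1 e.2).
  by apply: eq_bigl => e; rewrite -remove_rootE inE.
rewrite big_imset /=; last by move=> x y _ _; exact: edge_inj.
have uK : uniq [seq x <- J | x \in K].
  by rewrite filter_uniq//; move: uIJ; rewrite /= cat_uniq => /and4P[].
rewrite big_uniq//; apply: eq_big => [k|k _].
  by rewrite mem_filter; case: (boolP (k \in K)) => //; rewrite inE => /andP[->].
by rewrite /edge; case: ifP.
Qed.

End RemoveRoot.

(** Forests are grouped by the set [K] of neighbours of the first root; deleting that root injects
    each group into the forests counted by the recursive call. Since the weights are nonnegative, an
    injection is enough. *)
Lemma sum_rooted_forest_le (t : 'I_n -> 'I_n -> R) m I J :
  (forall x y, t x y = t y x) -> (forall x y, 0 <= t x y) ->
  uniq (I ++ J) -> (size I + size J < m)%N ->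
  \sum_(G | rooted_forest I J G) \prod_(e in G) t e.1 e.2 <= forests t m I J.
Proof.
move=> tsym t0; elim: m I J => // m IH [|i I] J.
  move=> _ _ /=; case: J => [|j J] /=; last first.
    by rewrite big_pred0// => G; rewrite /rooted_forest /= !andbF.
  rewrite (bigID (pred1 set0)) /= [X in _ + X]big1 ?addr0; last first.
    move=> G /andP[/and5P[_ _ /forall_inP h _ _] /set0Pn[e /h]].
    by rewrite in_nil.
  rewrite big_mkcond /= (bigD1 set0)//= [X in _ + X]big1 ?addr0; last first.
    by move=> G G0; rewrite (negbTE G0) andbF.
  by case: ifP => // _; rewrite big_set0.
move=> u szm /=; have uJ : uniq J by move: u; rewrite cat_uniq => /and3P[].
rewrite splits_setE//.
pose Kof (G : {set 'I_n * 'I_n}) := [set k in J | gadj G i k].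
rewrite (partition_big Kof (fun K : {set 'I_n} => K \subset [set x in J])) /=; last first.
  by move=> G _; apply/subsetP => k; rewrite !inE => /andP[].
apply: ler_sum => K KJ.
set fK := [seq x <- J | x \in K]; set fL := [seq x <- J | x \notin K].
apply: (@le_trans _ _ ((\prod_(k <- fK) t i k) *
    \sum_(G | rooted_forest (I ++ fK) fL G) \prod_(e in G) t e.1 e.2)).
  pose d (G : {set 'I_n * 'I_n}) := [set e in G | (e.1 != i) && (e.2 != i)].
  pose P := [pred G : {set 'I_n * 'I_n} | rooted_forest (i :: I) J G && (Kof G == K)].
  rewrite (eq_bigr (fun G => (\prod_(k <- fK) t i k) * \prod_(e in d G) t e.1 e.2)).
    rewrite -big_distrr /=; apply: ler_wpM2l; first exact: prodr_ge0.
    apply: (@ler_sum_inj _ P (rooted_forest (I ++ fK) fL) d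
       (fun G => \prod_(e in G) t e.1 e.2)) => [G|G1 G2|G].
    - exact: prodr_ge0.
    - move=> /andP[h1 /eqP K1] /andP[h2 /eqP K2] dE.
      by rewrite (remove_root_setU h1) (remove_root_setU h2) -!/(Kof _) -!/(d _) dE K1 K2.
    - by move=> /andP[h1 /eqP KG]; rewrite /fK /fL -KG; exact: remove_root_forest.
  move=> G /andP[h1 /eqP KG]; rewrite (remove_root_prod u h1 tsym).
  by rewrite -/(Kof G) KG.
apply: ler_wpM2l; first exact: prodr_ge0.
have pJ : perm_eq (fK ++ fL) J by exact/permPl/perm_filterC.
apply: IH.
  rewrite -catA; move: u => /= /andP[_]; apply: etrans; apply: perm_uniq.
  by rewrite perm_cat2l.
by rewrite size_cat -addnA -size_cat (perm_size pJ); move: szm => /=; rewrite addSn.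
Qed.

End Forests.

(** * Connected components *)

Section PairsProduct.
Variable S : comPzSemiRingType.

(** The product over pairs of positions, in a form without indices that applies directly to
    sublists. *)
Fixpoint pairs_prod (T : Type) (f : T -> T -> S) (s : seq T) : S :=
  if s is x :: s' then (\prod_(y <- s') f x y) * pairs_prod f s' else 1.

Lemma pairs_prodE (T : Type) (f : T -> T -> S) x0 s :
  \prod_(i < size s) \prod_(j < size s | (i < j)%N) f (nth x0 s i) (nth x0 s j) =
  pairs_prod f s.
Proof.
elim: s => [|x s IH]; first by rewrite big_ord0.
rewrite /= big_ord_recl /=; congr (_ * _).
  rewrite big_mkcond big_ord_recl /= mul1r (big_nth x0) big_mkord.
  by apply: eq_bigr => i _.
rewrite -IH; apply: eq_bigr => i _; rewrite big_mkcond big_ord_recl /= mul1r.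
by rewrite [RHS]big_mkcond; apply: eq_bigr => j _; rewrite /bump /= !add1n ltnS.
Qed.

Lemma pairs_prod_map (T U : Type) (g : U -> T) (f : T -> T -> S) s :
  pairs_prod f (map g s) = pairs_prod (fun x y => f (g x) (g y)) s.
Proof. by elim: s => //= x s ->; rewrite big_map. Qed.

Lemma pairs_prod_sorted n (f : 'I_n -> 'I_n -> S) (s : seq 'I_n) :
  sorted (fun i j : 'I_n => (i < j)%N) s ->
  pairs_prod f s =
  \prod_(e : 'I_n * 'I_n | [&& e.1 \in s, e.2 \in s & (e.1 < e.2)%N]) f e.1 e.2.
Proof.
move=> ss.
have tr : transitive (fun i j : 'I_n => (i < j)%N) by move=> a b c; exact: ltn_trans.
have us : uniq s by apply: sorted_uniq ss => // i; rewrite ltnn.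
transitivity (\prod_(i <- s) \prod_(j <- s | (i < j)%N) f i j); last first.
  rewrite big_uniq//= (eq_bigr (fun i : 'I_n => \prod_(j : 'I_n | (j \in s) && (i < j)%N) f i j)).
    by rewrite pair_big_dep.
  move=> i _; rewrite big_mkcond big_uniq//= [RHS]big_mkcond [LHS]big_mkcond.
  by apply: eq_bigr => j _; case: (j \in s).
elim: s ss {us} => [|x s IH] ss /=; first by rewrite big_nil.
have xs : {in s, forall y : 'I_n, (x < y)%N} by move=> y; apply/allP: y; exact: order_path_min tr ss.
rewrite big_cons big_cons ltnn IH; last exact: path_sorted ss.
congr (_ * _).
  by rewrite [RHS]big_mkcond big_seq [RHS]big_seq; apply: eq_bigr => y /xs ->.
rewrite big_seq [RHS]big_seq; apply: eq_bigr => i /xs xi.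
by rewrite big_cons ltnNge ltnW.
Qed.

Lemma prod1D_subsets (T : finType) (z : T -> S) (E : seq T) : uniq E ->
  \prod_(e <- E) (1 + z e) =
  \sum_(G : {set T} | G \subset finset (fun x => x \in E)) \prod_(e in G) z e.
Proof.
elim: E => [|e E IH] /=.
  move=> _; rewrite big_nil (big_pred1 finset.set0) ?finset.big_set0// => G /=.
  have -> : finset (fun x => x \in [::]) = finset.set0 :> {set T}.
    by apply/finset.setP => x; rewrite !inE.
  by rewrite finset.subset0.
move=> /andP[eE uE]; rewrite big_cons IH// mulrDl mul1r.
transitivity (\sum_(G : {set T} | (G \subset finset.setU (finset.set1 e)
     (finset (fun x => x \in E))) && true) \prod_(e in G) z e); last first.
  by apply: eq_bigl => G; rewrite andbT -finset.set_cons.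
rewrite big_subset_setU1 ?inE//; congr (_ + _); first by apply: eq_bigl => G; rewrite andbT.
rewrite big_distrr /=; apply: eq_big => [G|G GE]; first by rewrite andbT.
rewrite finset.big_setU1//; apply: contra eE => /(fintype.subsetP GE).
by rewrite inE.
Qed.

End PairsProduct.

Section EnumOrd.

Lemma enum_ord_sorted n : sorted (fun i j : 'I_n => (i < j)%N) (enum 'I_n).
Proof.
rewrite -(sorted_map (f := val) (e' := ltn)) val_enum_ord; exact: iota_ltn_sorted.
Qed.

Lemma map_nth_enum_ord (T : Type) (x0 : T) s :
  [seq nth x0 s i | i : 'I_(size s) <- enum 'I_(size s)] = s.
Proof.
rewrite -[RHS](mkseq_nth x0) /mkseq -val_enum_ord -map_comp.
exact: eq_map.
Qed.

End EnumOrd.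

Section ConnectedSums.
Import mathcomp.boot.fintype mathcomp.boot.finset.
Context {R : realType}.

(** The Ursell function without its normalisation: [phi] before division by the factorial. *)
Definition conn_sum (T : Type) (x0 : T) (z : T -> T -> R[i]) (s : seq T) : R[i] :=
  \sum_(G : {set 'I_(size s) * 'I_(size s)} | graph_on G && gconnected G)
     \prod_(e in G) z (nth x0 s e.1) (nth x0 s e.2).

Lemma joined_closed n (G : {set 'I_n * 'I_n}) (P : pred 'I_n) i j :
  (forall u v, P u -> gadj G u v -> P v) -> P i -> joined G i j -> P j.
Proof.
move=> cl Pi /connectP[p]; elim: p i Pi => [|v p IH] i Pi /=; first by move=> _ ->.
by move=> /andP[iv vp] jE; apply: (IH v) => //; apply: cl iv.
Qed.

Definition conn_on n (v0 : 'I_n) (C : {set 'I_n}) (G : {set 'I_n * 'I_n}) :=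
  [&& graph_on G, [forall e in G, (e.1 \in C) && (e.2 \in C)] &
      [forall j in C, joined G v0 j]].

Section Relabel.
Variables (k n : nat) (g : 'I_k -> 'I_n) (i0 : 'I_k).
Hypothesis g_lt : forall i j, (g i < g j)%N = (i < j)%N.

Let g_inj : injective g.
Proof.
move=> i j gij; apply/val_inj; case: (ltngtP i j) => // ij; move: (ij);
  by rewrite -g_lt gij ltnn.
Qed.

Let h (G : {set 'I_k * 'I_k}) := [set (g e.1, g e.2) | e in G].
Let h' (G : {set 'I_n * 'I_n}) := [set e | (g e.1, g e.2) \in G].
Let C := [set g i | i : 'I_k].

Let gg_inj : injective (fun e : 'I_k * 'I_k => (g e.1, g e.2)).
Proof. by move=> [a b] [c d] /= [/g_inj -> /g_inj ->]. Qed.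

Let mem_h G i j : ((g i, g j) \in h G) = ((i, j) \in G).
Proof.
apply/imsetP/idP => [[[a b] abG /= [/g_inj -> /g_inj ->//]]|ijG].
by exists (i, j).
Qed.

Let hK G : h' (h G) = G.
Proof. by apply/setP => -[i j]; rewrite inE mem_h. Qed.

Let joined_h G i j : joined (h G) (g i) (g j) = joined G i j.
Proof.
have adjE u v : gadj (h G) (g u) (g v) = gadj G u v by rewrite /gadj !mem_h.
apply/idP/idP => H.
  have /existsP[j' /andP[/eqP/g_inj -> //]] : [exists j', (g j == g j') && joined G i j'].
  apply: (@joined_closed _ (h G) (fun v => [exists j', (v == g j') && joined G i j'])) H.
    move=> u v /existsP[j' /andP[/eqP -> ij']] j'v.
    have [v' vE] : exists v', v = g v'.
      by move: j'v => /orP[/imsetP[e _ [_ ->]]|/imsetP[e _ [-> _]]]; eexists.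
    apply/existsP; exists v'; rewrite vE eqxx /=; apply: joined_trans ij' _.
    by apply: connect1; rewrite -adjE -vE.
  by apply/existsP; exists i; rewrite eqxx; apply: connect0.
apply: (@joined_closed _ G (fun v => joined (h G) (g i) (g v))) H => [u v iu uv|].
  by apply: joined_trans iu _; apply: connect1; rewrite adjE.
exact: connect0.
Qed.

(** An increasing injection transports graphs without reordering the ends of edges, as is necessary
    because edges are stored as increasing pairs. Connectivity on the image is tested from the
    single vertex [g i0]. *)
Lemma relabel_conn (z : 'I_n -> 'I_n -> R[i]) :
  \sum_(G : {set 'I_k * 'I_k} | graph_on G && gconnected G)
    \prod_(e in G) z (g e.1) (g e.2) =
  \sum_(G | conn_on (g i0) C G) \prod_(e in G) z e.1 e.2.
Proof.
rewrite (reindex_onto h h') /=; last first.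
  move=> G /and3P[gG /forall_inP sG _]; apply/setP => -[u v]; apply/imsetP/idP.
    by move=> [e]; rewrite inE => eG ->.
  move=> uvG; have /andP[/imsetP[i _ /= ui] /imsetP[j _ /= vj]] := sG _ uvG.
  by exists (i, j); rewrite ?inE/= -?ui -?vj.
apply: eq_big => [G|G _]; last first.
  by rewrite big_imset//= => x y _ _; exact: gg_inj.
rewrite hK eqxx andbT; apply/andP/and3P.
  move=> [/forall_inP gG /forallP cG]; split.
  - apply/forall_inP => _ /imsetP[e eG ->] /=; rewrite g_lt; exact: gG.
  - by apply/forall_inP => _ /imsetP[e eG ->] /=; rewrite !imset_f.
  - apply/forall_inP => _ /imsetP[j _ ->]; rewrite joined_h.
    exact: (forallP (cG i0)).
move=> [/forall_inP gG _ /forall_inP jG]; split.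
  apply/forall_inP => -[i j] ijG /=; rewrite -g_lt.
  by apply: (gG (g i, g j)); rewrite mem_h.
have jG' j : joined G i0 j by rewrite -joined_h jG// imset_f.
apply/forallP => i; apply/forallP => j; apply: (joined_trans (y := i0)) => //.
by rewrite joined_sym.
Qed.

End Relabel.

Section ComponentOf.
Variables (n : nat) (v0 : 'I_n) (z : 'I_n -> 'I_n -> R[i]).

Definition graph_in (L : {set 'I_n}) (G : {set 'I_n * 'I_n}) :=
  graph_on G && [forall e in G, (e.1 \in L) && (e.2 \in L)].

Let a (G : {set 'I_n * 'I_n}) := \prod_(e in G) z e.1 e.2.
Let comp G := [set j | joined G v0 j].

(** No edge leaves the component of [v0], so such a graph is a connected graph on [C] together with
    an arbitrary graph on the complement, and its weight factors. *)
Lemma sum_component (C : {set 'I_n}) : v0 \in C ->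
  \sum_(G | graph_on G && (comp G == C)) a G =
  (\sum_(G | conn_on v0 C G) a G) * \sum_(G | graph_in (~: C) G) a G.
Proof.
move=> v0C; rewrite big_distrlr /= pair_big /=.
pose h (p : {set 'I_n * 'I_n} * {set 'I_n * 'I_n}) := p.1 :|: p.2.
pose h' (G : {set 'I_n * 'I_n}) :=
  ([set e in G | (e.1 \in C) && (e.2 \in C)],
   [set e in G | (e.1 \in ~: C) && (e.2 \in ~: C)]).
have same G : comp G == C -> forall e, e \in G -> (e.1 \in C) = (e.2 \in C).
  move=> /eqP <- e eG; rewrite !inE; have := joined_edge eG => j12.
  apply/idP/idP => H; first exact: joined_trans H j12.
  by rewrite joined_sym in j12; exact: joined_trans H j12.
rewrite (reindex_onto h h') /=; last first.
  move=> G /andP[_ /same sG]; apply/setP => e; rewrite !inE.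
  rewrite -andb_orr; case: (boolP (e \in G)) => //= /sG ->.
  by rewrite andbb andbb orbN.
apply: eq_big => [[G1 G2]|[G1 G2]] /=; last first.
  move=> /andP[_ /eqP[E1 E2]]; rewrite /a /h /=.
  rewrite big_mkcond [in RHS]big_mkcond /= [X in _ = _ * X]big_mkcond /= -big_split /=.
  apply: eq_bigr => e _; rewrite inE.
  have [eG1|_] := boolP (e \in G1); last by rewrite /= mul1r.
  have [eG2|_] := boolP (e \in G2); last by rewrite mulr1.
  by move: eG1 eG2; rewrite -E1 -E2 !inE => /and3P[_ -> _] /and3P[_].
apply/andP/andP.
  move=> [/andP[/forall_inP gG /eqP cG] /eqP[E1 E2]].
  have sub1 : G1 \subset G1 :|: G2 by apply: subsetUl.
  split; last first.
    apply/andP; split.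
      by apply/forall_inP => e eG; apply: gG; rewrite inE eG orbT.
    by apply/forall_inP => e; rewrite -E2 !inE => /andP[].
  apply/and3P; split.
  - by apply/forall_inP => e eG; apply: gG; rewrite inE eG.
  - by apply/forall_inP => e; rewrite -E1 !inE => /andP[].
  - apply/forall_inP => j; rewrite -cG inE.
    apply: (@joined_closed _ (h (G1, G2)) (fun j => joined G1 v0 j)); last exact: connect0.
    move=> u v v0u uv; apply: (joined_trans v0u); apply: connect1.
    have uC : u \in C by rewrite -cG inE; exact: joinedS v0u.
    have vC : v \in C.
      rewrite -cG inE; move: uC; rewrite -cG inE => uC.
      by apply: joined_trans uC _; apply: connect1.
    have key e : e \in h (G1, G2) -> e.1 \in C -> e.2 \in C -> e \in G1.
      by move=> eh e1 e2; rewrite -E1 inE eh e1.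
    by move: uv => /orP[] /key; rewrite /gadj => -> //; rewrite orbT.
move=> [/and3P[/forall_inP g1 /forall_inP s1 /forall_inP j1]].
move=> /andP[/forall_inP g2 /forall_inP s2].
split; last first.
  rewrite /h' /h /=; apply/eqP; congr (_, _); apply/setP => e; rewrite !inE.
    case: (boolP (e \in G1)) => /= [/s1 ->//|_].
    case: (boolP (e \in G2)) => //= /s2; rewrite !inE => /andP[/negbTE ->]//.
  case: (boolP (e \in G2)) => /= [/s2|_]; first by rewrite !inE orbT => ->.
  by case: (boolP (e \in G1)) => //= /s1 /andP[->].
apply/andP; split; first by apply/forall_inP => e; rewrite inE => /orP[/g1|/g2].
apply/eqP/setP => j; rewrite inE; apply/idP/idP; last first.
  by move=> /j1; apply: joinedS; apply: subsetUl.
apply: (@joined_closed _ (h (G1, G2)) [in C]) => // u v uC.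
rewrite /gadj /h /= !inE => /orP[] /orP[/s1|/s2] /=; rewrite ?inE => /andP[] //.
- by rewrite uC.
- by move=> _; rewrite uC.
Qed.

Lemma sum_graph_on :
  \sum_(G : {set 'I_n * 'I_n} | graph_on G) a G =
  \sum_(C : {set 'I_n} | v0 \in C)
    (\sum_(G | conn_on v0 C G) a G) * \sum_(G | graph_in (~: C) G) a G.
Proof.
rewrite (partition_big comp (fun C : {set 'I_n} => v0 \in C)) /=; last first.
  by move=> G _; rewrite inE; apply: connect0.
by apply: eq_bigr => C /sum_component.
Qed.

Lemma pairs_prod1D_sorted (s : seq 'I_n) :
  sorted (fun i j : 'I_n => (i < j)%N) s ->
  pairs_prod (fun i j => 1 + z i j) s = \sum_(G | graph_in [set i in s] G) a G.
Proof.
move=> ss; rewrite pairs_prod_sorted//.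
pose E := enum [pred e : 'I_n * 'I_n | [&& e.1 \in s, e.2 \in s & (e.1 < e.2)%N]].
transitivity (\prod_(e <- E) (1 + z e.1 e.2)); first by rewrite big_enum.
rewrite (@prod1D_subsets _ _ (fun e => z e.1 e.2)) ?enum_uniq//.
apply: eq_bigl => G; apply/subsetP/andP.
  move=> GE; split; apply/forall_inP => e /GE; rewrite !inE mem_enum inE.
    by case/and3P.
  by case/and3P => -> ->.
move=> [/forall_inP gG /forall_inP sG] e eG; rewrite inE mem_enum inE.
by have := sG e eG; rewrite !inE => /andP[-> ->]; rewrite gG.
Qed.

End ComponentOf.

(** Expanding the left side gives a sum over all graphs; grouping by the component of the first
    vertex yields the right side, [K] being the rest of that component. This is the combinatorial
    source of the recursion between the two series. *)
Lemma pairs_prod1D_splits (T : Type) (x0 : T) (z : T -> T -> R[i]) x J :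
  pairs_prod (fun x y => 1 + z x y) (x :: J) =
  splits (fun K L => conn_sum x0 z (x :: K) * pairs_prod (fun x y => 1 + z x y) L) J.
Proof.
set s := x :: J; set n := size J.
(* Graphs live on positions, not on points: the list may contain repetitions. *)
pose f (i : 'I_n.+1) := nth x0 s i.
pose zz i j := z (f i) (f j).
pose Jv := map (lift (@ord0 n)) (enum 'I_n).
have enumE : enum 'I_n.+1 = ord0 :: Jv by rewrite /Jv enum_ordSl.
have sE : s = map f (ord0 :: Jv) by rewrite -enumE -(map_nth_enum_ord x0 s).
have JE : J = map f Jv by case: sE.
have sorted_enum : sorted (fun i j : 'I_n.+1 => (i < j)%N) (ord0 :: Jv).
  rewrite -enumE; exact: enum_ord_sorted.
have tr : transitive (fun i j : 'I_n.+1 => (i < j)%N) by move=> a b c; exact: ltn_trans.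
have Jpos : {in Jv, forall i : 'I_n.+1, (@ord0 n < i)%N}.
  by move=> i; apply/allP: i; exact: order_path_min tr sorted_enum.
have sJv : sorted (fun i j : 'I_n.+1 => (i < j)%N) Jv := path_sorted sorted_enum.
have uJv : uniq Jv by apply: sorted_uniq sJv => // i; rewrite ltnn.
rewrite sE pairs_prod_map (@pairs_prod1D_sorted _ zz)//.
have -> : \sum_(G | graph_in [set i in ord0 :: Jv] G) \prod_(e in G) zz e.1 e.2 =
    \sum_(G : {set 'I_n.+1 * 'I_n.+1} | graph_on G) \prod_(e in G) zz e.1 e.2.
  apply: eq_bigl => G; rewrite /graph_in; case: (graph_on G) => //=.
  by apply/forall_inP => e _; rewrite -enumE !inE !mem_enum.
rewrite (sum_graph_on ord0) JE splits_map splits_setE//.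
rewrite (reindex_onto (fun K => ord0 |: K) (fun K => K :\ ord0)) /=; last first.
  by move=> C oC; rewrite setD1K.
have o_notin : ord0 \notin Jv by apply/negP => /Jpos; rewrite ltnn.
have JvE (i : 'I_n.+1) : (i \in Jv) = (i != ord0).
  have : i \in enum 'I_n.+1 by rewrite mem_enum.
  rewrite enumE inE; case: eqVneq => //= -> _; exact/negbTE.
apply: eq_big => [K|K].
  rewrite setU11 /=; apply/eqP/subsetP => [KE i iK|KJ].
    by rewrite inE JvE; apply: contraTneq iK => ->; rewrite -KE !inE eqxx.
  by rewrite setU1K//; apply/negP => /KJ; rewrite inE (negbTE o_notin).
rewrite setU11 /= => /eqP KE.
have KJ : {subset K <= Jv}.
  by move=> i iK; rewrite JvE; apply: contraTneq iK => ->; rewrite -KE !inE eqxx.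
congr (_ * _); last first.
  rewrite pairs_prod_map (@pairs_prod1D_sorted _ zz) ?sorted_filter//.
  apply: eq_bigl => G; congr (graph_in _ _); apply/setP => i.
  by rewrite !inE mem_filter JvE negb_or andbC.
set p := ord0 :: [seq i <- Jv | i \in K].
have pE : x :: map f [seq i <- Jv | i \in K] = map f p by [].
have sp : sorted (fun i j : 'I_n.+1 => (i < j)%N) p.
  rewrite /= path_min_sorted ?sorted_filter//.
  by apply/allP => i; rewrite mem_filter => /andP[_ /Jpos].
rewrite pE /conn_sum.
have szp : (0 < size (map f p))%N by [].
(* The increasing enumeration of the positions in the component, along which [relabel_conn]
   transports its graphs. *)
pose g (i : 'I_(size (map f p))) := nth ord0 p i.
have ip (i : 'I_(size (map f p))) : (i < size p)%N.
  by apply: leq_trans (ltn_ord i) _; rewrite size_map.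
have glt i j : (g i < g j)%N = (i < j)%N.
  have nlt (u v : 'I_(size (map f p))) : (u < v)%N -> (g u < g v)%N.
    by move=> uv; apply: (sorted_ltn_nth tr ord0 sp); rewrite ?inE.
  apply/idP/idP => [|/nlt//]; case: (ltngtP i j) => // [/nlt ji ij|/val_inj ->].
    by have := ltn_trans ji ij; rewrite ltnn.
  by rewrite ltnn.
have := relabel_conn (Ordinal szp) glt zz.
have -> : g (Ordinal szp) = ord0 by [].
have -> : [set g i | i : 'I_(size (map f p))] = ord0 |: K.
  apply/setP => i; apply/imsetP/idP => [[j _ ->]|iK].
    have : g j \in p by rewrite mem_nth.
    by rewrite inE mem_filter !inE => /orP[->//|/andP[->]]; rewrite orbT.
  have ip' : i \in p.
    move: iK; rewrite !inE mem_filter => /orP[->//|iK].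
    by rewrite iK KJ// orbT.
  have szi : (index i p < size (map f p))%N by rewrite size_map index_mem.
  by exists (Ordinal szi) => //; rewrite /g /= nth_index.
move=> <-; apply: eq_bigr => G _; apply: eq_bigr => e _.
by rewrite /zz /g !(nth_map ord0).
Qed.

(** Stability is assumed for all sublists because the tree-graph inequality calls for it on each
    block of a partition; the bounds for the blocks multiply to the product of [B] over the whole
    list. *)
Lemma conn_sum_le (T : eqType) (x0 : T) (z : T -> T -> R[i]) (t : T -> T -> R)
    (B : T -> R) x s m :
  (forall x y, t x y = t y x) -> (forall x y, 0 <= t x y) ->
  (forall x y, cmod (z x y) <= t x y * Num.max 1 (cmod (1 + z x y))) ->
  (forall s', subseq s' (x :: s) ->
     pairs_prod (fun x y => cmod (1 + z x y)) s' <= \prod_(y <- s') B y) ->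
  ((size s).+1 < m)%N ->
  cmod (conn_sum x0 z (x :: s)) <= (\prod_(y <- x :: s) B y) * forests t m [:: x] s.
Proof.
move=> tsym t0 zle stab szm.
set xs := x :: s; set n := size xs.
pose f (i : 'I_n) := nth x0 xs i.
pose Jv := map (lift (@ord0 (size s))) (enum 'I_(size s)).
have enumE : enum 'I_n = ord0 :: Jv by rewrite /n /Jv /= enum_ordSl.
have xsE : xs = map f (enum 'I_n) by rewrite -(map_nth_enum_ord x0 xs).
have sE : s = map f Jv by have := xsE; rewrite enumE => -[].
have M0 : 0 <= \prod_(y <- xs) B y.
  apply: le_trans (stab xs (subseq_refl _)).
  elim: xs {n f Jv enumE xsE sE} => //= y l IH; rewrite mulr_ge0// prodr_ge0// => *.
  exact: cmod_ge0.
apply: le_trans (@tree_graph_le _ n (fun e => z (f e.1) (f e.2))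
   (fun e => t (f e.1) (f e.2)) _ _ (\prod_(y <- xs) B y) _) _.
- by move=> e; exact: t0.
- by move=> e; exact: zle.
- move=> Q; have csym := sym_connect_sym (@gadj_sym _ Q).
  (* A canonical vertex of each component; products over pairs inside components are grouped by
     it. *)
  pose rt := fingraph.root (gadj Q).
  have jE i j : joined Q i j = (rt i == rt j) by rewrite /joined /rt -root_connect.
  rewrite xsE big_map big_enum /= (partition_big rt predT)//=.
  rewrite (partition_big (fun e : 'I_n * 'I_n => rt e.1) predT)//=.
  apply: ler_prod => r _; apply/andP; split.
    by apply: prodr_ge0 => *; exact: cmod_ge0.
  pose l := [seq i <- enum 'I_n | rt i == r].
  have lE i : (i \in l) = (rt i == r) by rewrite mem_filter mem_enum andbT.
  have sl : sorted (fun i j : 'I_n => (i < j)%N) l.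
    by apply: sorted_filter (enum_ord_sorted n) => a b c; exact: ltn_trans.
  have := stab (map f l); rewrite -/xs {1}xsE map_subseq ?filter_subseq//.
  move=> /(_ isT); rewrite pairs_prod_map pairs_prod_sorted// big_map big_filter big_enum_cond /=.
  move=> H; apply: le_trans H; rewrite le_eqVlt; apply/orP; left; apply/eqP.
  apply: eq_bigl => e; rewrite !lE jE.
  case: (rt e.1 =P r) => [->|]; rewrite ?andbT ?andbF//.
  by rewrite eq_sym andbC.
apply: ler_wpM2l => //.
have -> : forests t m [:: x] s = forests (fun i j => t (f i) (f j)) m [:: ord0] Jv.
  by rewrite -(forests_map f t) -sE.
apply: le_trans (sum_rooted_forest_le _ _ _ _); last first.
- by rewrite /= size_map size_enum_ord.
- by have := enum_uniq 'I_n; rewrite enumE.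
- by move=> *; exact: t0.
- by move=> *; exact: tsym.
(* A spanning tree is a forest with the single root [ord0], so the sums compare term by term. *)
rewrite [leLHS]big_mkcond [leRHS]big_mkcond; apply: ler_sum => G _.
case: ifPn => [/and3P[gG cG bG]|_]; last first.
  by case: ifP => // _; apply: prodr_ge0 => *; exact: t0.
suff -> : rooted_forest [:: ord0] Jv G by [].
apply/and5P; split => //.
- by apply/forall_inP => e _; rewrite -[_ ++ _]/(ord0 :: Jv) -enumE !mem_enum.
- by apply/allP => j _ /=; rewrite orbF; move/forallP: cG => /(_ j)/forallP/(_ ord0).
Qed.

End ConnectedSums.

(** * Iterated integrals *)

Section BinomialSum.
Variable V : nmodType.

(** After integration a splitting counts only through the sizes of its two parts, and ['C(n, k)]
    sublists have size [k]. *)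
Definition binomial_sum (a : nat -> nat -> V) (n : nat) : V :=
  \sum_(k < n.+1) a k (n - k)%N *+ 'C(n, k).

Lemma binomial_sumS (a : nat -> nat -> V) n :
  binomial_sum (fun k l => a k.+1 l) n + binomial_sum (fun k l => a k l.+1) n =
  binomial_sum a n.+1.
Proof.
rewrite /binomial_sum [RHS]big_ord_recl /= bin0 subn0.
under [X in _ = _ + X]eq_bigr => k _ do rewrite /bump /= add1n subSS binS mulrnDr.
rewrite big_split /= [RHS]addrA [RHS]addrC; congr (_ + _).
rewrite [X in _ = _ + X]big_ord_recr /= bin_small// mulr0n addr0.
rewrite big_ord_recl /= bin0 subn0; congr (_ + _).
by apply: eq_bigr => k _; rewrite /bump /= add1n subnSK.
Qed.

End BinomialSum.

Section ListMeasurability.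
Context {d : measure_display} {X : measurableType d}.

(* Measurability of functions of finite lists of points, tested against all
   measurable families of lists of a fixed length; no sigma-algebra on lists is
   needed. *)
Definition mlist {dS} {S : measurableType dS} (f : S -> seq X) :=
  (exists n, forall s, size (f s) = n) /\
  (forall i, measurable_fun setT (fun s => nth point (f s) i)).

Definition smeas {dY} {Y : measurableType dY} (F : seq X -> Y) :=
  forall dS (S : measurableType dS) (f : S -> seq X),
    mlist f -> measurable_fun setT (fun s => F (f s)).

Definition smeas2 {dY} {Y : measurableType dY} (F : seq X -> seq X -> Y) :=
  forall dS (S : measurableType dS) (f g : S -> seq X),
    mlist f -> mlist g -> measurable_fun setT (fun s => F (f s) (g s)).

Definition smeas3 {dY} {Y : measurableType dY} (F : seq X -> seq X -> seq X -> Y) :=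
  forall dS (S : measurableType dS) (f g h : S -> seq X),
    mlist f -> mlist g -> mlist h ->
    measurable_fun setT (fun s => F (f s) (g s) (h s)).

Section MlistOps.
Context {dS} {S : measurableType dS}.
Implicit Types f g : S -> seq X.

Lemma mlist_cst (l : seq X) : mlist (fun _ : S => l).
Proof. by split => [|i]; [exists (size l)|exact: measurable_cst]. Qed.

Lemma mlist_cons (x : S -> X) f :
  measurable_fun setT x -> mlist f -> mlist (fun s => x s :: f s).
Proof.
move=> mx [[n fn] mf]; split; first by exists n.+1 => s /=; rewrite fn.
by case=> [|i] /=.
Qed.

Lemma mlist_behead f : mlist f -> mlist (fun s => behead (f s)).
Proof.
move=> [[n fn] mf]; split; first by exists n.-1 => s; rewrite size_behead fn.
by move=> i; under eq_fun do rewrite nth_behead; exact: mf.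
Qed.

Lemma mlist_cat f g : mlist f -> mlist g -> mlist (fun s => f s ++ g s).
Proof.
move=> [[n fn] mf] [[m gm] mg]; split.
  by exists (n + m)%N => s; rewrite size_cat fn gm.
move=> i; under eq_fun do rewrite nth_cat fn.
by case: ltnP => _; [exact: mf|exact: mg].
Qed.

Lemma mlist_comp {dT} {T : measurableType dT} f (g : T -> S) :
  mlist f -> measurable_fun setT g -> mlist (fun t => f (g t)).
Proof.
move=> [[n fn] mf] mg; split; first by exists n.
by move=> i; apply: (measurableT_comp (mf i) mg).
Qed.

End MlistOps.

Section SmeasTheory.
Context {dY} {Y : measurableType dY}.

Lemma smeas2_fix (F : seq X -> seq X -> Y) l : smeas2 F -> smeas (F l).
Proof. by move=> mF dS S f mf; apply: mF => //; exact: mlist_cst. Qed.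

Lemma smeas_cons (F : seq X -> Y) x : smeas F -> smeas (fun s => F (x :: s)).
Proof. by move=> mF dS S f mf; apply: mF; apply: mlist_cons. Qed.

Lemma smeas_consE (F : seq X -> Y) : smeas F -> smeas2 (fun l s => F (nth point l 0 :: s)).
Proof. by move=> mF dS S f g mf mg; apply: mF; apply: mlist_cons => //; case: mf. Qed.

Lemma smeas_point (F : seq X -> Y) : smeas F -> measurable_fun setT (fun x => F [:: x]).
Proof.
by move=> mF; apply: mF; apply: mlist_cons => //; exact: mlist_cst.
Qed.

End SmeasTheory.

End ListMeasurability.

(** * Iterated integrals of nonnegative functions *)

Section IteratedIntegral.
Context {R : realType} {d : measure_display} {X : measurableType d}.
Variable nu : {finite_measure set X -> \bar R}.
Local Open Scope ereal_scope.
Implicit Types F G : seq X -> \bar R.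

Lemma iabs_ge0 n F : (forall s, 0 <= F s) -> 0 <= iabs nu n F.
Proof.
elim: n F => //= n IH F F0; apply: integral_ge0 => x _; exact: IH.
Qed.

Lemma eq_iabs n F G : (forall s, size s = n -> F s = G s) -> iabs nu n F = iabs nu n G.
Proof.
elim: n F G => [|n IH] F G FG /=; first exact: FG.
by apply: eq_integral => x _; apply: IH => s sn; rewrite FG//= sn.
Qed.

(** The integration variable is pushed onto the parameter list ([A'] reads it back from the head),
    so that the induction hypothesis covers the inner integral jointly in parameter and variable, as
    Tonelli's theorem requires. *)
Lemma smeas_iabs n (A : seq X -> seq X -> \bar R) :
  (forall K L, 0 <= A K L) -> smeas2 A -> smeas (fun K => iabs nu n (A K)).
Proof.
elim: n A => [|n IH] A A0 mA dS S f mf /=; first exact: (mA _ _ f (fun=> [::])) _ (mlist_cst _).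
pose A' K L := A (behead K) (nth point K 0 :: L).
have mA' : smeas2 A'.
  move=> dU U p q mp mq; apply: mA; first exact: mlist_behead.
  by apply: mlist_cons => //; case: mp.
have A'0 K L : 0 <= A' K L by exact: A0.
have := IH A' A'0 mA' _ _ (fun sx : S * X => sx.2 :: f sx.1).
rewrite /A' /= => mI.
apply: (@measurable_fun_fubini_tonelli_F _ _ _ _ _ nu
  (fun sx : S * X => iabs nu n (fun L => A (f sx.1) (sx.2 :: L)))).
- apply: mI; apply: mlist_cons; first exact: measurable_snd.
  exact: mlist_comp mf measurable_fst.
- by move=> sx; apply: iabs_ge0.
Qed.

Lemma measurable_iabs_cons n F :
  (forall s, 0 <= F s) -> smeas F ->
  measurable_fun setT (fun x => iabs nu n (fun s => F (x :: s))).
Proof.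
move=> F0 mF.
exact: (smeas_point (@smeas_iabs n (fun l s => F (nth point l 0 :: s)) _ (smeas_consE mF))).
Qed.

(** Almost everywhere, one variable at a time, parallel to the recursion of [iabs]; no product
    measure is formed. *)
Fixpoint aen (n : nat) (P : seq X -> Prop) : Prop :=
  if n is n'.+1 then {ae nu, forall x, aen n' (fun s => P (x :: s))} else P [::].

Lemma aenS n (P Q : seq X -> Prop) :
  (forall s, size s = n -> P s -> Q s) -> aen n P -> aen n Q.
Proof.
elim: n P Q => [|n IH] P Q PQ /=; first exact: PQ.
apply: filterS => x; apply: IH => s sn; apply: PQ; by rewrite /= sn.
Qed.

Lemma aenW n (P : seq X -> Prop) : (forall s, size s = n -> P s) -> aen n P.
Proof.
elim: n P => [|n IH] P HP /=; first exact: HP.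
by apply: aeW => x; apply: IH => s sn; apply: HP; rewrite /= sn.
Qed.

Lemma aen_forall (I : finType) n (P : I -> seq X -> Prop) :
  (forall i, aen n (P i)) -> aen n (fun s => forall i, P i s).
Proof.
elim: n P => [|n IH] P HP //=.
suff H : {ae nu, forall x, forall i, aen n (fun s => P i (x :: s))}.
  by apply: filterS H => x; exact: IH.
exact: (@filter_forall _ I (fun i x => aen n (fun s => P i (x :: s)))
  (almost_everywhere nu) (ae_filter_ringOfSetsType nu) HP).
Qed.

Lemma aen_mask (m : bitseq) (P : seq X -> Prop) :
  aen (count id m) P -> aen (size m) (fun s => P (mask m s)).
Proof.
elim: m P => [|[] m IH] P //=.
- by apply: filterS => x; exact: IH.
- by move=> HP; apply: aeW => x; exact: IH.
Qed.

(** A list of length [n] has finitely many sublists, each selected by a mask, and the coordinates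
    that a mask drops impose no condition. *)
Lemma aen_subseq (P : seq X -> Prop) n :
  (forall k, aen k P) -> aen n (fun s => forall s', subseq s' s -> P s').
Proof.
move=> HP; have : aen n (fun s => forall m : n.-tuple bool, P (mask m s)).
  apply: aen_forall => m; have := @aen_mask m P (HP _).
  by rewrite size_tuple.
apply: aenS => s sn Ps s' /subseqP[m sm ->].
have szm : size m == n by rewrite sm sn.
exact: (Ps (Tuple szm)).
Qed.

Lemma le_iabs n F G : (forall s, 0 <= F s) -> (forall s, 0 <= G s) ->
  smeas F -> smeas G -> aen n (fun s => F s <= G s) ->
  iabs nu n F <= iabs nu n G.
Proof.
elim: n F G => [|n IH] F G F0 G0 mF mG FG //=.
apply: ae_ge0_le_integral => //.
- by move=> x _; exact: iabs_ge0.
- exact: measurable_iabs_cons.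
- by move=> x _; exact: iabs_ge0.
- exact: measurable_iabs_cons.
- move: FG => /=; apply: filterS => x FGx _; apply: IH => //; exact: smeas_cons.
Qed.

(** Converts [prod_ae], a vanishing integral of an indicator, into the pointwise form [aen]. *)
Lemma iabs_eq0 n F : (forall s, 0 <= F s) -> smeas F ->
  iabs nu n F = 0 -> aen n (fun s => F s = 0).
Proof.
elim: n F => [|n IH] F F0 mF //= I0.
have mI := @measurable_iabs_cons n F F0 mF.
have /(ae_eq_integral_abs nu measurableT mI) : \int[nu]_x `|iabs nu n (fun s => F (x :: s))| = 0.
  rewrite -[RHS]I0; apply: eq_integral => x _; rewrite gee0_abs//; exact: iabs_ge0.
apply: filterS => x /(_ I) /= Ix; apply: IH => //; exact: smeas_cons.
Qed.

Lemma iabsD n F G : (forall s, 0 <= F s) -> (forall s, 0 <= G s) ->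
  smeas F -> smeas G ->
  iabs nu n (fun s => F s + G s) = iabs nu n F + iabs nu n G.
Proof.
elim: n F G => [|n IH] F G F0 G0 mF mG //=.
rewrite -ge0_integralD//.
- by apply: eq_integral => x _; apply: IH => //; exact: smeas_cons.
- by move=> x _; exact: iabs_ge0.
- exact: measurable_iabs_cons.
- by move=> x _; exact: iabs_ge0.
- exact: measurable_iabs_cons.
Qed.

Lemma iabsZl n F (k : \bar R) : (forall s, 0 <= F s) -> 0 <= k -> smeas F ->
  iabs nu n (fun s => k * F s) = k * iabs nu n F.
Proof.
move=> + k0; elim: n F => [|n IH] F F0 mF //=.
rewrite -ge0_integralZl//.
- by apply: eq_integral => x _; apply: IH => //; exact: smeas_cons.
- exact: measurable_iabs_cons.
- by move=> x _; exact: iabs_ge0.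
Qed.

Lemma iabs_sum n (I : Type) (r : seq I) (F : I -> seq X -> \bar R) :
  (forall i s, 0 <= F i s) -> (forall i, smeas (F i)) ->
  iabs nu n (fun s => \sum_(i <- r) F i s) = \sum_(i <- r) iabs nu n (F i).
Proof.
elim: n F => [|n IH] F F0 mF //=.
rewrite -ge0_integral_sum//.
- apply: eq_integral => x _; apply: (IH (fun i s => F i (x :: s))) => // i.
  exact: smeas_cons.
- move=> i; exact: measurable_iabs_cons.
- by move=> i x _; exact: iabs_ge0.
Qed.

(** Tonelli's theorem applied repeatedly: the integral over [x] moves from the innermost to the
    outermost place past one variable at a time. *)
Lemma iabs_swap n F : (forall s, 0 <= F s) -> smeas F ->
  iabs nu n (fun s => \int[nu]_x F (x :: s)) = iabs nu n.+1 F.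
Proof.
elim: n F => [//|n IH] F F0 mF.
pose F' y K := F (nth point K 0 :: y :: behead K).
have mF' y : smeas (F' y).
  move=> dS S f mf; apply: mF; apply: mlist_cons; first by case: mf.
  by apply: mlist_cons => //; exact: mlist_behead.
transitivity (\int[nu]_y iabs nu n.+1 (F' y)).
  by apply: eq_integral => y _; rewrite -(IH (F' y)) // => s; exact: F0.
rewrite /F' /= (@fubini_tonelli _ _ _ _ _ nu nu
  (fun yx : X * X => iabs nu n (fun s => F (yx.2 :: yx.1 :: s))))//.
  have mA : smeas2 (fun K L => F (nth point K 0 :: nth point K 1 :: L)).
    move=> dS S f g mf mg; apply: mF; do 2 (apply: mlist_cons; first by case: mf).
    exact: mg.
  have := @smeas_iabs n (fun K L => F (nth point K 0 :: nth point K 1 :: L))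
    (fun _ _ => F0 _) mA _ _ (fun yx : X * X => [:: yx.2; yx.1]).
  apply; apply: mlist_cons; first exact: measurable_snd.
  by apply: mlist_cons; [exact: measurable_fst|exact: mlist_cst].
by move=> yx; exact: iabs_ge0.
Qed.

End IteratedIntegral.

Section SmeasForests.
Context {R : realType} {d : measure_display} {X : measurableType d}.

Lemma smeas2_prod (f : X -> X -> R) : measurable_fun setT (fun p : X * X => f p.1 p.2) ->
  smeas2 (fun I K : seq X => \prod_(k <- K) f (nth point I 0) k).
Proof.
move=> mf dS S g h [_ mg] [[n hn] mh].
rewrite (_ : (fun _ => _) =
  (fun s => \prod_(i < n) f (nth point (g s) 0) (nth point (h s) i))); last first.
  by apply/funext => s; rewrite (big_nth point) hn big_mkord.
apply: measurable_prod => i _.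
exact: (measurableT_comp mf (measurable_fun_pair (mg 0%N) (mh i))).
Qed.

Lemma smeas_prod (f : X -> R) : measurable_fun setT f ->
  smeas (fun K : seq X => \prod_(k <- K) f k).
Proof.
move=> mf dS S h mh.
apply: (@smeas2_prod (fun _ => f) _ _ _ (fun=> [::])) => //; last exact: mlist_cst.
exact: measurableT_comp mf measurable_snd.
Qed.

Lemma smeas2_splits (A : seq X -> seq X -> seq X -> R) :
  smeas3 A -> smeas2 (fun I J => splits (A I) J).
Proof.
move=> mA dS S f g mf [[n gn] mg]; elim: n A mA f mf g gn mg => [|n IH] A mA f mf g gn mg.
  rewrite (_ : (fun _ => _) = (fun s => A (f s) [::] [::])); last first.
    by apply/funext => s; rewrite (size0nil (gn s)).
  by apply: mA => //; exact: mlist_cst.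
pose A1 I K L := A (behead I) (nth point I 0 :: K) L.
pose A2 I K L := A (behead I) K (nth point I 0 :: L).
have mgl : mlist g by split => //; exists n.+1.
have mgb : mlist (fun s => behead (g s)) by exact: mlist_behead.
rewrite (_ : (fun _ => _) =
    (fun s => splits (A1 (nth point (g s) 0 :: f s)) (behead (g s)) +
              splits (A2 (nth point (g s) 0 :: f s)) (behead (g s)))); last first.
  by apply/funext => s; have := gn s; case: (g s).
have sgb s : size (behead (g s)) = n by rewrite size_behead gn.
apply: measurable_funD; apply: IH => //; try by case: mgb.
- move=> dU U p q r mp mq mr; apply: mA => //; first exact: mlist_behead.
  by apply: mlist_cons => //; case: mp.
- exact: mlist_cons.
- move=> dU U p q r mp mq mr; apply: mA => //; first exact: mlist_behead.
  by apply: mlist_cons => //; case: mp.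
- exact: mlist_cons.
Qed.

Lemma smeas_splits (A : seq X -> seq X -> R) : smeas2 A -> smeas (splits A).
Proof.
move=> mA dS S g mg.
apply: (@smeas2_splits (fun _ => A) _ _ _ (fun=> [::])) => //; last exact: mlist_cst.
by move=> dU U p q r _ mq mr; exact: mA.
Qed.

Lemma smeas2_forests (t : X -> X -> R) m :
  measurable_fun setT (fun p : X * X => t p.1 p.2) -> smeas2 (forests t m).
Proof.
move=> mt; elim: m => [|m IH] dS S f g mf mg /=; first exact: measurable_cst.
have [[n fn] mfi] := mf; case: n fn => [|n] fn.
  have [[k gk] _] := mg.
  rewrite (_ : (fun _ => _) = fun=> (k == 0%N)%:R); first exact: measurable_cst.
  by apply/funext => s; rewrite (size0nil (fn s)) gk.
pose A I K L := (\prod_(k <- K) t (nth point I 0) k) * forests t m (behead I ++ K) L.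
rewrite (_ : (fun _ => _) = (fun s => splits (A (f s)) (g s))).
  apply: smeas2_splits => // dU U p q r mp mq mr; apply: measurable_funM.
    exact: smeas2_prod.
  by apply: IH => //; apply: mlist_cat => //; exact: mlist_behead.
by apply/funext => s; have := fn s; case: (f s).
Qed.

End SmeasForests.

Lemma exp_partial_sum_le {R : realType} (x : R) M : 0 <= x ->
  \sum_(k < M) (k`!%:R)^-1 * x ^+ k <= expR x.
Proof.
move=> x0; rewrite -(big_mkord xpredT (fun k => (k`!%:R)^-1 * x ^+ k)).
rewrite /expR; apply: le_trans (nondecreasing_cvgn_le _ (is_cvg_series_exp_coeff x) M).
  rewrite le_eqVlt; apply/orP; left; apply/eqP.
  by apply: eq_bigr => i _; rewrite /exp_coeff /= mulrC.
apply/nondecreasing_seqP => n; rewrite /series /= big_nat_recr//= lerDl.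
by rewrite /exp_coeff /= divr_ge0 ?exprn_ge0.
Qed.

Lemma sum_triangle (V : nmodType) (f : nat -> nat -> V) M :
  \sum_(j < M) \sum_(k < j.+1) f k (j - k)%N = \sum_(k < M) \sum_(l < M - k) f k l.
Proof.
have widen (j : 'I_M) :
    \sum_(k < j.+1) f k (j - k)%N = \sum_(k < M | (k <= j)%N) f k (j - k)%N.
  by rewrite (big_ord_widen M (fun k => f k (j - k)%N) (ltn_ord j)).
under eq_bigr => j _ do rewrite widen big_mkcond /=.
rewrite exchange_big /=; apply: eq_bigr => k _.
have := ltnW (ltn_ord k); move: (nat_of_ord k) => {}k.
elim: M {widen} => [|M IH]; first by rewrite leqn0 => /eqP ->; rewrite !big_ord0.
rewrite leq_eqVlt => /orP[/eqP ->|kM].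
  rewrite subnn big_ord0 big1// => j _; case: ifP => // jM.
  by have := ltn_ord j; rewrite ltnNge jM.
rewrite ltnS in kM; rewrite big_ord_recr /= IH// kM subSn// big_ord_recr //=.
Qed.

Section EnnSums.
Context {R : realType}.
Local Open Scope ereal_scope.

Lemma natmul_EFin (x : \bar R) n : (x *+ n)%R = n%:R%:E * x.
Proof.
case: n => [|n]; first by rewrite mulr0n mul0e.
rewrite mule_natl; elim: n => [|n IH]; first by rewrite mulr1n.
by rewrite mulrS IH.
Qed.

Lemma sum_triangle_le (f : nat -> nat -> \bar R) M : (forall k l, 0 <= f k l) ->
  \sum_(j < M) \sum_(k < j.+1) f k (j - k)%N <= \sum_(k < M) \sum_(l < M) f k l.
Proof.
move=> f0; rewrite sum_triangle; apply: lee_sum => k _.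
rewrite (big_ord_widen M (fun l => f k l) (leq_subr k M)) big_mkcond.
by apply: lee_sum => l _; case: ifP.
Qed.

End EnnSums.

(** * Integration of rooted forests *)

Section ForestIntegral.
Context {R : realType} {d : measure_display} {X : measurableType d}.
Variable nu : {finite_measure set X -> \bar R}.
Local Open Scope ereal_scope.

(** Induction on the first variable, which goes either to [K] or to [L]; Pascal's rule adds the two
    cases. *)
Lemma iabs_splits (A : seq X -> seq X -> R) n :
  (forall K L, (0 <= A K L)%R) -> smeas2 A ->
  iabs nu n (fun J => (splits A J)%:E) =
  binomial_sum (fun k l => iabs nu k (fun K => iabs nu l (fun L => (A K L)%:E))) n.
Proof.
elim: n A => [|n IH] A A0 mA.
  by rewrite /binomial_sum big_ord_recl big_ord0 /= addr0 mulr1n.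
have mA' : smeas2 (fun K L => (A K L)%:E).
  by move=> dS S f g mf mg; apply/measurable_EFinP; exact: mA.
have A'0 K L : 0 <= (A K L)%:E by rewrite lee_fin.
pose A1 y K L := A (y :: K) L; pose A2 y K L := A K (y :: L).
have mA1 y : smeas2 (A1 y).
  by move=> dS S f g mf mg; apply: mA => //; exact: mlist_cons.
have mA2 y : smeas2 (A2 y).
  by move=> dS S f g mf mg; apply: mA => //; exact: mlist_cons.
pose a1 k l y := iabs nu k (fun K => iabs nu l (fun L => (A1 y K L)%:E)).
pose a2 k l y := iabs nu k (fun K => iabs nu l (fun L => (A2 y K L)%:E)).
have a10 k l y : 0 <= a1 k l y by do 2 (apply: iabs_ge0 => ?); rewrite lee_fin A0.
have a20 k l y : 0 <= a2 k l y by do 2 (apply: iabs_ge0 => ?); rewrite lee_fin A0.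
have ma1 k l : measurable_fun setT (a1 k l).
  apply: (@measurable_iabs_cons _ _ _ _ _ (fun K => iabs nu l (fun L => (A K L)%:E))).
    by move=> K; apply: iabs_ge0.
  exact: smeas_iabs.
have ma2 k l : measurable_fun setT (a2 k l).
  have m3 : smeas2 (fun I K => iabs nu l (fun L => (A K (nth point I 0 :: L))%:E)).
    move=> dS S f g mf mg.
    apply: (@smeas_iabs _ _ _ nu l
       (fun P L => (A (behead P) (nth point P 0 :: L))%:E)
       (fun _ _ => A'0 _ _) _ _ _ (fun s => nth point (f s) 0 :: g s)).
      move=> dU U p q mp mq; apply: mA'; first exact: mlist_behead.
      by apply: mlist_cons => //; case: mp.
    by apply: mlist_cons => //; case: mf.
  have := @smeas_iabs _ _ _ nu k _ _ m3; move=> h.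
  by apply: (smeas_point (h _)) => I K; apply: iabs_ge0.
have intb (a : nat -> nat -> X -> \bar R) : (forall k l y, 0 <= a k l y) ->
    (forall k l, measurable_fun setT (a k l)) ->
    \int[nu]_y binomial_sum (fun k l => a k l y) n =
    binomial_sum (fun k l => \int[nu]_y a k l y) n.
  move=> a0 ma; rewrite /binomial_sum ge0_integral_sum//.
  - apply: eq_bigr => k _; rewrite natmul_EFin -ge0_integralZl//.
      by apply: eq_integral => y _; rewrite natmul_EFin.
  - move=> k; under eq_fun do rewrite natmul_EFin.
    exact: measurable_funeM.
  - by move=> k y _; rewrite natmul_EFin mule_ge0// lee_fin.
rewrite -binomial_sumS -[X in X + _]/(binomial_sum (fun k l => \int[nu]_y a1 k l y) n).
rewrite -intb//.
(* A variable given to [L] is integrated inside the integral over [K]; [iabs_swap] brings it to the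
   front. *)
have -> : binomial_sum (fun k l => iabs nu k (fun K => iabs nu l.+1 (fun L => (A K L)%:E))) n =
    binomial_sum (fun k l => \int[nu]_y a2 k l y) n.
  congr binomial_sum; apply/funext => k; apply/funext => l.
  rewrite -[RHS](@iabs_swap _ _ _ nu k
    (fun P => iabs nu l (fun L => (A (behead P) (nth point P 0 :: L))%:E)))//.
    by move=> P; apply: iabs_ge0.
  apply: smeas_iabs => // dU U p q mp mq; apply: mA'; first exact: mlist_behead.
  by apply: mlist_cons => //; case: mp.
rewrite -intb// -ge0_integralD//.
- apply: eq_integral => y _ /=.
  transitivity (iabs nu n (fun J => (splits (A1 y) J)%:E) +
                iabs nu n (fun J => (splits (A2 y) J)%:E)); last first.
    by congr (_ + _); apply: IH => // K L; exact: A0.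
  rewrite -iabsD//.
  + by move=> s; rewrite lee_fin splits_ge0// => K L; exact: A0.
  + by move=> s; rewrite lee_fin splits_ge0// => K L; exact: A0.
  + move=> dS S f mf; apply/measurable_EFinP; exact: (smeas_splits (mA1 y)).
  + move=> dS S f mf; apply/measurable_EFinP; exact: (smeas_splits (mA2 y)).
- by move=> y _; apply: sume_ge0 => k _; rewrite natmul_EFin mule_ge0// lee_fin.
- apply: emeasurable_sum => k; under eq_fun do rewrite natmul_EFin.
  exact: measurable_funeM.
- by move=> y _; apply: sume_ge0 => k _; rewrite natmul_EFin mule_ge0// lee_fin.
- apply: emeasurable_sum => k; under eq_fun do rewrite natmul_EFin.
  exact: measurable_funeM.
Qed.

Lemma aen_all (P : X -> Prop) n : {ae nu, forall x, P x} ->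
  aen nu n (fun s => forall x, x \in s -> P x).
Proof.
move=> HP; elim: n => [|n IH] //=; move: HP; apply: filterS => x Px.
by apply: aenS IH => s _ Ps y; rewrite inE => /orP[/eqP ->|/Ps].
Qed.

Lemma iabs_prod_le (g : X -> R) (c : R) k : (forall x, (0 <= g x)%R) ->
  measurable_fun setT g -> \int[nu]_x (g x)%:E <= c%:E ->
  iabs nu k (fun s => (\prod_(x <- s) g x)%:E) <= (c ^+ k)%:E.
Proof.
move=> g0 mg gc; elim: k => [|k IH] /=; first by rewrite big_nil.
have p0 s : 0 <= (\prod_(x <- s) g x)%:E by rewrite lee_fin prodr_ge0.
have mp : smeas (fun s : seq X => (\prod_(x <- s) g x)%:E).
  by move=> dS S f mf; apply/measurable_EFinP; exact: smeas_prod.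
rewrite (eq_integral (fun x => (g x)%:E * iabs nu k (fun s => (\prod_(x <- s) g x)%:E))).
  rewrite ge0_integralZr//.
  - by rewrite exprS EFinM lee_pmul// ?iabs_ge0// integral_ge0// => x _; rewrite lee_fin.
  - exact/measurable_EFinP.
  - by move=> x _; rewrite lee_fin.
  - exact: iabs_ge0.
move=> x _; rewrite -iabsZl// ?lee_fin//; apply: eq_iabs => s _.
by rewrite big_cons EFinM.
Qed.

Lemma iabs0 n : iabs nu n (fun=> 0) = 0.
Proof. by elim: n => //= n IH; rewrite IH integral0. Qed.

Section ForestBound.
Variables (t : X -> X -> R) (B a : X -> R).
Hypotheses (t0 : forall x y, (0 <= t x y)%R) (B0 : forall x, (0 <= B x)%R)
  (a0 : forall x, (0 <= a x)%R).
Hypotheses (mt : measurable_fun setT (fun p : X * X => t p.1 p.2))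
  (mB : measurable_fun setT B) (ma : measurable_fun setT a).

Let good x := \int[nu]_y (t x y * B y * expR (a y))%:E <= (a x)%:E.
Let ae_good := {ae nu, forall x, good x}.

Let w m I J : R := forests t m I J * \prod_(y <- J) B y.

Let w_ge0 m I J : (0 <= w m I J)%R.
Proof. by rewrite mulr_ge0 ?forests_ge0 ?prodr_ge0. Qed.

Let sm_w m : smeas2 (w m).
Proof.
move=> dS S f g mf mg; apply: measurable_funM; first exact: smeas2_forests.
exact: smeas_prod.
Qed.

Let sm_wE m : smeas2 (fun I J => (w m I J)%:E).
Proof. by move=> dS S f g mf mg; apply/measurable_EFinP; exact: sm_w. Qed.

Let c k : R := (k`!%:R)^-1.
Let c_ge0 k : (0 <= c k)%R. Proof. by rewrite invr_ge0. Qed.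

Let P i (K : seq X) : R := \prod_(k <- K) (t i k * B k).

Let w_cons m i I J :
  w m.+1 (i :: I) J = splits (fun K L => P i K * w m (I ++ K) L)%R J.
Proof.
rewrite /w /= -/(splits _ _).
have H (A : seq X -> seq X -> R) :
    (splits A J * \prod_(y <- J) B y =
     splits (fun K L => A K L * ((\prod_(y <- K) B y) * \prod_(y <- L) B y)) J)%R.
  elim: J A => [|y J IH] A /=; first by rewrite !big_nil !mulr1.
  by rewrite big_cons mulrDl; congr (_ + _)%R;
    rewrite [(B y * _)%R]mulrC mulrA IH splits_mulr; apply: eq_splits => K L _;
    rewrite !big_cons; ring.
rewrite H; apply: eq_splits => K L _; rewrite /P big_split /=; ring.
Qed.

(** Let the first root [i] have [k] neighbours. By induction the rest integrates to at most the
    product of [expR (a x)] over the remaining roots and these neighbours. By [good i] each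
    neighbour then integrates to at most [a i], and the sum of [a i ^+ k / k!] is at most
    [expR (a i)]. The roots are fixed points, hence the separate requirement that they be good. *)
Lemma forest_integral_le m M I : ae_good -> (forall x, x \in I -> good x) ->
  \sum_(j < M) (c j)%:E * iabs nu j (fun J => (w m I J)%:E) <=
  (\prod_(i <- I) expR (a i))%:E.
Proof.
move=> aeg; elim: m M I => [|m IH] M I gI.
  rewrite big1 => [|j _].
    by rewrite lee_fin; apply: prodr_ge0 => i _; exact: expR_ge0.
  by rewrite (@eq_iabs _ _ _ _ _ _ (fun=> 0)) ?iabs0 ?mule0// => s _; rewrite /w mul0r.
case: I gI => [|i I] gI.
  rewrite big_nil; case: M => [|M]; first by rewrite big_ord0 lee_fin.
  rewrite big_ord_recl big1 ?adde0 => [|j _].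
    by rewrite /= /c fact0 invr1 mul1e /w /= big_nil mulr1.
  rewrite (@eq_iabs _ _ _ _ _ _ (fun=> 0)) ?iabs0 ?mule0// => s sj.
  by rewrite /w /= sj mul0r.
have gi : good i by apply: gI; rewrite mem_head.
have {}gI x : x \in I -> good x by move=> xI; apply: gI; rewrite inE xI orbT.
pose W l I' := iabs nu l (fun L => (w m I' L)%:E).
have W0 l I' : 0 <= W l I' by apply: iabs_ge0 => L; rewrite lee_fin.
have P0 K : (0 <= P i K)%R by apply: prodr_ge0 => k _; rewrite mulr_ge0.
have PE0 K : 0 <= (P i K)%:E by rewrite lee_fin.
have mti : measurable_fun setT (t i) := measurableT_comp mt (pair1_measurable i).
have mP : smeas (P i).
  by apply: smeas_prod; apply: measurable_funM.
have mPE : smeas (fun K => (P i K)%:E).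
  by move=> dS S f mf; apply/measurable_EFinP; exact: mP.
have mw : smeas2 (fun K L => (w m (I ++ K) L)%:E).
  by move=> dS S f g mf mg; apply: sm_wE => //; apply: mlist_cat => //; exact: mlist_cst.
have mW l : smeas (fun K => W l (I ++ K)).
  by apply: smeas_iabs => // K L; rewrite lee_fin.
pose f k l := iabs nu k (fun K => ((c k)%:E * (P i K)%:E) * ((c l)%:E * W l (I ++ K))).
have mf k l : smeas (fun K => ((c k)%:E * (P i K)%:E) * ((c l)%:E * W l (I ++ K))).
  move=> dS S g mg; apply: emeasurable_funM; apply: measurable_funeM.
    exact: mPE.
  exact: mW.
have f_ge0 k l K : 0 <= ((c k)%:E * (P i K)%:E) * ((c l)%:E * W l (I ++ K)).
  by rewrite !mule_ge0// lee_fin.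
have termE j : (c j)%:E * iabs nu j (fun J => (w m.+1 (i :: I) J)%:E) =
    \sum_(k < j.+1) f k (j - k)%N.
  rewrite (_ : (fun J => _) = fun J =>
      (splits (fun K L => P i K * w m (I ++ K) L)%R J)%:E); last first.
    by apply/funext => J; rewrite w_cons.
  rewrite iabs_splits; [|by move=> K L; rewrite mulr_ge0| ]; last first.
    move=> dS S p q mp mq; apply: measurable_funM; first exact: mP.
    by apply: sm_w => //; apply: mlist_cat => //; exact: mlist_cst.
  rewrite /binomial_sum ge0_sume_distrr; last first.
    move=> k _; rewrite natmul_EFin mule_ge0 ?lee_fin//.
    by do 2 (apply: iabs_ge0 => ?); rewrite lee_fin mulr_ge0.
  apply: eq_bigr => k _; rewrite natmul_EFin muleA -EFinM.
  (* The factorial of [j] splits between neighbours and remaining vertices, so that the sum becomes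
     a convolution. *)
  have -> : (c j * 'C(j, k)%:R = c k * c (j - k)%N)%R.
    have kj : (k <= j)%N by rewrite -ltnS.
    rewrite /c -(bin_fact kj) !natrM; field.
    by rewrite !pnatr_eq0 -!lt0n !fact_gt0 bin_gt0 kj.
  rewrite -iabsZl ?lee_fin ?mulr_ge0//.
  - apply: eq_iabs => K _; rewrite EFinM -!muleA; congr (_ * _).
    rewrite muleCA; congr (_ * _).
    rewrite /W -iabsZl ?lee_fin//; last exact: smeas2_fix mw.
    by move=> s; rewrite lee_fin.
  - by move=> K; apply: iabs_ge0 => L; rewrite lee_fin mulr_ge0.
  - apply: smeas_iabs; first by move=> K L; rewrite lee_fin mulr_ge0.
    move=> dS S p q mp mq; apply/measurable_EFinP; apply: measurable_funM; first exact: mP.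
    by apply: sm_w => //; apply: mlist_cat => //; exact: mlist_cst.
rewrite (eq_bigr (fun j : 'I_M => \sum_(k < j.+1) f k (j - k)%N)); last first.
  by move=> j _; exact: termE.
(* Enlarging the triangle to a square makes the range of [l] independent of [k]: the inner sum is
   then that of the induction hypothesis for [I ++ K]. *)
apply: le_trans (sum_triangle_le _ _) _; first by move=> k l; exact: iabs_ge0.
rewrite big_cons.
apply: (@le_trans _ _ (\sum_(k < M) ((\prod_(x <- I) expR (a x)) * (c k * a i ^+ k))%:E)).
  apply: lee_sum => k _.
  rewrite /f -(@iabs_sum _ _ _ nu k _ _ (fun (l : 'I_M) K =>
    ((c k)%:E * (P i K)%:E) * ((c l)%:E * W l (I ++ K))))//.
  have mG : smeas (fun K : seq X => (\prod_(x <- K) (t i x * B x * expR (a x)))%:E).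
    move=> dS S g mg; apply/measurable_EFinP; apply: smeas_prod => //.
    apply: measurable_funM; last exact: measurableT_comp.
    exact: measurable_funM.
  have G0 (K : seq X) : 0 <= (\prod_(x <- K) (t i x * B x * expR (a x)))%:E.
    by rewrite lee_fin prodr_ge0// => x _; rewrite !mulr_ge0// expR_ge0.
  have cI : (0 <= c k * \prod_(x <- I) expR (a x))%R.
    by rewrite mulr_ge0// prodr_ge0// => x _; exact: expR_ge0.
  apply: (@le_trans _ _ (iabs nu k (fun K => (c k * \prod_(x <- I) expR (a x))%:E *
      (\prod_(x <- K) (t i x * B x * expR (a x)))%:E))).
    apply: le_iabs.
    - by move=> K; apply: sume_ge0 => l _.
    - by move=> K; rewrite mule_ge0// lee_fin.
    - by move=> dS S g mg; apply: emeasurable_sum => l; exact: mf.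
    - by move=> dS S g mg; apply: measurable_funeM; exact: mG.
    - apply: aenS (aen_all k aeg) => K _ gK.
      rewrite -ge0_sume_distrr; last by move=> l _; rewrite mule_ge0// lee_fin.
      have := IH M (I ++ K); rewrite -/(W _ _) => IHK.
      apply: (@le_trans _ _ (((c k)%:E * (P i K)%:E) *
          (\prod_(x <- I ++ K) expR (a x))%:E)).
        apply: lee_wpmul2l; first by rewrite mule_ge0// lee_fin.
        by apply: IHK => x; rewrite mem_cat => /orP[/gI|/gK].
      by rewrite -!EFinM lee_fin big_cat /P !big_split /= le_eqVlt; apply/orP; left;
        apply/eqP; ring.
  rewrite iabsZl ?lee_fin//.
  apply: (@le_trans _ _ ((c k * \prod_(x <- I) expR (a x))%:E * (a i ^+ k)%:E)).
    apply: lee_wpmul2l; first by rewrite lee_fin.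
    apply: iabs_prod_le => //.
      by move=> x; rewrite !mulr_ge0// expR_ge0.
    apply: measurable_funM; last exact: measurableT_comp.
    exact: measurable_funM.
  by rewrite -EFinM lee_fin le_eqVlt; apply/orP; left; apply/eqP; ring.
rewrite sumEFin lee_fin -mulr_sumr mulrC; apply: ler_wpM2r.
  by apply: prodr_ge0 => x _; exact: expR_ge0.
exact: exp_partial_sum_le.
Qed.

End ForestBound.
End ForestIntegral.

(** * Bounds on the cluster functions *)

Section ComplexMeasurability.
Context {R : realType} {dT : measure_display} {T : measurableType dT}.
Implicit Types f g : T -> R[i].

Definition cmeasurable f :=
  measurable_fun setT (fun x => cRe (f x)) /\ measurable_fun setT (fun x => cIm (f x)).

Lemma cmeasurable_cst (z : R[i]) : cmeasurable (fun=> z).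
Proof. by split; exact: measurable_cst. Qed.

Lemma cReD (z w : R[i]) : cRe (z + w) = cRe z + cRe w. Proof. by case: z; case: w. Qed.
Lemma cImD (z w : R[i]) : cIm (z + w) = cIm z + cIm w. Proof. by case: z; case: w. Qed.
Lemma cReM (z w : R[i]) : cRe (z * w) = cRe z * cRe w - cIm z * cIm w.
Proof. by case: z; case: w. Qed.
Lemma cImM (z w : R[i]) : cIm (z * w) = cRe z * cIm w + cIm z * cRe w.
Proof. by case: z; case: w. Qed.

Lemma cmeasurableD f g : cmeasurable f -> cmeasurable g -> cmeasurable (fun x => f x + g x).
Proof.
move=> [fr fi] [gr gi]; split.
  by under eq_fun do rewrite cReD; exact: measurable_funD.
by under eq_fun do rewrite cImD; exact: measurable_funD.
Qed.

Lemma cmeasurableM f g : cmeasurable f -> cmeasurable g -> cmeasurable (fun x => f x * g x).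
Proof.
move=> [fr fi] [gr gi]; split.
  under eq_fun do rewrite cReM; apply: measurable_funB; exact: measurable_funM.
under eq_fun do rewrite cImM; apply: measurable_funD; exact: measurable_funM.
Qed.

Lemma cmeasurable_sum (I : Type) (r : seq I) (P : pred I) (f : I -> T -> R[i]) :
  (forall i, cmeasurable (f i)) -> cmeasurable (fun x => \sum_(i <- r | P i) f i x).
Proof.
move=> mf; elim: r => [|i r IH].
  by under eq_fun do rewrite big_nil; exact: cmeasurable_cst.
under eq_fun do rewrite big_cons; case: (P i) => //; exact: cmeasurableD.
Qed.

Lemma cmeasurable_prod (I : Type) (r : seq I) (P : pred I) (f : I -> T -> R[i]) :
  (forall i, cmeasurable (f i)) -> cmeasurable (fun x => \prod_(i <- r | P i) f i x).
Proof.
move=> mf; elim: r => [|i r IH].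
  by under eq_fun do rewrite big_nil; exact: cmeasurable_cst.
under eq_fun do rewrite big_cons; case: (P i) => //; exact: cmeasurableM.
Qed.

Lemma measurable_cmod f : cmeasurable f -> measurable_fun setT (fun x => cmod (f x)).
Proof.
move=> [fr fi]; apply: measurableT_comp.
  apply: continuous_measurable_fun; exact: sqrt_continuous.
by apply: measurable_funD; exact: measurable_funX.
Qed.

End ComplexMeasurability.

Lemma cmeasurable_comp {R : realType} {dT dS : measure_display} {T : measurableType dT}
    {S : measurableType dS} (f : T -> R[i]) (g : S -> T) :
  cmeasurable f -> measurable_fun setT g -> cmeasurable (fun s => f (g s)).
Proof.
by move=> [fr fi] mg; split; [exact: measurableT_comp fr mg|exact: measurableT_comp fi mg].
Qed.

Section ClusterMeasurability.
Context {R : realType} {d : measure_display} {X : measurableType d}.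
Variables (ur : X * X -> \bar R) (ui : X * X -> R).
Hypotheses (mur : measurable_fun setT ur) (mui : measurable_fun setT ui).

Definition csmeas (F : seq X -> R[i]) :=
  smeas (fun s => cRe (F s)) /\ smeas (fun s => cIm (F s)).

Lemma csmeasP (F : seq X -> R[i]) :
  (forall dS (S : measurableType dS) (f : S -> seq X), mlist f ->
    cmeasurable (fun s => F (f s))) -> csmeas F.
Proof. by move=> H; split => dS S f mf; have [] := H _ _ f mf. Qed.

Lemma csmeas_cmod F : csmeas F -> smeas (fun s => cmod (F s)).
Proof.
move=> [Fr Fi] dS S f mf; apply: measurable_cmod; split; [exact: Fr|exact: Fi].
Qed.

Let mpinfty : measurable_fun setT (fun p => ur p == +oo%E).
Proof. by apply: measurable_fun_eqe => //; exact: measurable_cst. Qed.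

Let mfine : measurable_fun setT (fun p => fine (ur p)).
Proof. by apply: measurableT_comp => //; exact: fine_measurable. Qed.

Lemma measurable_zeta : cmeasurable (fun p : X * X => zeta ur ui p.1 p.2).
Proof.
have mN (f : X * X -> R) : measurable_fun setT f -> measurable_fun setT (fun p => - f p).
  by move=> mf; exact: measurableT_comp.
have mc : measurable_fun setT (fun p => cos (- ui p)).
  apply: measurableT_comp; last exact: mN.
  by apply: continuous_measurable_fun; exact: continuous_cos.
have ms : measurable_fun setT (fun p => sin (- ui p)).
  apply: measurableT_comp; last exact: mN.
  by apply: continuous_measurable_fun; exact: continuous_sin.
have me : measurable_fun setT (fun p => expR (- fine (ur p))).
  by apply: measurableT_comp => //; exact: mN.
split.
  rewrite (_ : (fun _ => _) = (fun p => if ur p == +oo%E then -1 else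
     expR (- fine (ur p)) * cos (- ui p) - 1)).
    apply: measurable_fun_ifT => //.
    by apply: measurable_funB => //; exact: measurable_funM.
  apply/funext => -[x y]; rewrite /zeta /=; case: ifP => // _ /=.
  by rewrite mul0r subr0.
rewrite (_ : (fun _ => _) = (fun p => if ur p == +oo%E then 0 else
   expR (- fine (ur p)) * sin (- ui p))).
  by apply: measurable_fun_ifT => //; exact: measurable_funM.
apply/funext => -[x y]; rewrite /zeta /=; case: ifP => // _ /=; rewrite ?oppr0//.
by rewrite mul0r !addr0 ?oppr0 ?addr0 ?subr0.
Qed.

Lemma measurable_ubar : cmeasurable (fun p : X * X => ubar ur ui p.1 p.2).
Proof.
split.
  rewrite (_ : (fun _ => _) = (fun p => if ur p == +oo%E then 1 else fine (ur p))).
    exact: measurable_fun_ifT.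
  by apply/funext => -[x y]; rewrite /ubar /=; case: ifP.
rewrite (_ : (fun _ => _) = (fun p => if ur p == +oo%E then 0 else ui p)).
  exact: measurable_fun_ifT.
by apply/funext => -[x y]; rewrite /ubar /=; case: ifP.
Qed.

Let zeta_nth {dS} {S : measurableType dS} (f : S -> seq X) i j : mlist f ->
  cmeasurable (fun s => zeta ur ui (nth point (f s) i) (nth point (f s) j)).
Proof.
move=> [_ mf].
exact: (cmeasurable_comp measurable_zeta (measurable_fun_pair (mf i) (mf j))).
Qed.

Lemma csmeas_conn_sum : csmeas (conn_sum point (zeta ur ui)).
Proof.
apply: csmeasP => dS S f mf; have [[n fn] _] := mf.
have conn_sum_size s : size s = n -> conn_sum point (zeta ur ui) s =
  \sum_(G : {set 'I_n * 'I_n} | graph_on G && gconnected G)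
     \prod_(e in G) zeta ur ui (nth point s e.1) (nth point s e.2).
  by move=> <-.
rewrite (_ : (fun _ => _) = (fun s =>
  \sum_(G : {set 'I_n * 'I_n} | graph_on G && gconnected G)
     \prod_(e in G) zeta ur ui (nth point (f s) e.1) (nth point (f s) e.2))).
  apply: cmeasurable_sum => G; apply: cmeasurable_prod => e; exact: zeta_nth.
by apply/funext => s; rewrite conn_sum_size.
Qed.

Lemma phiE s : phi ur ui s = ((size s)`!%:R)^-1 * conn_sum point (zeta ur ui) s.
Proof. by []. Qed.

Lemma csmeas_phi : csmeas (phi ur ui).
Proof.
apply: csmeasP => dS S f mf; have [[n fn] _] := mf.
rewrite (_ : (fun _ => _) =
    (fun s => (n`!%:R)^-1 * conn_sum point (zeta ur ui) (f s))).
  apply: cmeasurableM; first exact: cmeasurable_cst.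
  by have [mr mi] := csmeas_conn_sum; split; [exact: mr|exact: mi].
by apply/funext => s; rewrite phiE fn.
Qed.

Lemma ZtermE s : Zterm ur ui s = pairs_prod (fun x y => 1 + zeta ur ui x y) s.
Proof. exact: (@pairs_prodE _ _ (fun x y => 1 + zeta ur ui x y)). Qed.

Lemma csmeas_Zterm : csmeas (Zterm ur ui).
Proof.
apply: csmeasP => dS S f mf; have [[n fn] _] := mf.
rewrite (_ : (fun _ => _) = (fun s => \prod_(i < n) \prod_(j < n | (i < j)%N)
     (1 + zeta ur ui (nth point (f s) i) (nth point (f s) j)))).
  do 2 (apply: cmeasurable_prod => ?).
  by apply: cmeasurableD; [exact: cmeasurable_cst|exact: zeta_nth].
by apply/funext => s; rewrite /Zterm fn.
Qed.

End ClusterMeasurability.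

Section ClusterBounds.
Context {R : realType} {d : measure_display} {X : measurableType d}.
Variables (nu : {finite_measure set X -> \bar R}).
Variables (ur : X * X -> \bar R) (ui : X * X -> R) (a b : X -> R) (t : X -> X -> R).
Hypotheses (mur : measurable_fun setT ur) (mui : measurable_fun setT ui).
Hypotheses (ma : measurable_fun setT a) (mb : measurable_fun setT b).
Hypotheses (a0 : forall x, 0 <= a x) (b0 : forall x, 0 <= b x).
Hypotheses (t0 : forall x y, 0 <= t x y) (tsym : forall x y, t x y = t y x).
Hypothesis mt : measurable_fun setT (fun p : X * X => t p.1 p.2).
Hypothesis zle : forall x y,
  cmod (zeta ur ui x y) <= t x y * Num.max 1 (cmod (1 + zeta ur ui x y)).

Let good x := (\int[nu]_y (t x y * expR (b y) * expR (a y))%:E <= (a x)%:E)%E.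
Hypothesis ae_good : {ae nu, forall x, good x}.

Hypothesis stability : forall n : nat, prod_ae nu n (fun s =>
  \prod_(i < size s) \prod_(j < size s | (i < j)%N)
    cmod (1 + zeta ur ui (nth point s i) (nth point s j))
  <= \prod_(i < size s) expR (b (nth point s i))).
Hypothesis integrability : (\int[nu]_y (expR (a y + 2 * b y))%:E < +oo)%E.

Let stable s := cmod (Zterm ur ui s) <= \prod_(x <- s) expR (b x).

Let mexpb : measurable_fun setT (fun x => expR (b x)).
Proof. exact: measurableT_comp. Qed.

Lemma stable_ae n : aen nu n stable.
Proof.
have mZ := csmeas_cmod (csmeas_Zterm mur mui).
have mB : smeas (fun s : seq X => \prod_(x <- s) expR (b x)) := smeas_prod mexpb.
have P_stable s : (\prod_(i < size s) \prod_(j < size s | (i < j)%N)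
    cmod (1 + zeta ur ui (nth point s i) (nth point s j))
  <= \prod_(i < size s) expR (b (nth point s i))) = stable s.
  rewrite /stable (big_nth point) big_mkord /Zterm cmod_prod; congr (_ <= _).
  by apply: eq_bigr => i _; rewrite cmod_prod.
have indE : (fun s => (\1_[set s' | ~ stable s'] s : R)%:E) =
    (fun s => (if stable s then 0 else 1)%:E).
  apply/funext => s; rewrite indicE; congr (_%:E).
  case: ifPn => st; first by rewrite memNset//= => /(_ st).
  by rewrite mem_set//=; apply/negP.
have H0 : iabs nu n (fun s => (if stable s then 0 else 1)%:E) = 0%E.
  rewrite -indE -(stability n); congr (iabs nu n _); apply/funext => s.
  congr (\1_ _ _)%:E; by apply/seteqP; split => s' /=; rewrite P_stable.
apply: aenS (iabs_eq0 _ _ H0).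
- by move=> s _; case: (stable s) => // -[] /eqP; rewrite oner_eq0.
- by move=> s; case: (stable s).
- move=> dS S f mf; apply/measurable_EFinP; apply: measurable_fun_ifT => //.
  by apply: measurable_fun_ler; [exact: mZ|exact: mB].
Qed.

Let stable_sub s := forall s', subseq s' s -> stable s'.

Let cs := conn_sum point (zeta ur ui).

Let conn_sum_stable x s m : stable_sub (x :: s) -> ((size s).+1 < m)%N ->
  cmod (cs (x :: s)) <=
  expR (b x) * (forests t m [:: x] s * \prod_(y <- s) expR (b y)).
Proof.
move=> st szm; apply: le_trans (@conn_sum_le _ _ point _ t (expR \o b) x s m _ _ _ _ szm) _ => //.
  move=> s' /st; rewrite /stable ZtermE; apply: le_trans.
  rewrite le_eqVlt; apply/orP; left; apply/eqP.
  by elim: s' => [|y s' /= ->]; rewrite ?cmod1//= cmodM cmod_prod.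
by rewrite big_cons /= -mulrA [_ * forests _ _ _ _]mulrC.
Qed.

(** All that is required of the first point, for every length at once, so that one null set serves
    the whole series. *)
Definition phi_ok x := good x /\ forall n, aen nu n (fun s => stable_sub (x :: s)).

Lemma phi_ok_ae : {ae nu, forall x, phi_ok x}.
Proof.
have st : {ae nu, forall x, forall n, aen nu n (fun s => stable_sub (x :: s))}.
  apply: ae_foralln => n.
  exact: (@aen_subseq _ _ _ nu stable n.+1 stable_ae).
by apply: filterS2 ae_good st => x gx sx; split.
Qed.

Local Open Scope ereal_scope.

Let aphi s := (cmod (phi ur ui s))%:E.

Let aphi_ge0 s : 0 <= aphi s. Proof. by rewrite lee_fin cmod_ge0. Qed.

Let maphi : smeas aphi.
Proof.
move=> dS S f mf; apply/measurable_EFinP.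
exact: (csmeas_cmod (csmeas_phi mur mui)).
Qed.

Let acs_ge0 s : 0 <= (cmod (cs s))%:E. Proof. by rewrite lee_fin cmod_ge0. Qed.

Let macs : smeas (fun s => (cmod (cs s))%:E).
Proof.
move=> dS S f mf; apply/measurable_EFinP.
exact: (csmeas_cmod (csmeas_conn_sum mur mui)).
Qed.

(** The weight [j.+1] turns the factorial of [j.+1] into that of [j], the normalisation of the
    forest sums: hence the factor n in the pointwise bound. *)
Lemma iabs_phi_cons x j : j.+1%:R%:E * iabs nu j (fun s => aphi (x :: s)) =
  (j`!%:R^-1)%:E * iabs nu j (fun s => (cmod (cs (x :: s)))%:E).
Proof.
rewrite -!iabsZl ?lee_fin ?invr_ge0//; first last.
- exact: (smeas_cons x maphi).
- exact: (smeas_cons x macs).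
apply: eq_iabs => s sj; rewrite /aphi phiE cmodM -!EFinM -/cs; congr (_%:E).
have -> : cmod (((size (x :: s))`!%:R)^-1 : R[i])%R = ((j.+1`!)%:R^-1)%R.
  by rewrite cmodE Normc.normcV -cmodE cmod_nat /= sj.
by rewrite mulrA factS natrM invfM mulrA divff ?mul1r// pnatr_eq0.
Qed.

(** The forest bound with the single root [x]; the factor [expR (b x)] is the share of the root in
    the stability bound. *)
Lemma phi_partial_le x N : phi_ok x ->
  \sum_(1 <= j < N) j.+1%:R%:E * iabs nu j (fun s => aphi (x :: s)) <=
  ((expR (a x) - 1) * expR (b x))%:E.
Proof.
move=> [gx stx]; case: N => [|N].
  rewrite big_geq// lee_fin mulr_ge0 ?expR_ge0// subr_ge0 -expR0 ler_expR.
  exact: a0.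
pose w m I (J : seq X) : R := (forests t m I J * \prod_(y <- J) expR (b y))%R.
have w0 m I J : 0 <= (w m I J)%:E.
  rewrite lee_fin mulr_ge0 ?forests_ge0 ?prodr_ge0// => y _; exact: expR_ge0.
(* One amount of fuel for all terms: the root and [j <= N] further vertices need [j.+1 < m]. *)
pose m := N.+2.
have mw : smeas (fun s => (w m [:: x] s)%:E).
  move=> dS S f mf; apply/measurable_EFinP; apply: measurable_funM.
    exact: (smeas2_fix [:: x] (smeas2_forests m mt)).
  exact: smeas_prod.
apply: (@le_trans _ _ (\sum_(1 <= j < N.+1)
   (expR (b x))%:E * ((j`!%:R^-1)%:E * iabs nu j (fun s => (w m [:: x] s)%:E)))).
  rewrite big_nat_cond [leRHS]big_nat_cond; apply: lee_sum => j /andP[/andP[_ jN] _].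
  rewrite iabs_phi_cons muleCA; apply: lee_wpmul2l; first by rewrite lee_fin invr_ge0.
  rewrite -iabsZl ?lee_fin ?expR_ge0//; apply: le_iabs.
  - by move=> s; exact: acs_ge0.
  - by move=> s; rewrite mule_ge0// lee_fin expR_ge0.
  - exact: (smeas_cons x macs).
  - by move=> dS S f mf; apply: measurable_funeM; exact: mw.
  - apply: aenS (stx j) => s sj st; rewrite -EFinM lee_fin.
    by apply: conn_sum_stable => //; rewrite sj /m ltnS.
rewrite -ge0_sume_distrr; last first.
  by move=> j _; rewrite mule_ge0 ?iabs_ge0// lee_fin invr_ge0.
rewrite [leRHS]EFinM muleC; apply: lee_wpmul2r; first by rewrite lee_fin expR_ge0.
have := @forest_integral_le _ _ _ nu t (fun y => expR (b y)) a t0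
  (fun y => expR_ge0 (b y)) a0 mt mexpb ma m N.+1 [:: x] ae_good.
move=> /(_ _)/wrap[|].
  by move=> y; rewrite inE => /eqP ->.
(* The term [j = 0] is the bare root, of weight 1; moving it to the other side leaves
   [expR (a x) - 1]. *)
rewrite big_ord_recl big_seq1 /= fact0 invr1 mul1e big_nil !mulr1 => H.
rewrite EFinB leeBrDr// addeC; apply: le_trans H; apply: leeD.
  by rewrite /m /= big_nil mul1r.
by rewrite big_add1 /= big_mkord.
Qed.

Lemma phi_sum_le x : phi_ok x ->
  \sum_(2 <= n <oo) n%:R%:E * iabs nu n.-1 (fun s => aphi (x :: s)) <=
  ((expR (a x) - 1) * expR (b x))%:E.
Proof.
move=> okx; apply: lime_le.
  by apply: is_cvg_nneseries => n _ _; rewrite mule_ge0 ?lee_fin// iabs_ge0.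
apply: nearW => N; rewrite big_add1 /=; exact: phi_partial_le.
Qed.

Lemma phi_seq1 x : phi ur ui [:: x] = 1%R.
Proof.
have := @pairs_prod1D_splits R X point (zeta ur ui) x [::].
by rewrite /= big_nil !mulr1 phiE /= invr1 mul1r => <-.
Qed.

Let expR_ge1 (x : R) : (0 <= x)%R -> (1 <= expR x)%R.
Proof. by move=> x0; rewrite -expR0 ler_expR. Qed.

(** With the term n = 1 included, the bound 1 + (e^a - 1) e^b is absorbed by e^{a + 2b}, the
    function assumed integrable. *)
Let phi_partial0_le x N : phi_ok x ->
  \sum_(0 <= j < N) j.+1%:R%:E * iabs nu j (fun s => aphi (x :: s)) <=
  (expR (a x + 2 * b x))%:E.
Proof.
move=> /(phi_partial_le N); case: N => [|N] H.
  by rewrite big_geq// lee_fin expR_ge0.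
rewrite big_ltn//= /aphi phi_seq1 cmod1 mul1e.
apply: (@le_trans _ _ (1 + ((expR (a x) - 1) * expR (b x))%:E)); first by rewrite leeD2l.
rewrite -EFinD lee_fin expRD expRM_natl expr2.
have B1 := expR_ge1 (b0 x).
have : (0 <= expR (a x) * expR (b x) * (expR (b x) - 1))%R.
  by rewrite !mulr_ge0 ?expR_ge0// subr_ge0.
by nra.
Qed.

(** The pointwise bound integrated over the first point. The weight n is kept because the derivative
    of the logarithm series will need it. *)
Lemma phi_integral_bound : exists C : R, forall N,
  \sum_(n < N) n%:R%:E * iabs nu n aphi <= C%:E.
Proof.
pose I := \int[nu]_y (expR (a y + 2 * b y))%:E.
have I0 : 0 <= I by apply: integral_ge0 => y _; rewrite lee_fin expR_ge0.
have Ifin : I \is a fin_num by rewrite ge0_fin_numE.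
exists (fine I) => N; rewrite fineK//.
rewrite -(big_mkord xpredT (fun n => n%:R%:E * iabs nu n aphi)).
case: N => [|N]; first by rewrite big_geq.
rewrite big_nat_recl//= mul0e add0e.
rewrite (eq_bigr (fun j => \int[nu]_x (j.+1%:R%:E * iabs nu j (fun s => aphi (x :: s))))).
  rewrite -ge0_integral_sum//; first last.
  - by move=> j x _; rewrite mule_ge0 ?iabs_ge0// lee_fin.
  - by move=> j; apply: measurable_funeM; exact: measurable_iabs_cons.
  apply: ae_ge0_le_integral => //.
  - by move=> x _; apply: sume_ge0 => j _; rewrite mule_ge0 ?iabs_ge0// lee_fin.
  - apply: emeasurable_sum => j; apply: measurable_funeM; exact: measurable_iabs_cons.
  - apply/measurable_EFinP; apply: measurableT_comp => //.
    by apply: measurable_funD => //; exact: measurable_funM.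
  - by apply: filterS phi_ok_ae => x okx _; exact: phi_partial0_le.
by move=> j _; rewrite ge0_integralZl ?lee_fin//;
  [exact: measurable_iabs_cons|move=> x _; exact: iabs_ge0].
Qed.

Lemma phi_summable : \sum_(1 <= n <oo) iabs nu n aphi < +oo.
Proof.
have [C HC] := phi_integral_bound.
apply: (@le_lt_trans _ _ C%:E); last exact: ltry.
apply: lime_le; first by apply: is_cvg_nneseries => n _ _; exact: iabs_ge0.
apply: nearW => N; apply: le_trans (HC N).
rewrite -(big_mkord xpredT (fun n => n%:R%:E * iabs nu n aphi)).
case: N => [|N]; first by rewrite !big_geq.
rewrite [leRHS]big_ltn// mul0e add0e.
rewrite [leLHS]big_nat_cond [leRHS]big_nat_cond; apply: lee_sum => j /andP[/andP[j1 _] _].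
rewrite -[leLHS]mul1e; apply: lee_wpmul2r; first exact: iabs_ge0.
by rewrite lee_fin (ler_nat _ 1).
Qed.

Lemma iabs_phi_lty n : iabs nu n aphi < +oo.
Proof.
case: n => [|n]; first by rewrite /= ltry.
have [C HC] := phi_integral_bound.
apply: le_lt_trans (ltry C); apply: le_trans (HC n.+2).
rewrite big_ord_recr /= -[leLHS]add0e; apply: leeD.
  by apply: sume_ge0 => j _; rewrite mule_ge0 ?lee_fin// iabs_ge0.
rewrite -[leLHS]mul1e; apply: lee_wpmul2r; first exact: (@iabs_ge0 _ _ _ nu n.+1).
by rewrite lee_fin (ler_nat _ 1).
Qed.

(** Stability bounds the integrand by a product of one-point factors, and [C] is the integral of
    e^{a + 2b}, which dominates that of e^b. *)
Lemma iabs_Zterm_le : exists C : R, (0 <= C)%R /\ forall n,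
  iabs nu n (fun s => (cmod (Zterm ur ui s))%:E) <= (C ^+ n)%:E.
Proof.
pose I := \int[nu]_y (expR (a y + 2 * b y))%:E.
have I0 : 0 <= I by apply: integral_ge0 => y _; rewrite lee_fin expR_ge0.
have Ifin : I \is a fin_num by rewrite ge0_fin_numE.
exists (fine I); split => [|n]; first exact: fine_ge0.
apply: (@le_trans _ _ (iabs nu n (fun s => (\prod_(x <- s) expR (b x))%:E))).
  apply: le_iabs.
  - by move=> s; rewrite lee_fin cmod_ge0.
  - by move=> s; rewrite lee_fin prodr_ge0// => x _; exact: expR_ge0.
  - move=> dS S f mf; apply/measurable_EFinP.
    exact: (csmeas_cmod (csmeas_Zterm mur mui)).
  - by move=> dS S f mf; apply/measurable_EFinP; exact: smeas_prod.
  - by apply: aenS (stable_ae n) => s _; rewrite lee_fin.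
apply: iabs_prod_le => //.
rewrite fineK//; apply: ge0_le_integral => //.
- exact/measurable_EFinP.
- apply/measurable_EFinP; apply: measurableT_comp => //.
  by apply: measurable_funD => //; exact: measurable_funM.
- by move=> x _; rewrite lee_fin ler_expR; have := a0 x; have := b0 x; lra.
Qed.

End ClusterBounds.

(** * Complex iterated integrals *)

Section ComplexIntegral.
Context {R : realType} {d : measure_display} {X : measurableType d}.
Variable nu : {finite_measure set X -> \bar R}.
Implicit Types f g : X -> R[i].

Lemma cRe_le_cmod (z : R[i]) : `|cRe z| <= cmod z.
Proof. by rewrite /cmod -sqrtr_sqr ler_sqrt ?addr_ge0 ?sqr_ge0// lerDl sqr_ge0. Qed.

Lemma cIm_le_cmod (z : R[i]) : `|cIm z| <= cmod z.
Proof. by rewrite /cmod -sqrtr_sqr ler_sqrt ?addr_ge0 ?sqr_ge0// lerDr sqr_ge0. Qed.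

Lemma cmod_sqr (z : R[i]) : cmod z ^+ 2 = cRe z ^+ 2 + cIm z ^+ 2.
Proof. by rewrite /cmod sqr_sqrtr// addr_ge0 ?sqr_ge0. Qed.

Definition cintegrable f := cmeasurable f /\ (\int[nu]_x (cmod (f x))%:E < +oo)%E.

Lemma cintegrable_cmod f : cintegrable f -> nu.-integrable setT (EFin \o (fun x => cmod (f x))).
Proof.
move=> [mf fi]; apply/integrableP; split.
  by apply/measurable_EFinP; exact: measurable_cmod.
apply: le_lt_trans fi; rewrite le_eqVlt; apply/orP; left; apply/eqP.
by apply: eq_integral => x _ /=; rewrite ger0_norm// cmod_ge0.
Qed.

Lemma cintegrable_Re f : cintegrable f -> nu.-integrable setT (EFin \o (fun x => cRe (f x))).
Proof.
move=> fi; apply: le_integrable (cintegrable_cmod fi) => //.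
  by apply/measurable_EFinP; case: fi => -[].
by move=> x _ /=; rewrite lee_fin (le_trans (cRe_le_cmod _))// ler_norm.
Qed.

Lemma cintegrable_Im f : cintegrable f -> nu.-integrable setT (EFin \o (fun x => cIm (f x))).
Proof.
move=> fi; apply: le_integrable (cintegrable_cmod fi) => //.
  by apply/measurable_EFinP; case: fi => -[].
by move=> x _ /=; rewrite lee_fin (le_trans (cIm_le_cmod _))// ler_norm.
Qed.

Lemma cintegrableD f g : cintegrable f -> cintegrable g -> cintegrable (fun x => f x + g x).
Proof.
move=> fi gi; split; first by apply: cmeasurableD; [case: fi|case: gi].
have mf : measurable_fun setT (fun x => cmod (f x)) by apply: measurable_cmod; case: fi.
have mg : measurable_fun setT (fun x => cmod (g x)) by apply: measurable_cmod; case: gi.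
apply: (@le_lt_trans _ _ (\int[nu]_x ((cmod (f x))%:E + (cmod (g x))%:E))%E).
  apply: ge0_le_integral => //.
  - by move=> x _; rewrite lee_fin cmod_ge0.
  - apply/measurable_EFinP; apply: measurable_cmod.
    by apply: cmeasurableD; [case: fi|case: gi].
  - by apply/measurable_EFinP; exact: measurable_funD.
  - by move=> x _; rewrite lee_fin cmodD.
rewrite ge0_integralD//; first by apply: lte_add_pinfty; [case: fi|case: gi].
- by move=> x _; rewrite lee_fin cmod_ge0.
- exact/measurable_EFinP.
- by move=> x _; rewrite lee_fin cmod_ge0.
- exact/measurable_EFinP.
Qed.

Lemma cintegrableZl c f : cintegrable f -> cintegrable (fun x => c * f x).
Proof.
move=> [mf fi]; split; first by apply: cmeasurableM => //; exact: cmeasurable_cst.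
have mcf := measurable_cmod mf.
rewrite (eq_integral (fun x => (cmod c)%:E * (cmod (f x))%:E)%E); last first.
  by move=> x _; rewrite cmodM EFinM.
rewrite ge0_integralZl ?lee_fin ?cmod_ge0//.
- rewrite -ge0_fin_numE ?mule_ge0 ?lee_fin ?cmod_ge0//.
    by apply: fin_numM => //; rewrite ge0_fin_numE// integral_ge0// => x _; rewrite lee_fin cmod_ge0.
  by apply: integral_ge0 => x _; rewrite lee_fin cmod_ge0.
- exact/measurable_EFinP.
- by move=> x _; rewrite lee_fin cmod_ge0.
Qed.

Lemma cintD f g : cintegrable f -> cintegrable g ->
  cint nu (fun x => f x + g x) = cint nu f + cint nu g.
Proof.
move=> fi gi; rewrite /cint; under [in X in X +i* _]eq_fun do rewrite cReD.
under [in X in _ +i* X]eq_fun do rewrite cImD.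
rewrite !RintegralD//; by [apply: cintegrable_Re|apply: cintegrable_Im].
Qed.

Lemma cintZl c f : cintegrable f -> cint nu (fun x => c * f x) = c * cint nu f.
Proof.
move=> fi; rewrite /cint; under [in X in X +i* _]eq_fun do rewrite cReM.
under [in X in _ +i* X]eq_fun do rewrite cImM.
have Zi (r : R) (u : X -> R) : nu.-integrable setT (EFin \o u) ->
    nu.-integrable setT (EFin \o (fun x => r * u x)).
  by move=> ui; apply: eq_integrable (integrableZl measurableT r ui).
have [fr fim] := (cintegrable_Re fi, cintegrable_Im fi).
rewrite RintegralB ?RintegralD//; try exact: Zi.
rewrite !RintegralZl//; case: c => p q /=.
by apply/eqP; rewrite eq_complex /= !eqxx.
Qed.

Lemma cint0 : cint nu (fun=> 0) = 0.
Proof. by rewrite /cint /= /Rintegral integral0. Qed.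

Lemma cint_sum (I : Type) (r : seq I) (F : I -> X -> R[i]) :
  (forall i, cintegrable (F i)) ->
  cintegrable (fun x => \sum_(i <- r) F i x) /\
  cint nu (fun x => \sum_(i <- r) F i x) = \sum_(i <- r) cint nu (F i).
Proof.
move=> Fi; elim: r => [|i r [IH1 IH2]].
  rewrite big_nil; under eq_fun do rewrite big_nil.
  split; last exact: cint0.
  split; first exact: cmeasurable_cst.
  by under eq_integral do rewrite cmod0; rewrite integral0 ltry.
rewrite big_cons; under eq_fun do rewrite big_cons.
by split; [exact: cintegrableD|rewrite cintD// IH2].
Qed.

Lemma ae_eq_cint f g : cmeasurable f -> cmeasurable g ->
  {ae nu, forall x, f x = g x} -> cint nu f = cint nu g.
Proof.
move=> [fr fi] [gr gi] fg; rewrite /cint /Rintegral; congr (fine _ +i* fine _);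
  apply: ae_eq_integral => //; try exact/measurable_EFinP;
  by apply: filterS fg => x -> _.
Qed.

(** With I the integral of f, |I|^2 is the integral of Re(conj(I) f), hence at most |I| times the
    integral of |f|. *)
Lemma cmod_cint_le f : cmeasurable f ->
  ((cmod (cint nu f))%:E <= \int[nu]_x (cmod (f x))%:E)%E.
Proof.
move=> mf; set J := (\int[nu]_x _)%E.
have J0 : (0 <= J)%E by apply: integral_ge0 => x _; rewrite lee_fin cmod_ge0.
have [Jfin|] := ltP J +oo%E; last by rewrite leye_eq => /eqP ->; rewrite leey.
have fi : cintegrable f by [].
have [fr fim] := (cintegrable_Re fi, cintegrable_Im fi).
have fc := cintegrable_cmod fi.
set I := cint nu f; pose p := cRe I; pose q := cIm I.
have Zi (r : R) (u : X -> R) : nu.-integrable setT (EFin \o u) ->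
    nu.-integrable setT (EFin \o (fun x => r * u x)).
  by move=> ui; apply: eq_integrable (integrableZl measurableT r ui).
have JE : J = (Rintegral nu setT (fun x => cmod (f x)))%:E.
  by rewrite /Rintegral fineK// ge0_fin_numE.
rewrite JE lee_fin.
have [I0|I0] := eqVneq (cmod I) 0.
  by rewrite I0; apply: Rintegral_ge0 => x _; exact: cmod_ge0.
have Ip : 0 < cmod I by rewrite lt_def I0 cmod_ge0.
rewrite -(ler_pM2l Ip) -expr2 cmod_sqr !expr2 -/p -/q.
rewrite {2}/p {2}/q /I /cint [cRe _]/= [cIm _]/= -!RintegralZl// -RintegralD//; try exact: Zi.
apply: le_Rintegral => //; try exact: Zi.
  have := @integrableD _ _ _ nu setT measurableT _ _ (Zi p _ fr) (Zi q _ fim).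
  by apply: eq_integrable.
move=> x _; rewrite -/I.
(* [p -i* q] is the conjugate of [I]. *)
have -> : p * cRe (f x) + q * cIm (f x) = cRe ((p -i* q) * f x).
  by rewrite cReM /= mulNr opprK.
apply: le_trans (ler_norm _) (le_trans (cRe_le_cmod _) _).
by rewrite cmodM /cmod /= sqrrN.
Qed.

End ComplexIntegral.

Section IteratedComplexIntegral.
Context {R : realType} {d : measure_display} {X : measurableType d}.
Variable nu : {finite_measure set X -> \bar R}.
Variable h : X -> R[i].
Hypothesis mh : cmeasurable h.
Hypothesis h1 : forall x, cmod (h x) = 1.
Implicit Types F G A B : seq X -> R[i].

(** Tonelli's theorem is applied to the positive and negative parts separately; no integrability
    enters, since [fine] gives a value in every case. *)
Lemma measurable_Rintegral_param {dS} {S : measurableType dS} (H : S * X -> R) :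
  measurable_fun setT H -> measurable_fun setT (fun s => Rintegral nu setT (fun x => H (s, x))).
Proof.
move=> mH; have mHE : measurable_fun setT (EFin \o H) by exact/measurable_EFinP.
apply: measurableT_comp; first exact: fine_measurable.
rewrite (_ : (fun _ => _) = (fun s => (\int[nu]_x ((EFin \o H)^\+ (s, x))
    - \int[nu]_x ((EFin \o H)^\- (s, x)))%E)); last first.
  apply/funext => s; rewrite integralE; congr (_ - _)%E; apply: eq_integral => x _;
    by rewrite ?funeposE ?funenegE.
apply: emeasurable_funB.
  apply: (@measurable_fun_fubini_tonelli_F _ _ _ _ _ nu (EFin \o H)^\+%E) => //.
  exact: measurable_funepos.
apply: (@measurable_fun_fubini_tonelli_F _ _ _ _ _ nu (EFin \o H)^\-%E) => //.
exact: measurable_funeneg.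
Qed.

Lemma cmeasurable_cint_param {dS} {S : measurableType dS} (H : S * X -> R[i]) :
  cmeasurable H -> cmeasurable (fun s => cint nu (fun x => H (s, x))).
Proof.
move=> [Hr Hi]; split.
  exact: (measurable_Rintegral_param Hr).
exact: (measurable_Rintegral_param Hi).
Qed.

Definition csmeas2 (A : seq X -> seq X -> R[i]) :=
  forall dS (S : measurableType dS) (f g : S -> seq X), mlist f -> mlist g ->
    cmeasurable (fun s => A (f s) (g s)).

Lemma csmeas_cmeasurable F {dS} {S : measurableType dS} (f : S -> seq X) :
  csmeas F -> mlist f -> cmeasurable (fun s => F (f s)).
Proof. by move=> [Fr Fi] mf; split; [exact: Fr|exact: Fi]. Qed.

Lemma csmeas_iint n (A : seq X -> seq X -> R[i]) :
  csmeas2 A -> csmeas (fun K => iint nu h n (A K)).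
Proof.
elim: n A => [|n IH] A mA; apply: csmeasP => dS S f mf /=.
  exact: (mA _ _ f (fun=> [::]) mf (mlist_cst _)).
pose A' K L := A (behead K) (nth point K 0 :: L).
have mA' : csmeas2 A'.
  move=> dU U p q mp mq; apply: mA; first exact: mlist_behead.
  by apply: mlist_cons => //; case: mp.
have mfx : mlist (fun sx : S * X => sx.2 :: f sx.1).
  apply: mlist_cons; first exact: measurable_snd.
  exact: mlist_comp mf measurable_fst.
apply: (@cmeasurable_cint_param _ _
  (fun sx : S * X => h sx.2 * iint nu h n (fun L => A (f sx.1) (sx.2 :: L)))).
apply: cmeasurableM; first exact: cmeasurable_comp mh measurable_snd.
exact: (csmeas_cmeasurable (IH A' mA') mfx).
Qed.

Lemma csmeas_cons F x : csmeas F -> csmeas (fun s => F (x :: s)).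
Proof. by move=> [Fr Fi]; split; [exact: smeas_cons x Fr|exact: smeas_cons x Fi]. Qed.

Lemma cmeasurable_iint_cons n F : csmeas F ->
  cmeasurable (fun x => iint nu h n (fun s => F (x :: s))).
Proof.
move=> mF; have m2 : csmeas2 (fun l s => F (nth point l 0 :: s)).
  move=> dS S f g mf mg; apply: csmeas_cmeasurable => //.
  by apply: mlist_cons => //; case: mf.
apply: (csmeas_cmeasurable (f := fun x => [:: x]) (csmeas_iint n m2)).
by apply: mlist_cons => //; exact: mlist_cst.
Qed.

Let Fabs F s := (cmod (F s))%:E.

Lemma Fabs_ge0 F s : (0 <= Fabs F s)%E. Proof. by rewrite lee_fin cmod_ge0. Qed.

Lemma smeas_Fabs F : csmeas F -> smeas (Fabs F).
Proof.
by move=> mF dS S f mf; apply/measurable_EFinP; exact: (csmeas_cmod mF).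
Qed.

Lemma cmod_iint_le n F : csmeas F -> ((cmod (iint nu h n F))%:E <= iabs nu n (Fabs F))%E.
Proof.
elim: n F => [|n IH] F mF //=.
have mi := cmeasurable_iint_cons n mF.
have mhi : cmeasurable (fun x => h x * iint nu h n (fun s => F (x :: s))).
  exact: cmeasurableM.
apply: le_trans (cmod_cint_le nu mhi) _; apply: ge0_le_integral => //.
- by move=> x _; rewrite lee_fin cmod_ge0.
- by apply/measurable_EFinP; exact: measurable_cmod.
- by apply: measurable_iabs_cons; [exact: Fabs_ge0|exact: smeas_Fabs].
- by move=> x _; rewrite cmodM h1 mul1r; apply: IH; exact: csmeas_cons.
Qed.

(* Outside this class the real integrals inside [iint] may be junk values. *)
Definition igood n F := csmeas F /\ (iabs nu n (Fabs F) < +oo)%E.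

Lemma igood_ae n F : igood n.+1 F -> {ae nu, forall x, igood n (fun s => F (x :: s))}.
Proof.
move=> [mF Ffin].
have mI := @measurable_iabs_cons _ _ _ nu n _ (@Fabs_ge0 F) (smeas_Fabs mF).
have : nu.-integrable setT (fun x => iabs nu n (fun s => Fabs F (x :: s))).
  apply/integrableP; split => //; apply: le_lt_trans Ffin.
  rewrite le_eqVlt; apply/orP; left; apply/eqP; apply: eq_integral => x _.
  by rewrite gee0_abs// iabs_ge0// => s; exact: Fabs_ge0.
move=> /(integrable_ae measurableT); apply: filterS => x /(_ I) xfin; split.
  exact: csmeas_cons.
by rewrite -ge0_fin_numE// iabs_ge0// => s; exact: Fabs_ge0.
Qed.

Lemma igood_cintegrable n F : igood n.+1 F ->
  cintegrable nu (fun x => h x * iint nu h n (fun s => F (x :: s))).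
Proof.
move=> [mF Ffin]; have mi := cmeasurable_iint_cons n mF.
have mhi : cmeasurable (fun x => h x * iint nu h n (fun s => F (x :: s))).
  exact: cmeasurableM.
split=> //; apply: le_lt_trans Ffin; apply: ge0_le_integral => //.
- by move=> x _; rewrite lee_fin cmod_ge0.
- by apply/measurable_EFinP; exact: measurable_cmod.
- by apply: measurable_iabs_cons; [exact: Fabs_ge0|exact: smeas_Fabs].
- by move=> x _; rewrite cmodM h1 mul1r; apply: cmod_iint_le; exact: csmeas_cons.
Qed.

Lemma eq_iint n F G : (forall s, size s = n -> F s = G s) -> iint nu h n F = iint nu h n G.
Proof.
elim: n F G => [|n IH] F G FG /=; first exact: FG.
congr (cint nu _); apply/funext => x; congr (_ * _).
by apply: IH => s sn; rewrite FG//= sn.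
Qed.

Lemma csmeasD F G : csmeas F -> csmeas G -> csmeas (fun s => F s + G s).
Proof.
by move=> mF mG; apply: csmeasP => dS S f mf; apply: cmeasurableD; exact: csmeas_cmeasurable.
Qed.

Lemma csmeasM F G : csmeas F -> csmeas G -> csmeas (fun s => F s * G s).
Proof.
by move=> mF mG; apply: csmeasP => dS S f mf; apply: cmeasurableM; exact: csmeas_cmeasurable.
Qed.

Lemma csmeas_cst (c : R[i]) : csmeas (fun _ : seq X => c).
Proof. by apply: csmeasP => dS S f mf; exact: cmeasurable_cst. Qed.

Lemma iintD n F G : igood n F -> igood n G ->
  iint nu h n (fun s => F s + G s) = iint nu h n F + iint nu h n G.
Proof.
elim: n F G => [|n IH] F G gF gG //=.
have [mF _] := gF; have [mG _] := gG.
rewrite -cintD; [|exact: igood_cintegrable|exact: igood_cintegrable].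
apply: ae_eq_cint.
- by apply: cmeasurableM => //; exact: (cmeasurable_iint_cons n (csmeasD mF mG)).
- by apply: cmeasurableD; apply: cmeasurableM => //; exact: cmeasurable_iint_cons.
- by apply: filterS2 (igood_ae gF) (igood_ae gG) => x gFx gGx; rewrite IH// mulrDr.
Qed.

Lemma iintZl n c F : igood n F -> iint nu h n (fun s => c * F s) = c * iint nu h n F.
Proof.
elim: n F => [|n IH] F gF //=; have [mF _] := gF.
rewrite -cintZl; last exact: igood_cintegrable.
apply: ae_eq_cint.
- apply: cmeasurableM => //.
  exact: (cmeasurable_iint_cons n (csmeasM (csmeas_cst c) mF)).
- apply: cmeasurableM; first exact: cmeasurable_cst.
  by apply: cmeasurableM => //; exact: cmeasurable_iint_cons.
- by apply: filterS (igood_ae gF) => x gFx; rewrite IH// mulrCA.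
Qed.

Lemma cRe_splits (A : seq X -> seq X -> R[i]) J :
  cRe (splits A J) = splits (fun K L => cRe (A K L)) J.
Proof. by elim: J A => //= y J IH A; rewrite cReD !IH. Qed.

Lemma cIm_splits (A : seq X -> seq X -> R[i]) J :
  cIm (splits A J) = splits (fun K L => cIm (A K L)) J.
Proof. by elim: J A => //= y J IH A; rewrite cImD !IH. Qed.

Lemma csmeas_splits A B : csmeas A -> csmeas B ->
  csmeas (splits (fun K L => A K * B L)).
Proof.
move=> mA mB.
have mAB : csmeas2 (fun K L => A K * B L).
  by move=> dS S f g mf mg; apply: cmeasurableM; exact: csmeas_cmeasurable.
apply: csmeasP => dS S f mf; split.
  under eq_fun do rewrite cRe_splits; apply: smeas_splits => // dU U p q mp mq.
  by case: (mAB _ _ p q mp mq).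
under eq_fun do rewrite cIm_splits; apply: smeas_splits => // dU U p q mp mq.
by case: (mAB _ _ p q mp mq).
Qed.

Lemma cmod_splits_le (A : seq X -> seq X -> R[i]) J :
  cmod (splits A J) <= splits (fun K L => cmod (A K L)) J.
Proof.
elim: J A => //= y J IH A; apply: le_trans (cmodD _ _) _.
by apply: lerD; exact: IH.
Qed.

(** The modulus is at most the splitting of |A| |B|, whose integral is a finite combination of
    products of finite integrals. *)
Lemma igood_splits A B n : (forall k, igood k A) -> (forall k, igood k B) ->
  igood n (splits (fun K L => A K * B L)).
Proof.
move=> gA gB; have [[mA _] [mB _]] := (gA 0%N, gB 0%N).
have ms := csmeas_splits mA mB.
split => //.
have mAB : smeas2 (fun K L => cmod (A K) * cmod (B L)).
  move=> dS S f g mf mg; apply: measurable_funM.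
    exact: (csmeas_cmod mA).
  exact: (csmeas_cmod mB).
apply: (@le_lt_trans _ _ (iabs nu n (fun J =>
    (splits (fun K L => cmod (A K) * cmod (B L)) J)%:E))).
  apply: le_iabs.
  - exact: Fabs_ge0.
  - by move=> s; rewrite lee_fin splits_ge0// => K L; rewrite mulr_ge0 ?cmod_ge0.
  - exact: smeas_Fabs.
  - by move=> dS S f mf; apply/measurable_EFinP; exact: smeas_splits.
  - apply: aenW => s _; rewrite lee_fin; apply: le_trans (cmod_splits_le _ _) _.
    by rewrite (eq_splits (B := fun K L => cmod (A K) * cmod (B L)))// => K L _; rewrite cmodM.
rewrite iabs_splits//; last by move=> K L; rewrite mulr_ge0 ?cmod_ge0.
rewrite /binomial_sum; apply: lte_sum_pinfty => k _; rewrite natmul_EFin.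
have fabsB l : iabs nu l (Fabs B) \is a fin_num.
  by rewrite ge0_fin_numE; [case: (gB l)|apply: iabs_ge0; exact: Fabs_ge0].
have fabsA l : iabs nu l (Fabs A) \is a fin_num.
  by rewrite ge0_fin_numE; [case: (gA l)|apply: iabs_ge0; exact: Fabs_ge0].
rewrite (@eq_iabs _ _ _ nu k _ (fun K => iabs nu (n - k)%N (Fabs B) * Fabs A K)%E).
  rewrite iabsZl; [|exact: Fabs_ge0|apply: iabs_ge0; exact: Fabs_ge0|exact: smeas_Fabs].
  by rewrite ltey_eq; apply/orP; left; rewrite !fin_numM.
move=> K _; rewrite muleC -iabsZl.
- by apply: eq_iabs => L _; rewrite EFinM.
- exact: Fabs_ge0.
- exact: Fabs_ge0.
- exact: smeas_Fabs.
Qed.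

Lemma cint_binomial_sum (a : nat -> nat -> X -> R[i]) n :
  (forall k l, cintegrable nu (a k l)) ->
  cintegrable nu (fun x => binomial_sum (fun k l => a k l x) n) /\
  cint nu (fun x => binomial_sum (fun k l => a k l x) n) =
  binomial_sum (fun k l => cint nu (a k l)) n.
Proof.
move=> ia; rewrite /binomial_sum.
have ia' (k : 'I_n.+1) : cintegrable nu (fun x => a k (n - k)%N x *+ 'C(n, k)).
  by under eq_fun do rewrite -mulr_natl; exact: cintegrableZl.
have [H1 H2] := cint_sum (index_enum 'I_n.+1) ia'; split => //.
rewrite H2; apply: eq_bigr => k _; under eq_fun do rewrite -mulr_natl.
by rewrite cintZl// mulr_natl.
Qed.

Lemma binomial_sum_mull c (a : nat -> nat -> R[i]) n :
  c * binomial_sum a n = binomial_sum (fun k l => c * a k l) n.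
Proof.
by rewrite /binomial_sum big_distrr /=; apply: eq_bigr => k _; rewrite mulrnAr.
Qed.

Lemma igood_ae_all F : (forall k, igood k F) ->
  {ae nu, forall x, forall k, igood k (fun s => F (x :: s))}.
Proof. by move=> gF; apply: ae_foralln => k; apply: igood_ae. Qed.

(** Because the summand is a product, the variable given to [L] sees the integral of [A] as a
    constant; linearity replaces an exchange of integrals. *)
Lemma iint_splits A B n : (forall k, igood k A) -> (forall k, igood k B) ->
  iint nu h n (splits (fun K L => A K * B L)) =
  binomial_sum (fun k l => iint nu h k A * iint nu h l B) n.
Proof.
elim: n A B => [|n IH] A B gA gB.
  by rewrite /binomial_sum big_ord_recl big_ord0 /= addr0 mulr1n.
have [[mA _] [mB _]] := (gA 0%N, gB 0%N).
pose a1 k l x := (h x * iint nu h k (fun s => A (x :: s))) * iint nu h l B.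
pose a2 k l x := iint nu h k A * (h x * iint nu h l (fun s => B (x :: s))).
have ia1 k l : cintegrable nu (a1 k l).
  rewrite /a1; under eq_fun do rewrite mulrC.
  by apply: cintegrableZl; exact: igood_cintegrable.
have ia2 k l : cintegrable nu (a2 k l).
  by apply: cintegrableZl; exact: igood_cintegrable.
have [i1 s1] := cint_binomial_sum n ia1.
have [i2 s2] := cint_binomial_sum n ia2.
rewrite -binomial_sumS.
have -> : binomial_sum (fun k l => iint nu h k.+1 A * iint nu h l B) n =
    binomial_sum (fun k l => cint nu (a1 k l)) n.
  congr binomial_sum; apply/funext => k; apply/funext => l; rewrite /a1.
  under [in RHS]eq_fun do rewrite mulrC.
  by rewrite cintZl 1?mulrC//; exact: igood_cintegrable.
have -> : binomial_sum (fun k l => iint nu h k A * iint nu h l.+1 B) n =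
    binomial_sum (fun k l => cint nu (a2 k l)) n.
  congr binomial_sum; apply/funext => k; apply/funext => l.
  by rewrite /a2 cintZl//; exact: igood_cintegrable.
rewrite -s1 -s2 -cintD// [LHS]/=; apply: ae_eq_cint.
- apply: cmeasurableM => //.
  exact: (@cmeasurable_iint_cons n (splits (fun K L => A K * B L)) (csmeas_splits mA mB)).
- by apply: cmeasurableD; [case: i1|case: i2].
apply: filterS2 (igood_ae_all gA) (igood_ae_all gB) => x gAx gBx /=.
rewrite (iintD (igood_splits n gAx gB) (igood_splits n gA gBx)).
rewrite (IH _ _ gAx gB) (IH _ _ gA gBx) mulrDr !binomial_sum_mull; congr (_ + _).
  by congr binomial_sum; apply/funext => k; apply/funext => l; rewrite mulrA.
by congr binomial_sum; apply/funext => k; apply/funext => l; rewrite mulrCA.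
Qed.

(* The integrated form of the decomposition of a graph according to the connected
   component of its first vertex. *)
Lemma iint_cons_splits A B C n : (forall k, igood k A) -> (forall k, igood k B) ->
  csmeas C ->
  (forall x J, C (x :: J) = splits (fun K L => A (x :: K) * B L) J) ->
  iint nu h n.+1 C = binomial_sum (fun k l => iint nu h k.+1 A * iint nu h l B) n.
Proof.
move=> gA gB mC CE.
pose a1 k l x := (h x * iint nu h k (fun s => A (x :: s))) * iint nu h l B.
have ia1 k l : cintegrable nu (a1 k l).
  rewrite /a1; under eq_fun do rewrite mulrC.
  by apply: cintegrableZl; exact: igood_cintegrable.
have [i1 s1] := cint_binomial_sum n ia1.
have -> : binomial_sum (fun k l => iint nu h k.+1 A * iint nu h l B) n =
    binomial_sum (fun k l => cint nu (a1 k l)) n.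
  congr binomial_sum; apply/funext => k; apply/funext => l; rewrite /a1.
  under [in RHS]eq_fun do rewrite mulrC.
  by rewrite cintZl 1?mulrC//; exact: igood_cintegrable.
rewrite -s1 [LHS]/=; apply: ae_eq_cint.
- by apply: cmeasurableM => //; exact: cmeasurable_iint_cons.
- by case: i1.
apply: filterS (igood_ae_all gA) => x gAx.
rewrite (_ : (fun s => C (x :: s)) = splits (fun K L => A (x :: K) * B L)); last first.
  by apply/funext => J; rewrite CE.
rewrite (iint_splits n gAx gB) binomial_sum_mull.
by congr binomial_sum; apply/funext => k; apply/funext => l; rewrite mulrA.
Qed.

End IteratedComplexIntegral.

(** * Exponentials of power series *)

Section ComplexExp.
Context {R : realType}.
Implicit Types z w : R[i].

Lemma complex_ext z w : cRe z = cRe w -> cIm z = cIm w -> z = w.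
Proof. by case: z => x y; case: w => u v /= -> ->. Qed.

Lemma cRe_cexp z : cRe (cexp z) = expR (cRe z) * cos (cIm z).
Proof. by rewrite /cexp cReM /= mul0r subr0. Qed.

Lemma cIm_cexp z : cIm (cexp z) = expR (cRe z) * sin (cIm z).
Proof. by rewrite /cexp cImM /= mul0r addr0. Qed.

Lemma cReN z : cRe (- z) = - cRe z. Proof. by case: z. Qed.
Lemma cImN z : cIm (- z) = - cIm z. Proof. by case: z. Qed.

Lemma cexpNK z : cexp (- z) * cexp z = 1.
Proof.
have ex : expR (- cRe z) * expR (cRe z) = 1 by rewrite mulrC expRxMexpNx_1.
have cs := cos2Dsin2 (cIm z).
apply: complex_ext.
  rewrite cReM !cRe_cexp !cIm_cexp cReN cImN cosN sinN.
  transitivity ((expR (- cRe z) * expR (cRe z)) * (cos (cIm z) ^+ 2 + sin (cIm z) ^+ 2)).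
    by ring.
  by rewrite ex cs mulr1.
rewrite cImM !cRe_cexp !cIm_cexp cReN cImN cosN sinN [RHS]/=; ring.
Qed.

Lemma cexp0 : cexp 0 = 1 :> R[i].
Proof.
by apply: complex_ext; rewrite ?cRe_cexp ?cIm_cexp /= expR0 ?cos0 ?sin0 mul1r.
Qed.

Lemma cmod_cexp z : cmod (cexp z) = expR (cRe z).
Proof.
rewrite /cmod cRe_cexp cIm_cexp !exprMn -mulrDr cos2Dsin2 mulr1 sqrtr_sqr.
by rewrite ger0_norm// expR_ge0.
Qed.

Lemma cmod_le_ReIm z : cmod z <= `|cRe z| + `|cIm z|.
Proof.
rewrite -[leRHS]ger0_norm ?addr_ge0// -sqrtr_sqr ler_sqrt ?sqr_ge0//.
rewrite sqrrD -(real_normK (num_real (cRe z))) -(real_normK (num_real (cIm z))).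
by rewrite -addrA lerD2l lerDr mulrn_wge0 ?mulr_ge0.
Qed.

Lemma cRe_sum (I : Type) (r : seq I) (P : pred I) (F : I -> R[i]) :
  cRe (\sum_(i <- r | P i) F i) = \sum_(i <- r | P i) cRe (F i).
Proof. by elim/big_rec2: _ => // i x y _ <-; rewrite cReD. Qed.

Lemma cIm_sum (I : Type) (r : seq I) (P : pred I) (F : I -> R[i]) :
  cIm (\sum_(i <- r | P i) F i) = \sum_(i <- r | P i) cIm (F i).
Proof. by elim/big_rec2: _ => // i x y _ <-; rewrite cImD. Qed.

Lemma cRe_mulr z (r : R) : cRe (z * r%:C) = cRe z * r.
Proof. by case: z => x y /=; rewrite mulr0 subr0. Qed.

Lemma cIm_mulr z (r : R) : cIm (z * r%:C) = cIm z * r.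
Proof. by case: z => x y /=; rewrite mulr0 add0r. Qed.

Lemma cmod_real (r : R) : cmod (r%:C) = `|r|.
Proof. by rewrite /cmod /= expr0n addr0 sqrtr_sqr. Qed.

Lemma is_derive_polysum (c : nat -> R) n (t : R) :
  is_derive t 1 (fun t => \sum_(i < n) c i * t ^+ i)
    (\sum_(i < n) c i * (i%:R * t ^+ i.-1)).
Proof.
elim: n => [|n IH].
  rewrite big_ord0; under eq_fun do rewrite big_ord0; exact: is_derive_cst.
rewrite big_ord_recr /=; under eq_fun do rewrite big_ord_recr /=.
apply: is_deriveD.
have -> : (fun t => c n * t ^+ n) = c n *: (id ^+ n) :> (R -> R).
  by apply/funext => u; rewrite /= exprfctE.
apply: is_derive_eq.
by rewrite /GRing.scale /= mulr1.
Qed.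

End ComplexExp.

Section PowerSeriesExp.
Context {R : realType}.
Variables z l : nat -> R[i].

Let zp N (t : R) : R[i] := \sum_(n < N) z n * (t ^+ n)%:C.
Let lp N (t : R) : R[i] := \sum_(n < N) l n * (t ^+ n)%:C.
Let dzp N (t : R) : R[i] := \sum_(n < N) z n * (n%:R * t ^+ n.-1)%:C.
Let dlp N (t : R) : R[i] := \sum_(n < N) l n * (n%:R * t ^+ n.-1)%:C.

Let f N (t : R) : R[i] := zp N t * cexp (- lp N t).
Let df N (t : R) : R[i] := (dzp N t - dlp N t * zp N t) * cexp (- lp N t).

Let Re_der (c : nat -> R[i]) (N : nat) (t : R) :
  is_derive t 1 (fun t : R => cRe (\sum_(n < N) c n * (t ^+ n)%:C))
    (cRe (\sum_(n < N) c n * (n%:R * t ^+ n.-1)%:C)).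
Proof.
rewrite cRe_sum; under eq_bigr do rewrite cRe_mulr.
under eq_fun => u do (rewrite cRe_sum; under eq_bigr do rewrite cRe_mulr).
exact: (is_derive_polysum (fun n => cRe (c n))).
Qed.

Let Im_der (c : nat -> R[i]) (N : nat) (t : R) :
  is_derive t 1 (fun t : R => cIm (\sum_(n < N) c n * (t ^+ n)%:C))
    (cIm (\sum_(n < N) c n * (n%:R * t ^+ n.-1)%:C)).
Proof.
rewrite cIm_sum; under eq_bigr do rewrite cIm_mulr.
under eq_fun => u do (rewrite cIm_sum; under eq_bigr do rewrite cIm_mulr).
exact: (is_derive_polysum (fun n => cIm (c n))).
Qed.

Let cRe_mul_cexpN (u w : R[i]) : cRe (u * cexp (- w)) =
  expR (- cRe w) * (cRe u * cos (cIm w) + cIm u * sin (cIm w)).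
Proof. by rewrite cReM cRe_cexp cIm_cexp cReN cImN cosN sinN; ring. Qed.

Let cIm_mul_cexpN (u w : R[i]) : cIm (u * cexp (- w)) =
  expR (- cRe w) * (cIm u * cos (cIm w) - cRe u * sin (cIm w)).
Proof. by rewrite cImM cRe_cexp cIm_cexp cReN cImN cosN sinN; ring. Qed.

(** The common shape of both parts of z e^{-l}: the real part has (c, s, u, v) = (cos, sin, Re z, Im
    z), the imaginary part (cos, -sin, Im z, Re z). *)
Let combine_der (e c s u v : R -> R) (de dc ds du dv t : R) :
  is_derive t 1 e de -> is_derive t 1 c dc -> is_derive t 1 s ds ->
  is_derive t 1 u du -> is_derive t 1 v dv ->
  is_derive t 1 (fun t => e t * (u t * c t + v t * s t))
    (de * (u t * c t + v t * s t) +
     e t * (du * c t + u t * dc + (dv * s t + v t * ds))).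
Proof.
move=> He Hc Hs Hu Hv.
have -> : (fun t => e t * (u t * c t + v t * s t)) = e * (u * c + v * s) by [].
apply: is_derive_eq; rewrite /= /GRing.scale /=.
by rewrite -[(u * c + v * s) t]/(u t * c t + v t * s t); ring.
Qed.

Let exp_der (N : nat) (t : R) : is_derive t 1 (fun t => expR (- cRe (lp N t)))
  (expR (- cRe (lp N t)) * - cRe (dlp N t)).
Proof.
have HN : is_derive t 1 (fun t => - cRe (lp N t)) (- cRe (dlp N t)).
  exact: (@is_deriveN _ _ _ (fun t => cRe (lp N t)) t 1 _ (Re_der l N t)).
exact: (@is_derive1_comp _ expR (fun t => - cRe (lp N t)) t _ _ (is_derive_expR _) HN).
Qed.

Let cos_der (N : nat) (t : R) : is_derive t 1 (fun t => cos (cIm (lp N t)))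
  (- sin (cIm (lp N t)) * cIm (dlp N t)).
Proof.
exact: (@is_derive1_comp _ cos (fun t => cIm (lp N t)) t _ _
  (is_derive_cos _) (Im_der l N t)).
Qed.

Let sin_der (N : nat) (t : R) : is_derive t 1 (fun t => sin (cIm (lp N t)))
  (cos (cIm (lp N t)) * cIm (dlp N t)).
Proof.
exact: (@is_derive1_comp _ sin (fun t => cIm (lp N t)) t _ _
  (is_derive_sin _) (Im_der l N t)).
Qed.

Let Re_f_der (N : nat) (t : R) : is_derive t 1 (fun t => cRe (f N t)) (cRe (df N t)).
Proof.
under eq_fun do rewrite cRe_mul_cexpN.
apply: is_derive_eq.
  exact: (combine_der (exp_der N t) (cos_der N t) (sin_der N t) (Re_der z N t) (Im_der z N t)).
rewrite cRe_mul_cexpN cReD cImD.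
have -> : cRe (- (dlp N t * zp N t)) = - (cRe (dlp N t) * cRe (zp N t) - cIm (dlp N t) * cIm (zp N t)).
  by rewrite -cReM; case: (_ * _).
have -> : cIm (- (dlp N t * zp N t)) = - (cRe (dlp N t) * cIm (zp N t) + cIm (dlp N t) * cRe (zp N t)).
  by rewrite -cImM; case: (_ * _).
rewrite -/(zp N t) -/(dzp N t); ring.
Qed.

Let Im_f_der (N : nat) (t : R) : is_derive t 1 (fun t => cIm (f N t)) (cIm (df N t)).
Proof.
under eq_fun do rewrite cIm_mul_cexpN -mulrN.
have NS : is_derive t 1 (fun t => - sin (cIm (lp N t))) (- (cos (cIm (lp N t)) * cIm (dlp N t))).
  exact: (@is_deriveN _ _ _ (fun t => sin (cIm (lp N t))) t 1 _ (sin_der N t)).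
apply: is_derive_eq.
  exact: (combine_der (exp_der N t) (cos_der N t) NS (Im_der z N t) (Re_der z N t)).
rewrite cIm_mul_cexpN cReD cImD.
have -> : cRe (- (dlp N t * zp N t)) = - (cRe (dlp N t) * cRe (zp N t) - cIm (dlp N t) * cIm (zp N t)).
  by rewrite -cReM; case: (_ * _).
have -> : cIm (- (dlp N t * zp N t)) = - (cRe (dlp N t) * cIm (zp N t) + cIm (dlp N t) * cRe (zp N t)).
  by rewrite -cImM; case: (_ * _).
rewrite -/(zp N t) -/(dzp N t); ring.
Qed.

Let MVT01 (g dg : R -> R) M : (forall t : R, is_derive t 1 g (dg t)) ->
  (forall t, 0 <= t <= 1 -> `|dg t| <= M) -> `|g 1 - g 0| <= M.
Proof.
move=> Hg HM; have cg : {within `[0, 1], continuous g}.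
  by apply: derivable_within_continuous => x _; have [] := Hg x.
have [c c01 ->] := @MVT_segment _ g dg 0 1 ler01 (fun x _ => Hg x) cg.
by rewrite subr0 mulr1; apply: HM; move: c01; rewrite in_itv.
Qed.

Hypothesis z0 : z 0%N = 1.
Hypothesis l0 : l 0%N = 0.
(** Coefficient by coefficient, this is the differential equation z' = l' z. *)
Hypothesis zrec : forall n,
  n.+1%:R * z n.+1 = \sum_(k < n.+1) (k.+1%:R * l k.+1) * z (n - k)%N.
Variables C D : R.
Hypothesis lC : forall N, \sum_(n < N) n%:R * cmod (l n) <= C.
Hypothesis zD : forall N, \sum_(n < N) cmod (z n) <= D.

Let A k := k.+1%:R * cmod (l k.+1).
Let B m := cmod (z m).
Let SA N := \sum_(k < N) A k.
Let SB N := \sum_(m < N) B m.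
Let A_ge0 k : 0 <= A k. Proof. by rewrite mulr_ge0 ?cmod_ge0. Qed.
Let B_ge0 m : 0 <= B m. Proof. exact: cmod_ge0. Qed.

Let SA_le N : SA N <= C.
Proof. by apply: le_trans (lC N.+1); rewrite big_ord_recl /= mul0r add0r. Qed.

(* The part of the product of the first [N] terms of the two series that lies
   beyond the triangle [k + m < N]. *)
Let eps N := SA N * (SB N.+1 - SB N./2) + (SA N - SA N./2) * SB N.+1.

Let tail_sum (F : nat -> R) (h M : nat) : (h <= M)%N ->
  \sum_(m < M) (h <= m)%N%:R * F m = \sum_(m < M) F m - \sum_(m < h) F m.
Proof.
move=> hM; rewrite (big_ord_widen M F hM) [X in _ - X]big_mkcond -sumrB.
by apply: eq_bigr => m _; case: ltnP => _; rewrite ?mul0r ?mul1r ?subrr ?subr0.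
Qed.

(** By [zrec], the derivative of the truncated z is the sum over k + m < N, whereas the product runs
    over the rectangle k < N, m <= N. The difference consists of the pairs with k + m >= N. *)
Let remainder_le N (t : R) : 0 <= t <= 1 ->
  cmod (dzp N.+1 t - dlp N.+1 t * zp N.+1 t) <= eps N.
Proof.
move=> /andP[t0 t1].
pose a k := k.+1%:R * l k.+1 * (t ^+ k)%:C.
pose b m := z m * (t ^+ m)%:C.
have natC n : (n%:R : R)%:C = n%:R :> R[i] by rewrite rmorph_nat.
have dlpE : dlp N.+1 t = \sum_(k < N) a k.
  rewrite /dlp big_ord_recl l0 mul0r add0r; apply: eq_bigr => k _.
  by rewrite lift0 /a rmorphM /= natC; ring.
have dzpE : dzp N.+1 t = \sum_(n < N) \sum_(k < n.+1) a k * b (n - k)%N.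
  rewrite /dzp big_ord_recl mul0r mulr0 add0r; apply: eq_bigr => n _.
  rewrite lift0 rmorphM /= natC mulrA [z _ * _]mulrC zrec big_distrl /=.
  apply: eq_bigr => k _; rewrite /a /b.
  have -> : t ^+ n = t ^+ k * t ^+ (n - k) by rewrite -exprD subnKC// -ltnS.
  by rewrite rmorphM; ring.
rewrite dzpE dlpE (sum_triangle (fun k m => a k * b m)) /zp big_distrlr /= -sumrB.
apply: le_trans (cmod_sum _ _ _) _.
set h := N./2; have hN : (h <= N)%N by rewrite /h; lia.
have epsE : eps N = \sum_(k < N) \sum_(m < N.+1)
    ((h <= m)%N%:R + (h <= k)%N%:R) * (A k * B m).
  transitivity (\sum_(k < N) \sum_(m < N.+1) (A k * ((h <= m)%N%:R * B m) +
      ((h <= k)%N%:R * A k) * B m)); last first.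
    by apply: eq_bigr => k _; apply: eq_bigr => m _; ring.
  rewrite /eps -(tail_sum B (leqW hN)) -(tail_sum A hN) /SA /SB !big_distrlr /=.
  by rewrite -big_split /=; apply: eq_bigr => k _; rewrite -big_split.
rewrite epsE; apply: ler_sum => k _.
rewrite (big_ord_widen N.+1 (fun m => a k * b m)); last by rewrite leqW// leq_subr.
rewrite big_mkcond /= -sumrB; apply: le_trans (cmod_sum _ _ _) _.
apply: ler_sum => m _; rewrite -/(b m).
have tn n : `|t ^+ n| <= 1 by rewrite normrX ger0_norm// exprn_ile1.
have abAB : cmod (a k * b m) <= A k * B m.
  rewrite cmodM; apply: ler_pM; rewrite ?cmod_ge0//.
    by rewrite /a !cmodM cmod_nat cmod_real ler_piMr// mulr_ge0 ?cmod_ge0.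
  by rewrite /b cmodM cmod_real ler_piMr// cmod_ge0.
have AB0 : 0 <= A k * B m by rewrite mulr_ge0.
case: ltnP => kmN; first by rewrite subrr cmod0 mulr_ge0// addr_ge0.
rewrite sub0r cmodN; apply: le_trans abAB _; apply: ler_peMl => //.
(* Outside the triangle one of the two indices is at least [N./2], so the indicator sum in [epsE] is
   at least 1. *)
case: (leqP h m) => hm; first by rewrite lerDl.
case: (leqP h k) => hk; first by rewrite add0r.
by exfalso; move: kmN hm hk; rewrite /h; have := ltn_ord k; lia.
Qed.

Let cmod_l_le N : \sum_(n < N) cmod (l n) <= C.
Proof.
apply: le_trans (lC N); apply: ler_sum => -[[|n] nN] _ /=.
  by rewrite l0 cmod0 mulr0.
by rewrite ler_peMl ?cmod_ge0// (ler_nat _ 1).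
Qed.

Let cmod_lp_le N (t : R) : 0 <= t <= 1 -> cmod (lp N t) <= C.
Proof.
move=> /andP[t0 t1]; apply: le_trans (cmod_l_le N).
apply: le_trans (cmod_sum _ _ _) _; apply: ler_sum => n _.
by rewrite cmodM cmod_real ler_piMr ?cmod_ge0// normrX ger0_norm// exprn_ile1.
Qed.

(** The mean value theorem holds for real functions only; using it for both parts costs the factor
    2. *)
Let f1_le N : cmod (f N.+1 1 - 1) <= 2 * (eps N * expR C).
Proof.
have f0 : f N.+1 0 = 1.
  have zp0 : zp N.+1 0 = 1.
    rewrite /zp big_ord_recl z0 mul1r expr0 big1 ?addr0// => n _.
    by rewrite /bump /= exprS mul0r mulr0.
  have lp0 : lp N.+1 0 = 0.
    rewrite /lp big_ord_recl l0 mul0r add0r big1// => n _.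
    by rewrite /bump /= exprS mul0r mulr0.
  by rewrite /f zp0 lp0 oppr0 cexp0 mulr1.
have df_le (t : R) : 0 <= t <= 1 -> cmod (df N.+1 t) <= eps N * expR C.
  move=> t01; rewrite /df cmodM cmod_cexp; apply: ler_pM; rewrite ?cmod_ge0 ?expR_ge0//.
    exact: remainder_le.
  rewrite ler_expR; apply: le_trans (cmod_lp_le N.+1 t01).
  by rewrite -cmodN; apply: le_trans (ler_norm _) (cRe_le_cmod _).
rewrite -f0; apply: le_trans (cmod_le_ReIm _) _.
rewrite cReD cImD cReN cImN mulr_natl mulr2n; apply: lerD.
  apply: (MVT01 (Re_f_der N.+1)) => t t01.
  exact: le_trans (cRe_le_cmod _) (df_le t t01).
apply: (MVT01 (Im_f_der N.+1)) => t t01.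
exact: le_trans (cIm_le_cmod _) (df_le t t01).
Qed.

Let zs N := \sum_(n < N) z n.
Let ls N := \sum_(n < N) l n.

Let zs_ls_le N : cmod (zs N.+1 - cexp (ls N.+1)) <= 2 * (eps N * expR C) * expR C.
Proof.
have t01 : 0 <= (1 : R) <= 1 by rewrite lexx ler01.
have zE : zp N.+1 1 = zs N.+1 by apply: eq_bigr => n _; rewrite expr1n mulr1.
have lE : lp N.+1 1 = ls N.+1 by apply: eq_bigr => n _; rewrite expr1n mulr1.
have -> : zs N.+1 - cexp (ls N.+1) = (f N.+1 1 - 1) * cexp (ls N.+1).
  by rewrite /f zE lE mulrBl mul1r -mulrA cexpNK mulr1.
rewrite cmodM cmod_cexp; apply: ler_pM; rewrite ?cmod_ge0 ?expR_ge0//.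
rewrite ler_expR; apply: le_trans (ler_norm _) (le_trans (cRe_le_cmod _) _).
by rewrite -lE; exact: cmod_lp_le.
Qed.

Let bounded_series_cvg (F : nat -> R) K : (forall n, 0 <= F n) ->
  (forall N, \sum_(n < N) F n <= K) -> cvgn (fun N => \sum_(n < N) F n).
Proof.
move=> F0 FK; apply: nondecreasing_is_cvgn.
  by apply/nondecreasing_seqP => N; rewrite big_ord_recr lerDl.
by exists K => _ [N _ <-].
Qed.

Let half_cvg : (fun N : nat => N./2) @ \oo --> \oo.
Proof.
apply/cvgnyPge => M; near=> N.
have : (M.*2 <= N)%N by near: N; exact: nbhs_infty_ge.
by lia.
Unshelve. all: by end_near. Qed.

(** [SA] and [SB] converge, being monotone and bounded, and the half-index sequences have the same
    limits; so both differences vanish in the limit. *)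
Let eps_cvg : eps @ \oo --> (0 : R).
Proof.
have cA : cvgn SA by apply: bounded_series_cvg SA_le.
have cB : cvgn SB by apply: bounded_series_cvg zD.
have cAh : (fun N => SA N./2) @ \oo --> limn SA by apply: cvg_comp half_cvg cA.
have cBh : (fun N => SB N./2) @ \oo --> limn SB by apply: cvg_comp half_cvg cB.
have cBS : (fun N => SB N.+1) @ \oo --> limn SB by rewrite (cvg_shiftS SB).
have -> : (0 : R) = limn SA * (limn SB - limn SB) + (limn SA - limn SA) * limn SB.
  by rewrite !subrr mulr0 mul0r addr0.
apply: cvgD; apply: cvgM => //; apply: cvgB => //.
Qed.

Let part_cvg (g : R[i] -> R) : (forall w, `|g w| <= cmod w) ->
  cvgn (fun N => \sum_(n < N) g (l n)).
Proof.
move=> gle.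
have serE (F : nat -> R) : series F = (fun N => \sum_(n < N) F n).
  by apply/funext => N; rewrite seriesEord.
rewrite -(serE (fun n => g (l n))); apply: normed_cvg.
suff : cvgn (series (fun n => `|g (l n)|)) by [].
rewrite serE; apply: (@bounded_series_cvg (fun n => `|g (l n)|) C) => // N.
by apply: le_trans (cmod_l_le N); apply: ler_sum => n _; exact: gle.
Qed.

Lemma power_series_exp : exists S : R[i],
  (fun N => cmod (ls N - S)) @ \oo --> (0 : R) /\
  (fun N => cmod (zs N - cexp S)) @ \oo --> (0 : R).
Proof.
have cr := part_cvg cRe_le_cmod; have ci := part_cvg cIm_le_cmod.
pose S := limn (fun N => \sum_(n < N) cRe (l n)) +i* limn (fun N => \sum_(n < N) cIm (l n)).
have lr : (fun N => cRe (ls N)) @ \oo --> cRe S.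
  by under eq_fun do rewrite cRe_sum; exact: cr.
have li : (fun N => cIm (ls N)) @ \oo --> cIm S.
  by under eq_fun do rewrite cIm_sum; exact: ci.
have dist_cvg (u : nat -> R) (w : R) : u @ \oo --> w ->
    (fun N => `|u N - w|) @ \oo --> (0 : R).
  move=> uw; rewrite -[X in _ --> X](@normr0 _ R) -(subrr w).
  by apply: cvg_norm; apply: cvgB => //; exact: cvg_cst.
have cmod_cvg (u : nat -> R[i]) (w : R[i]) :
    (fun N => cRe (u N)) @ \oo --> cRe w -> (fun N => cIm (u N)) @ \oo --> cIm w ->
    (fun N => cmod (u N - w)) @ \oo --> (0 : R).
  move=> ur ui.
  apply: (@squeeze_cvgr _ _ _ _ (fun=> 0) (fun N => `|cRe (u N) - cRe w| + `|cIm (u N) - cIm w|)).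
  - apply: nearW => N; rewrite cmod_ge0 /=; apply: le_trans (cmod_le_ReIm _) _.
    by rewrite cReD cImD cReN cImN.
  - exact: cvg_cst.
  - by rewrite -[X in _ --> X]addr0; apply: cvgD; exact: dist_cvg.
exists S; split; first exact: cmod_cvg.
have cexp_cvg : (fun N => cmod (cexp (ls N) - cexp S)) @ \oo --> (0 : R).
  apply: cmod_cvg.
    under eq_fun do rewrite cRe_cexp; rewrite cRe_cexp; apply: cvgM.
      by apply: continuous_cvg => //; exact: continuous_expR.
    by apply: continuous_cvg => //; exact: continuous_cos.
  under eq_fun do rewrite cIm_cexp; rewrite cIm_cexp; apply: cvgM.
    by apply: continuous_cvg => //; exact: continuous_expR.
  by apply: continuous_cvg => //; exact: continuous_sin.
rewrite -(cvg_shiftS (fun N => cmod (zs N - cexp S))).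
apply: (@squeeze_cvgr _ _ _ _ (fun=> 0) (fun N => 2 * (eps N * expR C) * expR C +
   cmod (cexp (ls N.+1) - cexp S))).
- apply: nearW => N; rewrite cmod_ge0 /=.
  rewrite -(subrKA (cexp (ls N.+1))); apply: le_trans (cmodD _ _) _.
  by apply: lerD => //; exact: zs_ls_le.
- exact: cvg_cst.
- have -> : (0 : R) = 2 * (0 * expR C) * expR C + 0 by rewrite mul0r mulr0 mul0r addr0.
  apply: cvgD; last by rewrite (cvg_shiftS (fun N => cmod (cexp (ls N) - cexp S))).
  by apply: cvgMl; apply: cvgMr; apply: cvgMl.
Qed.

End PowerSeriesExp.

(** * The cluster expansion *)

Section ExpBound.
Context {R : realType}.

Lemma norm_sin_le (x : R) : `|sin x| <= `|x|.
Proof.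
wlog x0 : x / 0 <= x.
  move=> H; have [/H//|x0] := leP 0 x.
  by rewrite -normrN -sinN -[leRHS]normrN H// oppr_ge0 ltW.
have cs : {within `[0, x], continuous (@sin R)}.
  by apply: derivable_within_continuous => y _; have [] := is_derive_sin y.
have [c _] := @MVT_segment _ sin cos 0 x x0 (fun y _ => is_derive_sin y) cs.
rewrite sin0 !subr0 => ->; rewrite normrM ler_piMl//; exact: cos_max.
Qed.

(** Half-angle formula: 1 - cos x = 2 sin(x/2)^2 <= x^2 / 2. *)
Lemma cos_ge (x : R) : 1 - x ^+ 2 / 2 <= cos x.
Proof.
have -> : x = (x / 2) *+ 2 by rewrite -mulr_natr divfK.
rewrite cos_mulr2n cos2sin2.
have : sin (x / 2) ^+ 2 <= (x / 2) ^+ 2.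
  by rewrite -ler_sqrt ?sqr_ge0// !sqrtr_sqr; exact: norm_sin_le.
have -> : (x / 2 *+ 2) ^+ 2 / 2 = 2 * (x / 2) ^+ 2 by rewrite -mulr_natr; field.
by rewrite mulr2n; lra.
Qed.

(** For w = p + i q, |e^w - 1|^2 = (e^p - 1)^2 + 2 e^p (1 - cos q). With M = max(1, e^p), the first
    term is at most p^2 M^2, and the second at most e^p q^2 <= M^2 q^2. *)
Lemma cmod_cexp_sub1_le (w : R[i]) :
  cmod (cexp w - 1) <= cmod w * Num.max 1 (expR (cRe w)).
Proof.
set p := cRe w; set q := cIm w; set e := expR p; set M := Num.max 1 e.
have e0 : 0 < e by exact: expR_gt0.
have M1 : 1 <= M by rewrite le_max lexx.
have Me : e <= M by rewrite le_max lexx orbT.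
have M0 : 0 <= M by exact: le_trans M1.
have eM : e <= M ^+ 2 by rewrite (le_trans Me)// expr2 ler_peMr.
have pM : (e - 1) ^+ 2 <= p ^+ 2 * M ^+ 2.
  rewrite -exprMn -ler_sqrt ?sqr_ge0// !sqrtr_sqr normrM (ger0_norm M0).
  have [p0|p0] := leP 0 p.
    have e1 : 1 <= e by rewrite -expR0 ler_expR.
    rewrite (ger0_norm p0) ger0_norm ?subr_ge0//.
    apply: (@le_trans _ _ (p * e)); last by rewrite ler_wpM2l.
    have : (1 - p) * e <= expR (- p) * e.
      by rewrite ler_pM2r//; exact: expR_ge1Dx.
    by rewrite [expR (- p) * e]mulrC expRxMexpNx_1; lra.
  have e1 : e <= 1 by rewrite /e expR_le1 ltW.
  rewrite (ltr0_norm p0) ler0_norm ?subr_le0//.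
  apply: (@le_trans _ _ (- p)); first by have := expR_ge1Dx p; rewrite -/e; lra.
  by rewrite ler_peMr// oppr_ge0 ltW.
have cq := cos_ge q.
have [cm0 wm0] := (cmod_ge0 (cexp w - 1), cmod_ge0 w).
rewrite -(ger0_norm cm0) -sqrtr_sqr -[leRHS]ger0_norm ?mulr_ge0// -sqrtr_sqr.
rewrite ler_sqrt ?sqr_ge0// exprMn !cmod_sqr.
rewrite cReD cImD cReN cImN cRe_cexp cIm_cexp -/p -/q -/e /= subr0.
have -> : (e * cos q - 1) ^+ 2 + (e * sin q) ^+ 2 = (e - 1) ^+ 2 + 2 * e * (1 - cos q).
  have s2 : sin q ^+ 2 = 1 - cos q ^+ 2 by rewrite sin2cos2.
  by rewrite [(e * sin q) ^+ 2]exprMn s2; ring.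
have cq' : 1 - cos q <= q ^+ 2 / 2 by lra.
have : 2 * e * (1 - cos q) <= M ^+ 2 * q ^+ 2.
  apply: (@le_trans _ _ (2 * e * (q ^+ 2 / 2))).
    by rewrite ler_wpM2l// mulr_ge0// ltW.
  have -> : 2 * e * (q ^+ 2 / 2) = e * q ^+ 2 by field.
  by rewrite ler_wpM2r// sqr_ge0.
by rewrite mulrDl; lra.
Qed.

Context {d : measure_display} {X : measurableType d}.
Variables (ur : X * X -> \bar R) (ui : X * X -> R).

(** With w = -u, the exponential e^{Re w} is |1 + zeta|. In the hard-core case zeta = -1, and the
    convention ubar = 1 makes both sides equal to 1. *)
Lemma cmod_zeta_le_ubar x y : cmod (zeta ur ui x y) <=
  cmod (ubar ur ui x y) * Num.max 1 (cmod (1 + zeta ur ui x y)).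
Proof.
rewrite /zeta /ubar; case: ifP => _.
  by rewrite cmodN cmod1 mul1r le_max lexx.
set u := _ +i* _; rewrite addrCA subrr addr0 cmod_cexp -(cmodN u).
exact: cmod_cexp_sub1_le.
Qed.

End ExpBound.

Section ClusterExpansion.
Context {R : realType} {d : measure_display} {X : measurableType d}.
Variables (nu : {finite_measure set X -> \bar R}) (h : X -> R[i]).
Variables (ur : X * X -> \bar R) (ui : X * X -> R) (a b : X -> R) (t : X -> X -> R).
Hypotheses (mh : cmeasurable h) (h1 : forall x, cmod (h x) = 1).
Hypotheses (mur : measurable_fun setT ur) (mui : measurable_fun setT ui).
Hypotheses (ma : measurable_fun setT a) (mb : measurable_fun setT b).
Hypotheses (a0 : forall x, 0 <= a x) (b0 : forall x, 0 <= b x).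
Hypotheses (t0 : forall x y, 0 <= t x y) (tsym : forall x y, t x y = t y x).
Hypothesis mt : measurable_fun setT (fun p : X * X => t p.1 p.2).
Hypothesis zle : forall x y,
  cmod (zeta ur ui x y) <= t x y * Num.max 1 (cmod (1 + zeta ur ui x y)).
Hypothesis ae_good : {ae nu, forall x,
  (\int[nu]_y (t x y * expR (b y) * expR (a y))%:E <= (a x)%:E)%E}.
Hypothesis stability : forall n : nat, prod_ae nu n (fun s =>
  \prod_(i < size s) \prod_(j < size s | (i < j)%N)
    cmod (1 + zeta ur ui (nth point s i) (nth point s j))
  <= \prod_(i < size s) expR (b (nth point s i))).
Hypothesis integrability : (\int[nu]_y (expR (a y + 2 * b y))%:E < +oo)%E.

Let cs := conn_sum point (zeta ur ui).

Let csE s : cs s = (size s)`!%:R * phi ur ui s.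
Proof. by rewrite phiE mulrA divff ?mul1r// pnatr_eq0 -lt0n fact_gt0. Qed.

Let igood_phi n : igood nu n (phi ur ui).
Proof.
split; first exact: csmeas_phi.
exact: (iabs_phi_lty mur mui ma mb a0 b0 t0 tsym mt zle ae_good stability integrability).
Qed.

Let igood_cs n : igood nu n cs.
Proof.
split; first exact: csmeas_conn_sum.
have [mphi phi_fin] := igood_phi n.
rewrite (@eq_iabs _ _ _ nu n _ (fun s => n`!%:R%:E * (cmod (phi ur ui s))%:E)%E).
  rewrite iabsZl//; [|by move=> s; exact: Fabs_ge0|exact: smeas_Fabs].
  rewrite ltey_eq; apply/orP; left; rewrite fin_numM// ge0_fin_numE//.
  by apply: iabs_ge0 => s; exact: Fabs_ge0.
by move=> s sn; rewrite csE sn cmodM cmod_nat EFinM.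
Qed.

Let igood_Z n : igood nu n (Zterm ur ui).
Proof.
split; first exact: csmeas_Zterm.
have [C [_ HC]] := iabs_Zterm_le mur mui ma mb a0 b0 stability integrability.
exact: le_lt_trans (HC n) (ltry _).
Qed.

Let z n := (n`!%:R)^-1 * iint nu h n (Zterm ur ui).
(** [phi] of the empty list is 1, whereas the logarithm series has no term of order 0. *)
Let l n := if n == 0%N then 0 else iint nu h n (phi ur ui).

Let iint_cs n : iint nu h n cs = n`!%:R * iint nu h n (phi ur ui).
Proof.
rewrite -(iintZl mh h1)//; apply: eq_iint => s sn.
by rewrite csE sn.
Qed.

(** The factorials combine to C(n, k) (k + 1)! / n! = (k + 1) / (n - k)!. The factor k + 1 remains
    because the first vertex is singled out. *)
Let zrec n : n.+1%:R * z n.+1 = \sum_(k < n.+1) (k.+1%:R * l k.+1) * z (n - k)%N.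
Proof.
have key : iint nu h n.+1 (Zterm ur ui) =
    binomial_sum (fun k m => iint nu h k.+1 cs * iint nu h m (Zterm ur ui)) n.
  apply: (iint_cons_splits mh h1 n igood_cs igood_Z (csmeas_Zterm mur mui)) => x J.
  rewrite !ZtermE (pairs_prod1D_splits point); apply: eq_splits => K L _.
  by rewrite ZtermE.
have lE k : l k.+1 = iint nu h k.+1 (phi ur ui) by [].
rewrite /z key /binomial_sum !big_distrr; apply: eq_bigr => k _.
have kn : (k <= n)%N by rewrite -ltnS.
rewrite iint_cs lE.
move: (iint nu h k.+1 (phi ur ui)) (iint nu h (n - k) (Zterm ur ui)) => P Q /=.
rewrite -[_ *+ 'C(n, k)]mulr_natl !factS -(bin_fact kn) !natrM; field.
by rewrite nat1r !pnatr_eq0 -!lt0n !fact_gt0 bin_gt0 kn.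
Qed.

Lemma cluster_expansion :
  (\sum_(1 <= n <oo) iabs nu n (fun s => (cmod (phi ur ui s))%:E) < +oo)%E /\
  (exists S : R[i],
     (fun N => cmod (logZpartial nu h ur ui N - S)) @ \oo --> (0 : R) /\
     (fun N => cmod (Zpartial nu h ur ui N - cexp S)) @ \oo --> (0 : R)) /\
  {ae nu, forall x1,
     (\sum_(2 <= n <oo) (n%:R)%:E *
         iabs nu n.-1 (fun s => (cmod (phi ur ui (x1 :: s)))%:E)
      <= ((expR (a x1) - 1) * expR (b x1))%:E)%E}.
Proof.
split.
  exact: (phi_summable mur mui ma mb a0 b0 t0 tsym mt zle ae_good stability integrability).
split; last first.
  apply: filterS (phi_ok_ae mur mui mb ae_good stability) => x okx.
  exact: (phi_sum_le mur mui ma mb a0 t0 tsym mt zle ae_good okx).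
have [C HC] := phi_integral_bound mur mui ma mb a0 b0 t0 tsym mt zle ae_good stability integrability.
have [D [D0 HD]] := iabs_Zterm_le mur mui ma mb a0 b0 stability integrability.
have z0 : z 0%N = 1 by rewrite /z /= invr1 mul1r /Zterm big_ord0.
have lC N : \sum_(n < N) n%:R * cmod (l n) <= C.
  rewrite -lee_fin; apply: le_trans (HC N); rewrite -sumEFin; apply: lee_sum => n _.
  rewrite EFinM; apply: lee_wpmul2l; first by rewrite lee_fin.
  rewrite /l; case: ifP => _; last by apply: cmod_iint_le => //; exact: csmeas_phi.
  by rewrite cmod0; apply: iabs_ge0 => s; exact: Fabs_ge0.
have zD N : \sum_(n < N) cmod (z n) <= expR D.
  apply: le_trans (exp_partial_sum_le N D0); apply: ler_sum => n _.
  rewrite /z cmodM cmodE Normc.normcV -cmodE cmod_nat ler_wpM2l ?invr_ge0//.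
  rewrite -lee_fin; apply: le_trans (HD n); apply: cmod_iint_le => //.
  exact: csmeas_Zterm.
have [S [lS zS]] := power_series_exp z0 (erefl : l 0%N = 0) zrec lC zD.
have lsE N : logZpartial nu h ur ui N = \sum_(n < N) l n.
  case: N => [|N]; first by rewrite /logZpartial big_geq// big_ord0.
  rewrite /logZpartial -(big_mkord xpredT l) [RHS]big_ltn// add0r.
  by apply: eq_big_nat => n /andP[n0 _]; rewrite /l eqn0Ngt n0.
by exists S; split => //; under eq_fun do rewrite lsE.
Qed.

End ClusterExpansion.

Theorem mainTheorem1 (R : realType) (d : measure_display) (X : measurableType d)
  (nu : {finite_measure set X -> \bar R}) (h : X -> R[i])
  (ur : X * X -> \bar R) (ui : X * X -> R) (a b : X -> R) :
  (* the complex measure mu = h . nu, with nu = |mu| *)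
  measurable_fun setT (fun x => cRe (h x)) ->
  measurable_fun setT (fun x => cIm (h x)) ->
  (forall x, cmod (h x) = 1) ->
  (* u = ur + i ui complex, measurable, symmetric, Re u in (-oo, +oo] *)
  measurable_fun setT ur -> measurable_fun setT ui ->
  (forall p, ur p != -oo%E) ->
  (forall x y, ur (x, y) = ur (y, x)) -> (forall x y, ui (x, y) = ui (y, x)) ->
  (* a, b nonnegative measurable functions *)
  measurable_fun setT a -> measurable_fun setT b ->
  (forall x, 0 <= a x) -> (forall x, 0 <= b x) ->
  (* Assumption 1 (stability) *)
  (forall n : nat, prod_ae nu n (fun s =>
      \prod_(i < size s) \prod_(j < size s | (i < j)%N)
         cmod (1 + zeta ur ui (nth point s i) (nth point s j))
      <= \prod_(i < size s) expR (b (nth point s i)))) ->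
  (* integrability *)
  (\int[nu]_y (expR (a y + 2 * b y))%:E < +oo)%E ->
  let conclusion (c : R) :=
    (* absolute convergence of the series in the exponential *)
    (\sum_(1 <= n <oo) iabs nu n (fun s => (cmod (phi ur ui s))%:E) < +oo)%E /\
    (* Z = exp { sum_{n>=1} int...int phi } *)
    (exists S : R[i],
       (fun N => cmod (logZpartial nu h ur ui N - S)) @ \oo --> (0 : R) /\
       (fun N => cmod (Zpartial nu h ur ui N - cexp S)) @ \oo --> (0 : R)) /\
    (* the pointwise bound, for |mu|-almost all x1 *)
    {ae nu, forall x1,
       (\sum_(2 <= n <oo) (n%:R)%:E *
           iabs nu n.-1 (fun s => (cmod (phi ur ui (x1 :: s)))%:E)
        <= ((expR (a x1) - 1) * expR (c * b x1))%:E)%E} in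
  (* Assumption 2 *)
  ({ae nu, forall x,
      (\int[nu]_y (cmod (zeta ur ui x y) * expR (a y + 2 * b y))%:E <= (a x)%:E)%E}
     -> conclusion 2) /\
  (* Assumption 2' *)
  ({ae nu, forall x,
      (\int[nu]_y (cmod (ubar ur ui x y) * expR (a y + b y))%:E <= (a x)%:E)%E}
     -> conclusion 1).
Proof.
move=> mhr mhi h1 mur mui urNy urS uiS ma mb a0 b0 stab integ conclusion.
have mh : cmeasurable h by split.
have zsym x y : zeta ur ui x y = zeta ur ui y x by rewrite /zeta urS uiS.
have usym x y : ubar ur ui x y = ubar ur ui y x by rewrite /ubar urS uiS.
have mz := measurable_cmod (measurable_zeta mur mui).
have mu := measurable_cmod (measurable_ubar mur mui).
have ge1 (r : R) : 1 <= Num.max 1 r by rewrite le_max lexx.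
have mexp : measurable_fun setT (fun y => expR (b y) * expR (a y)).
  by apply: measurable_funM; exact: measurableT_comp.
split=> ae_good.
  have [||sum1 [ex1 ae1]] := @cluster_expansion _ _ _ nu h ur ui a b
    (fun x y => cmod (zeta ur ui x y)) mh h1 mur mui ma mb a0 b0
    (fun _ _ => cmod_ge0 _) (fun x y => congr1 cmod (zsym x y)) mz _ _ stab integ.
  - by move=> x y; rewrite ler_peMr ?cmod_ge0.
  (* Since [b] is nonnegative, e^{a + b} is dominated by the e^{a + 2b} of Assumption 2. *)
  - apply: filterS ae_good => x; apply: le_trans; apply: ge0_le_integral => //.
    + by move=> y _; rewrite lee_fin !mulr_ge0 ?cmod_ge0 ?expR_ge0.
    + apply/measurable_EFinP; under eq_fun do rewrite -mulrA.
      by apply: measurable_funM => //; exact: measurableT_comp mz (pair1_measurable x).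
    + apply/measurable_EFinP; apply: measurable_funM.
        exact: measurableT_comp mz (pair1_measurable x).
      apply: measurableT_comp => //; apply: measurable_funD => //.
      exact: measurable_funM.
    + move=> y _; rewrite lee_fin -mulrA ler_wpM2l ?cmod_ge0// -expRD ler_expR.
      by have := b0 y; lra.
  (* The bound obtained has [expR (b x1)]; it is relaxed to the factor with [2 * b x1], using
     [0 <= expR (a x1) - 1]. *)
  split=> //; split=> //; apply: filterS ae1 => x1 H; apply: le_trans H _.
  rewrite lee_fin ler_wpM2l// ?ler_expR; last by have := b0 x1; lra.
  by rewrite subr_ge0 -expR0 ler_expR.
have [||sum1 [ex1 ae1]] := @cluster_expansion _ _ _ nu h ur ui a b
  (fun x y => cmod (ubar ur ui x y)) mh h1 mur mui ma mb a0 b0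
  (fun _ _ => cmod_ge0 _) (fun x y => congr1 cmod (usym x y)) mu _ _ stab integ.
- exact: cmod_zeta_le_ubar.
- apply: filterS ae_good => x; apply: le_trans; rewrite le_eqVlt; apply/orP; left.
  by apply/eqP; apply: eq_integral => y _; rewrite -mulrA -expRD addrC.
split=> //; split=> //; apply: filterS ae1 => x1; by rewrite mul1r.
Qed.
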